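(* Let $\Omega\subset\mathbb R$ be a bounded open interval, let $\Phi_1,\Phi_2\in C^1(\Omega)\cap W^{1,\infty}(\Omega)$ satisfy $-\partial_x\Phi_1\ge-\partial_x\Phi_2$ in $\Omega$ and $\partial^2_{xx}\Phi_i\ge0$ in $\Omega$, $i=1,2$. Let $\rho^i_0=\chi_{(a^i(0),b^i(0))}$ with $(a^i(0),b^i(0))\subset\Omega$, $i=1,2$, be such that $x_1\ge x_2$ whenever $x_i\in\{\rho^i_0>0\}$, and assume $|\Omega|>(b^1(0)-a^1(0))+(b^2(0)-a^2(0))$. Let $(\rho^{1,\infty},\rho^{2,\infty},p^\infty)$ be a weak solution of $(\mathrm{PME}_\infty)$ with these initial data whose densities are obtained as a (subsequential, as $\tau\downarrow0$) limit of the time-discrete solutions of the minimizing movement scheme with $m=\infty$. Then $\rho^{i,\infty}$ remains a patch for all $t>0$, i.e. $\rho^{i,\infty}_t=\chi_{(a^i(t),b^i(t))}$ for some interval $(a^i(t),b^i(t))$, $i=1,2$. Moreover the density pair is in this case a solution of the two-phase Hele-Shaw type flow with drifts described in the context.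
   Context: Notation. For $M>0$, $\mathscr P^M(\Omega)$ is the set of nonnegative Radon measures on $\Omega$ of total mass $M$ (measures may be regarded as living on $\overline\Omega$); absolutely continuous measures are identified with their densities. $W_2$ is the 2-Wasserstein distance on $\mathscr P^M(\Omega)$. $AC^2([0,T];(\mathscr P^M(\Omega),W_2))$ is the set of absolutely continuous curves whose metric derivative lies in $L^2(0,T)$. $M_i=b^i(0)-a^i(0)$. Scheme ($m=\infty$). $\mathcal F_\infty(\rho^1,\rho^2)=0$ if $\|\rho^1+\rho^2\|_{L^\infty}\le1$ and $+\infty$ otherwise; $\mathcal G(\rho^1,\rho^2)=\int\Phi_1\,d\rho^1+\int\Phi_2\,d\rho^2$. Given $\tau>0$, $N\in\mathbb N$ with $N\tau=T$, set $\rho^{i,\tau}_0=\rho^i_0$ and let $(\rho^{1,\tau}_{k+1},\rho^{2,\tau}_{k+1})$ be the unique minimizer over $\mathscr P^{M_1}(\Omega)\times\mathscr P^{M_2}(\Omega)$ of $\mathcal F_\infty(\rho^1,\rho^2)+\mathcal G(\rho^1,\rho^2)+\frac1{2\tau}W_2^2(\rho^1,\rho^{1,\tau}_k)+\frac1{2\tau}W_2^2(\rho^2,\rho^{2,\tau}_k)$. The time-discrete solution is $\rho^{i,\tau}_t:=\rho^{i,\tau}_{k+1}$ for $t\in[k\tau,(k+1)\tau)$; limits as $\tau\downarrow0$ are taken uniformly in $t\in[0,T]$ with respect to $W_2$. A weak solution of $(\mathrm{PME}_\infty)$ is a triple $(\rho^{1,\infty},\rho^{2,\infty},p^\infty)$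 with $\rho^{i,\infty}\in AC^2([0,T];(\mathscr P^{M_i}(\Omega),W_2))\cap L^\infty([0,T]\times\Omega)$, $\|\rho^{1,\infty}+\rho^{2,\infty}\|_{L^\infty}\le1$, $p^\infty\in L^2([0,T];H^1(\Omega))$, $p^\infty\ge0$, $p^\infty(1-\rho^{1,\infty}-\rho^{2,\infty})=0$ a.e., $\rho^{i,\infty}|_{t=0}=\rho^i_0$, and $$-\int_s^t\!\int_\Omega\rho^{i,\infty}\partial_t\phi\,dx\,d\theta+\int_s^t\!\int_\Omega(\partial_xp^\infty+\partial_x\Phi_i)\,\partial_x\phi\,\rho^{i,\infty}\,dx\,d\theta=\int_\Omega\rho^{i,\infty}_s\phi(s,\cdot)\,dx-\int_\Omega\rho^{i,\infty}_t\phi(t,\cdot)\,dx$$ for all $\phi\in C^1([0,T]\times\overline\Omega)$, $0\le s<t\le T$, $i=1,2$. Two-phase Hele-Shaw type flow with drifts. The pressure satisfies $p^\infty=0$ outside $\{\rho^{1,\infty}+\rho^{2,\infty}=1\}$ and, for a.e. $t$: (i) $-\partial^2_{xx}p^\infty=\partial^2_{xx}\Phi_i$ (as distributions) in the interior of $\{\rho^{i,\infty}_t=1\}$, $i=1,2$; (ii) the outward normal velocity $V$ of the boundary of $\{\rho^{i,\infty}_t=1\}$ is $V=\nu^i_x(-\partial^i_xp^\infty-\partial_x\Phi_i)$ on $\partial\{\rho^{i,\infty}_t=1\}$, where $\nu^i_x\in\{\pm1\}$ is the outward normal of $\{\rho^{i,\infty}_t=1\}$ and $\partial^i_x$ is the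 one-sided $x$-derivative taken from the interior of $\{\rho^{i,\infty}_t=1\}$; (iii) $\partial^1_xp^\infty+\partial_x\Phi_1=\partial^2_xp^\infty+\partial_x\Phi_2$ on $\partial\{\rho^{1,\infty}_t=1\}\cap\partial\{\rho^{2,\infty}_t=1\}$. *)

(* Defs.v *)
From HB Require Import structures.
From mathcomp Require Import all_boot all_order all_algebra.
From mathcomp Require Import all_classical all_reals all_analysis.

Set Implicit Arguments.
Unset Strict Implicit.
Unset Printing Implicit Defensive.

Import Order.TTheory GRing.Theory Num.Theory.
Import numFieldNormedType.Exports.

Local Open Scope classical_set_scope.
Local Open Scope ring_scope.

Notation leb R := (@lebesgue_measure R).
Notation leb2 R := (@lebesgue_measure R \x @lebesgue_measure R)%E.

(* Functions on time x space are uncurried: [f (t, x)]. *)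

Definition topo_boundary {R : realType} (E : set R) : set R :=
  closure E `\` interior E.

Definition Lp_norm {d} {X : measurableType d} {R : realType}
    (mu : {measure set X -> \bar R}) (D : set X) (p : \bar R) (f : X -> R)
    : \bar R :=
  ('N[mu]_p[(EFin \o f) \_ D])%E.

Definition in_Lp {d} {X : measurableType d} {R : realType}
    (mu : {measure set X -> \bar R}) (D : set X) (p : \bar R) (f : X -> R)
    : Prop :=
  measurable_fun D f /\ (Lp_norm mu D p f < +oo)%E.

(* [psi] belongs to C_c^oo(U). *)
Definition test_fun {R : realType} (U : set R) (psi : R -> R) : Prop :=
  (forall (n : nat) (x : R), derivable (derive1n n psi) x 1) /\
  exists2 K : set R, compact K /\ K `<=` U & forall x, ~ K x -> psi x = 0.

Definition weak_deriv {R : realType} (U : set R) (f g : R -> R) : Prop :=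
  forall psi : R -> R, test_fun U psi ->
    (\int[leb R]_(x in U) (f x * derive1 psi x))
    = - (\int[leb R]_(x in U) (g x * psi x)).

Definition C1_on {R : realType} (U : set R) (f : R -> R) : Prop :=
  (forall x, U x -> derivable f x 1) /\ {within U, continuous derive1 f}.

Definition W1oo {R : realType} (U : set R) (f : R -> R) : Prop :=
  in_Lp (leb R) U +oo%E f /\
  exists2 g : R -> R, weak_deriv U f g & in_Lp (leb R) U +oo%E g.

(* The distribution f'' is nonnegative on U. *)
Definition distr_deriv2_ge0 {R : realType} (U : set R) (f : R -> R) : Prop :=
  forall psi : R -> R, test_fun U psi -> (forall x, 0 <= psi x) ->
    0 <= \int[leb R]_(x in U) (f x * derive1n 2 psi x).

(* The finite nonnegative Borel measures on R (all of them Radon) that are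
   carried by Omega and have total mass M. *)
Definition in_PM {R : realType} (Omega : set R) (M : R)
    (mu : {measure set R -> \bar R}) : Prop :=
  mu (~` Omega) = 0%E /\ mu setT = M%:E.

Definition has_density {R : realType} (Omega : set R)
    (mu : {measure set R -> \bar R}) (f : R -> R) : Prop :=
  measurable_fun Omega f /\
  forall A : set R, measurable A ->
    mu A = (\int[leb R]_(x in A `&` Omega) (f x)%:E)%E.

Definition coupling {R : realType} (mu nu : {measure set R -> \bar R})
    (pi : {measure set (R * R) -> \bar R}) : Prop :=
  forall A : set R, measurable A ->
    pi (A `*` setT) = mu A /\ pi (setT `*` A) = nu A.

Definition W2 {R : realType} (mu nu : {measure set R -> \bar R}) : \bar R :=
  ((ereal_inf [set (\int[pi]_z ((z.1 - z.2) ^+ 2)%:E)%E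
              | pi in coupling mu nu]) `^ (2^-1))%E.

Definition AC_curve {R : realType} (Omega : set R) (M T : R)
    (mu : R -> {measure set R -> \bar R}) : Prop :=
  (forall t, 0 <= t <= T -> in_PM Omega M (mu t)) /\
  exists2 g : R -> R, (leb R).-integrable `[0, T] (EFin \o g) &
    forall s t, 0 <= s -> s <= t -> t <= T ->
      (W2 (mu s) (mu t) <= \int[leb R]_(x in `[s, t]) (g x)%:E)%E.

Definition is_metric_deriv {R : realType}
    (mu : R -> {measure set R -> \bar R}) (t v : R) : Prop :=
  (W2 (mu s) (mu t) * (`|s - t|^-1)%:E)%E @[s --> t^'] --> v%:E.

Definition AC2_curve {R : realType} (Omega : set R) (M T : R)
    (mu : R -> {measure set R -> \bar R}) : Prop :=
  AC_curve Omega M T mu /\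
  exists2 v : R -> R, in_Lp (leb R) `]0, T[ 2%:E v &
    \forall t \ae leb R, 0 < t < T -> is_metric_deriv mu t (v t).

Definition F_oo {R : realType} (Omega : set R)
    (mu1 mu2 : {measure set R -> \bar R}) : \bar R :=
  if `[< exists f1 f2 : R -> R, [/\ has_density Omega mu1 f1,
         has_density Omega mu2 f2 &
         (Lp_norm (leb R) Omega +oo (f1 \+ f2)%R <= 1)%E] >]
  then 0%E else +oo%E.

Definition G_drift {R : realType} (Omega : set R) (Phi1 Phi2 : R -> R)
    (mu1 mu2 : {measure set R -> \bar R}) : \bar R :=
  ((\int[mu1]_(x in Omega) (Phi1 x)%:E)
   + (\int[mu2]_(x in Omega) (Phi2 x)%:E))%E.

Definition JKO_energy {R : realType} (Omega : set R) (Phi1 Phi2 : R -> R)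
    (tau : R) (nu1 nu2 mu1 mu2 : {measure set R -> \bar R}) : \bar R :=
  (F_oo Omega mu1 mu2 + G_drift Omega Phi1 Phi2 mu1 mu2
   + ((2 * tau)^-1)%:E * W2 mu1 nu1 ^+ 2
   + ((2 * tau)^-1)%:E * W2 mu2 nu2 ^+ 2)%E.

Definition JKO_minimizer {R : realType} (Omega : set R) (Phi1 Phi2 : R -> R)
    (M1 M2 tau : R) (nu1 nu2 mu1 mu2 : {measure set R -> \bar R}) : Prop :=
  [/\ in_PM Omega M1 mu1, in_PM Omega M2 mu2 &
      forall sigma1 sigma2 : {measure set R -> \bar R},
        in_PM Omega M1 sigma1 -> in_PM Omega M2 sigma2 ->
        (JKO_energy Omega Phi1 Phi2 tau nu1 nu2 mu1 mu2
         <= JKO_energy Omega Phi1 Phi2 tau nu1 nu2 sigma1 sigma2)%E].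

(* [d1 k], [d2 k] for k = 0, ..., N are the steps of the scheme; later terms of
   the two sequences are irrelevant. *)
Definition JKO_scheme {R : realType} (Omega : set R) (Phi1 Phi2 : R -> R)
    (M1 M2 : R) (rho01 rho02 : R -> R) (tau : R) (N : nat)
    (d1 d2 : nat -> {measure set R -> \bar R}) : Prop :=
  [/\ has_density Omega (d1 0%N) rho01, has_density Omega (d2 0%N) rho02 &
      forall k : nat, (k < N)%N ->
        JKO_minimizer Omega Phi1 Phi2 M1 M2 tau
          (d1 k) (d2 k) (d1 k.+1) (d2 k.+1)].

(* Equal to [d k.+1] on [k tau, (k+1) tau) for k < N; the last step [d N] is
   kept at the final time N tau. *)
Definition time_discrete {R : realType} (tau : R) (N : nat)
    (d : nat -> {measure set R -> \bar R}) (t : R)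
    : {measure set R -> \bar R} :=
  d (minn (Num.truncn (t / tau)).+1 N).

Definition W2_uniform_limit {R : realType} (T : R)
    (nu : nat -> R -> {measure set R -> \bar R})
    (mu : R -> {measure set R -> \bar R}) : Prop :=
  forall eps : R, 0 < eps -> \forall n \near \oo,
    forall t, 0 <= t <= T -> (W2 (nu n t) (mu t) < eps%:E)%E.

Definition JKO_limit {R : realType} (Omega : set R) (T : R) (Phi1 Phi2 : R -> R)
    (M1 M2 : R) (rho01 rho02 : R -> R)
    (mu1 mu2 : R -> {measure set R -> \bar R}) : Prop :=
  exists (tau : nat -> R) (N : nat -> nat)
         (d1 d2 : nat -> nat -> {measure set R -> \bar R}),
    [/\ (forall n, 0 < tau n /\ (N n)%:R * tau n = T),
        tau n @[n --> \oo] --> 0,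
        (forall n, JKO_scheme Omega Phi1 Phi2 M1 M2 rho01 rho02
                     (tau n) (N n) (d1 n) (d2 n)),
        W2_uniform_limit T (fun n => time_discrete (tau n) (N n) (d1 n)) mu1 &
        W2_uniform_limit T (fun n => time_discrete (tau n) (N n) (d2 n)) mu2].

(* [phi] is C^1 on [0, T] x closure Omega, the partial derivatives being
   continuous up to the boundary with values [phit], [phix]. *)
Definition C1_cyl {R : realType} (Omega : set R) (T : R)
    (phi phit phix : R * R -> R) : Prop :=
  let Q : set (R * R) := `[0, T]%classic `*` closure Omega in
  [/\ {within Q, continuous phi}, {within Q, continuous phit},
      {within Q, continuous phix} &
      forall t x, 0 < t < T -> Omega x ->
        is_derive t (1 : R) (fun s => phi (s, x)) (phit (t, x)) /\
        is_derive x (1 : R) (fun y => phi (t, y)) (phix (t, x))].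

(* [q] plays the role of the weak space derivative of the pressure. *)
Definition weak_transport {R : realType} (Omega : set R) (T : R)
    (Phi : R -> R) (rho q : R * R -> R) : Prop :=
  forall phi phit phix : R * R -> R, C1_cyl Omega T phi phit phix ->
  forall s t, 0 <= s -> s < t -> t <= T ->
    - (\int[leb R]_(th in `[s, t]) (\int[leb R]_(x in Omega)
         (rho (th, x) * phit (th, x))))
    + (\int[leb R]_(th in `[s, t]) (\int[leb R]_(x in Omega)
         ((q (th, x) + derive1 Phi x) * phix (th, x) * rho (th, x))))
    = (\int[leb R]_(x in Omega) (rho (s, x) * phi (s, x)))
      - (\int[leb R]_(x in Omega) (rho (t, x) * phi (t, x))).

(* [p] belongs to L^2([0, T]; H^1(Omega)) with weak space derivative [q]. *)
Definition L2H1 {R : realType} (Omega : set R) (T : R) (p q : R * R -> R)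
    : Prop :=
  let Q : set (R * R) := `[0, T]%classic `*` Omega in
  [/\ in_Lp (leb2 R) Q 2%:E p, in_Lp (leb2 R) Q 2%:E q &
      \forall t \ae leb R, 0 <= t <= T ->
        weak_deriv Omega (fun x => p (t, x)) (fun x => q (t, x))].

(* The curve [mu] in AC^2 cap L^oo, with densities [rho (t, -)] and initial
   density [rho0]. *)
Definition density_curve {R : realType} (Omega : set R) (M T : R)
    (rho0 : R -> R) (mu : R -> {measure set R -> \bar R}) (rho : R * R -> R)
    : Prop :=
  [/\ AC2_curve Omega M T mu,
      in_Lp (leb2 R) (`[0, T]%classic `*` Omega) +oo%E rho,
      (forall t, 0 <= t <= T ->
         has_density Omega (mu t) (fun x => rho (t, x))) &
      \forall x \ae leb R, Omega x -> rho (0, x) = rho0 x].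

Definition weak_solution {R : realType} (Omega : set R) (T : R)
    (Phi1 Phi2 : R -> R) (M1 M2 : R) (rho01 rho02 : R -> R)
    (mu1 mu2 : R -> {measure set R -> \bar R}) (rho1 rho2 p : R * R -> R)
    : Prop :=
  let Q : set (R * R) := `[0, T]%classic `*` Omega in
  [/\ density_curve Omega M1 T rho01 mu1 rho1,
      density_curve Omega M2 T rho02 mu2 rho2,
      (Lp_norm (leb2 R) Q +oo (rho1 \+ rho2)%R <= 1)%E,
      (\forall z \ae leb2 R, Q z ->
         0 <= p z /\ p z * (1 - rho1 z - rho2 z) = 0) &
      exists q : R * R -> R,
        [/\ L2H1 Omega T p q,
            weak_transport Omega T Phi1 rho1 q &
            weak_transport Omega T Phi2 rho2 q]].

Definition is_patch {R : realType} (Omega : set R) (f : R -> R) (a b : R)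
    : Prop :=
  [/\ a < b, `]a, b[%classic `<=` Omega &
      \forall x \ae leb R, Omega x -> f x = \1_(`]a, b[) x].

Definition outward_normal {R : realType} (E : set R) (x nu : R) : Prop :=
  [/\ nu = 1 \/ nu = -1, topo_boundary E x &
      \forall h \near (0 : R)^'+, E (x - nu * h) /\ ~ E (x + nu * h)].

(* Outward normal velocity at time t of the boundary of the moving set E, at
   the boundary point x with outward normal nu. *)
Definition normal_velocity {R : realType} (E : R -> set R)
    (t x nu V : R) : Prop :=
  exists y : R -> R,
    [/\ y t = x, (\forall s \near t, outward_normal (E s) (y s) nu) &
        is_derive t (1 : R) y (nu * V)].

Definition inner_deriv {R : realType} (E : set R) (f : R -> R) (x d : R)
    : Prop :=
  (f y - f x) / (y - x) @[y --> within (interior E) (nbhs x)] --> d.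

(* Value at x of the continuous extension of [derive1 Phi] from Omega to its
   closure. *)
Definition drift_at {R : realType} (Omega : set R) (Phi : R -> R) (x g : R)
    : Prop :=
  derive1 Phi y @[y --> within Omega (nbhs x)] --> g.

Definition interface_law {R : realType} (Omega : set R) (Phi P : R -> R)
    (E : R -> set R) (t : R) : Prop :=
  forall x, topo_boundary (E t) x ->
    exists nu V d g : R,
      [/\ outward_normal (E t) x nu, normal_velocity E t x nu V,
          inner_deriv (E t) P x d, drift_at Omega Phi x g &
          V = nu * (- d - g)].

Definition contact_law {R : realType} (Omega : set R) (Phi1 Phi2 P : R -> R)
    (E1 E2 : set R) : Prop :=
  forall x, topo_boundary E1 x -> topo_boundary E2 x ->
    exists d1 d2 g1 g2 : R,
      [/\ inner_deriv E1 P x d1, inner_deriv E2 P x d2,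
          drift_at Omega Phi1 x g1, drift_at Omega Phi2 x g2 &
          d1 + g1 = d2 + g2].

(* -P'' = Phi'' as distributions in the interior of E. *)
Definition bulk_law {R : realType} (Phi P : R -> R) (E : set R) : Prop :=
  forall psi : R -> R, test_fun (interior E) psi ->
    - (\int[leb R]_(x in interior E) (P x * derive1n 2 psi x))
    = (\int[leb R]_(x in interior E) (Phi x * derive1n 2 psi x)).

(* [E1 t], [E2 t] are representatives of {rho1_t = 1}, {rho2_t = 1}, which are
   only defined up to null sets; P is the continuous representative of the
   pressure at time t. *)
Definition hele_shaw_two_phase {R : realType} (Omega : set R) (T : R)
    (Phi1 Phi2 : R -> R) (rho1 rho2 p : R * R -> R) (E1 E2 : R -> set R)
    : Prop :=
  [/\ (forall t, 0 < t <= T -> \forall x \ae leb R, Omega x ->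
         (E1 t x <-> rho1 (t, x) = 1) /\ (E2 t x <-> rho2 (t, x) = 1)),
      (\forall z \ae leb2 R, (`[0, T]%classic `*` Omega) z ->
         rho1 z + rho2 z <> 1 -> p z = 0) &
      \forall t \ae leb R, 0 < t < T ->
        exists P : R -> R,
          [/\ {within closure Omega, continuous P} /\
              (\forall x \ae leb R, Omega x -> p (t, x) = P x),
              bulk_law Phi1 P (E1 t) /\ bulk_law Phi2 P (E2 t),
              interface_law Omega Phi1 P E1 t /\
              interface_law Omega Phi2 P E2 t &
              contact_law Omega Phi1 Phi2 P (E1 t) (E2 t)]].

(* Main.v *)
Require Import Defs.
From HB Require Import structures.
From mathcomp Require Import all_boot all_order all_algebra.
From mathcomp Require Import all_classical all_reals all_analysis.
From mathcomp Require Import measurable_realfun ess_sup_inf ring lra.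

Set Implicit Arguments.
Unset Strict Implicit.
Unset Printing Implicit Defensive.

Import Order.TTheory GRing.Theory Num.Theory.
Import numFieldNormedType.Exports.

Local Open Scope classical_set_scope.
Local Open Scope ring_scope.

(** Each step of the scheme maps a pair of ordered patches, the second one to the
   left, to a pair of ordered patches. Let (mu1, mu2) be a minimizer with
   densities f1, f2 for the previous patches at a1 and a2. The transport cost to
   the patch at a_i is at least M_i times the squared displacement of the mean,
   with equality only for translates (transport_cost_ge_mean, patch_of_min_cost).
   On the other hand better_patches finds ordered patches with at most the drift
   energy of (f1, f2) and at most the same squared displacements of the means,
   strictly smaller ones unless they have the means of f1 and f2. It uses the
   convexity of the potentials through the bathtub principle and the order of
   the drifts through sorting. Since the cost between patches is exactly the
   squared displacement, the minimizer consists of patches (jko_step).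

   A measure on the interval is determined by its integrals against the ramps
   x |-> max (x - s) 0, which are continuous for W_2. Hence the limit curves
   consist of ordered patches E_i t = ]a_i t, a_i t + M_i[ (limit_patches).

   In the weak equation the flux velocity is u = q + Phi_i', where q is the weak
   derivative of the pressure. Testing with the functions x and ramp^2 / 2 and
   differentiating in time gives, for almost every t, that a_i is differentiable
   at t and that u is constant on E_i t, with value c_i = - a_i' (patch_velocity):
   the moments of a patch are explicit functions of its position. In dimension
   one the pressure has a continuous primitive P of q as representative
   (continuous_representative), and on E_i t it is c_i x + k - Phi_i. This
   contains the laws of the free boundary problem: P'' = - Phi_i'' in the bulk,
   the one-sided derivative c_i - Phi_i' at the ends, which move with velocity
   - c_i, and c1 = c2 where the patches touch, because the nonnegative gap between
   them has a minimum there. *)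

(** * Almost everywhere statements and Lebesgue points *)

Section almost_everywhere.
Context d (T : measurableType d) (R : realType).
Variable mu : {measure set T -> \bar R}.
Implicit Types P Q : T -> Prop.

Lemma aeS P Q : (forall x, P x -> Q x) ->
  (\forall x \ae mu, P x) -> \forall x \ae mu, Q x.
Proof. by move=> PQ; apply: negligibleS => x nQ Px; apply: nQ; exact: PQ. Qed.

Lemma aeI P Q : (\forall x \ae mu, P x) -> (\forall x \ae mu, Q x) ->
  \forall x \ae mu, P x /\ Q x.
Proof.
move=> hP hQ; apply: negligibleS (negligibleU hP hQ) => x.
by have [Px|nPx _] := pselect (P x); [move=> nQ; right => Qx; exact: nQ|left].
Qed.

Lemma ae_forall (I : countType) (P : I -> T -> Prop) :
  (forall i, \forall x \ae mu, P i x) -> \forall x \ae mu, forall i, P i x.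
Proof.
move=> hP.
pose Q n := if (unpickle n : option I) is Some i then P i else fun=> True.
have hQ n : mu.-negligible (~` Q n).
  rewrite /Q; case: unpickle => [i|]; first exact: hP.
  by rewrite (_ : ~` _ = set0) ?setCT//; exact: negligible_set0.
apply: negligibleS (negligible_bigcup hQ) => x.
apply: contra_notP => nQ i; apply: contrapT => nP; apply: nQ.
by exists (pickle i) => //; rewrite /Q pickleK.
Qed.

End almost_everywhere.

Section lebesgue_kernels.
Context {R : realType}.
Notation leb := (@lebesgue_measure R).
Implicit Types (w k f g : R -> R) (s h x : R).

Lemma integrable_bounded_support k (l r B : R) :
  measurable_fun setT k -> (forall x, `|k x| <= B) ->
  (forall x, ~ `[l, r]%classic x -> k x = 0) ->
  leb.-integrable setT (EFin \o k).
Proof.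
move=> mk kB k0.
have -> : EFin \o k = (EFin \o k) \_ `[l, r].
  apply/funext => x; rewrite patchE; case: ifPn => // /negP xI /=.
  by rewrite k0// => xI'; apply: xI; rewrite inE.
apply/(integrable_mkcond _ _).1 => //.
apply: measurable_bounded_integrable => //.
- by rewrite /= lebesgue_measure_itv/=; case: ifP => // _; rewrite -EFinB ltry.
- exact: measurable_funS mk.
- exists B; split; first exact: num_real.
  by move=> M BM x _ /=; rewrite (le_trans (kB x))// ltW.
Qed.

Lemma integrable_mul_bounded w k B : leb.-integrable setT (EFin \o w) ->
  measurable_fun setT k -> (forall x, `|k x| <= B) ->
  leb.-integrable setT (EFin \o (fun x => w x * k x)).
Proof.
move=> iw mk kB.
have := @integrableMl _ _ _ leb setT measurableT _ k iw mk.
apply; exists B; split; first exact: num_real.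
by move=> M BM x _ /=; rewrite (le_trans (kB x))// ltW.
Qed.

(** Only the height C / h and the support of the kernel matter, so that the same
   estimate serves for second differences of ramps and for derivatives of
   smooth steps. *)
Lemma lebesgue_pt_kernel w s (C e : R) : leb.-integrable setT (EFin \o w) ->
  lebesgue_pt w s -> 0 < e -> 0 <= C ->
  \forall h \near 0^'+, forall k, measurable_fun setT k ->
    (forall x, `|k x| <= C / h) -> (forall x, ~ ball s h x -> k x = 0) ->
    `|\int[leb]_x (w x * k x) - w s * \int[leb]_x k x| <= e.
Proof.
move=> iw ws e0 C0.
have e'0 : 0 < e / (2 * C + 1) by rewrite divr_gt0// ltr_wpDl// mulr_ge0.
have {}ws : \forall h \near 0^'+, (davg w s h < (e / (2 * C + 1))%:E)%E.
  apply: (ws [set y | (y < (e / (2 * C + 1))%:E)%E]).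
  apply: open_nbhs_nbhs; split; first exact: open_ereal_lt_ereal.
  by rewrite /= lte_fin.
near=> h => k mk kC k0.
have h0 : 0 < h by near: h; exact: nbhs_right_gt.
have : (davg w s h < (e / (2 * C + 1))%:E)%E by near: h; exact: ws.
have mb : measurable (ball s h : set (measurableTypeR R)) by rewrite ball_itv; exact: measurable_itv.
have bty : (leb (ball s h) < +oo)%E.
  by rewrite lebesgue_measure_ball ?(ltW h0)// ltry.
have iwb : leb.-integrable (ball s h) (EFin \o (fun x => w x - w s)).
  rewrite (_ : _ \o _ = ((EFin \o w) \- (EFin \o cst (w s)))%E)//.
  apply: integrableB => //; first exact: integrableS iw.
  apply: measurable_bounded_integrable => //.
  exists `|w s|; split; first exact: num_real.
  by move=> M BM x _ /=; exact: ltW.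
have ik : leb.-integrable setT (EFin \o k).
  apply: (@integrable_bounded_support _ (s - h) (s + h) (C / h)) => // x nx.
  apply: k0; apply: contra_not nx; rewrite ball_itv; exact: subset_itv_oo_cc.
have iwk : leb.-integrable setT (EFin \o (fun x => w x * k x)).
  exact: integrable_mul_bounded kC.
have iwsk : leb.-integrable setT (EFin \o (fun x => w s * k x)).
  exact: (integrableZl measurableT (w s) ik).
rewrite /davg /iavg lebesgue_measure_ball ?(ltW h0)//.
have E : (\int[leb]_(y in ball s h) `|(w y - w s)%:E|)%E =
  (\int[leb]_(y in ball s h) `|w y - w s|)%:E.
  rewrite /Rintegral fineK//; apply: integrable_fin_num => //.
  exact: integrable_norm.
rewrite [X in (_ * X)%E]E.
rewrite inver ifF; last by apply/negbTE; rewrite mulrn_eq0/= gt_eqF.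
rewrite -EFinM lte_fin => Jlt.
rewrite -RintegralZl// -RintegralB//.
have -> : \int[leb]_x (w x * k x - w s * k x) =
          \int[leb]_(x in ball s h) ((w x - w s) * k x).
  rewrite [RHS]Rintegral_mkcond; apply: eq_Rintegral => x _.
  rewrite patchE; case: ifPn => [_|/negP xb]; first by rewrite mulrBl.
  by rewrite k0 ?mulr0 ?subr0// => xb'; apply: xb; rewrite inE.
have iwbk : leb.-integrable (ball s h) (EFin \o (fun x => (w x - w s) * k x)).
  have := @integrableMl _ _ _ leb _ mb _ k iwb (measurable_funTS mk).
  apply; exists (C / h); split; first exact: num_real.
  by move=> M BM x _ /=; rewrite (le_trans (kC x))// ltW.
apply: (le_trans (le_normr_Rintegral mb iwbk)).
have : \int[leb]_(t in ball s h) `|(w t - w s) * k t| <=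
       \int[leb]_(t in ball s h) (`|w t - w s| * (C / h)).
  apply: le_Rintegral => //.
  - exact: integrable_norm.
  - exact: (integrableZr mb (C / h) (integrable_norm iwb)).
  - by move=> x _; rewrite normrM ler_wpM2l.
move=> /le_trans; apply.
rewrite RintegralZr//; last exact: integrable_norm.
move: Jlt; set J := \int[leb]_(y in _) _ => Jlt.
have {}Jlt : J < e / (2 * C + 1) * (h *+ 2).
  by rewrite mulrC -ltr_pdivrMl// pmulrn_lgt0.
have -> : J * (C / h) = J / h * C by field; rewrite gt_eqF.
have J1 : J / h <= 2 * (e / (2 * C + 1)).
  by rewrite ler_pdivrMr//; apply: (le_trans (ltW Jlt)); rewrite -mulr_natl; lra.
apply: (le_trans (ler_wpM2r C0 J1)).
rewrite -mulrA (mulrC _ C) mulrA mulrA ler_pdivrMr ?ltr_wpDl ?mulr_ge0//.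
nra.
Unshelve. all: by end_near. Qed.

End lebesgue_kernels.

(** * Ramps separate integrable functions *)

Section ramps.
Context {R : realType}.
Notation leb := (@lebesgue_measure R).
Implicit Types (w k f g : R -> R) (s h x : R).

Lemma integrable_mul_supp w k (A : set R) B :
  leb.-integrable setT (EFin \o w) ->
  (forall x, ~ A x -> w x = 0) -> measurable_fun setT k ->
  (forall x, A x -> `|k x| <= B) ->
  leb.-integrable setT (EFin \o (fun x => w x * k x)).
Proof.
move=> iw w0 mk kB.
have mw : measurable_fun setT w by apply/measurable_EFinP; exact: measurable_int iw.
apply: (le_integrable measurableT _ _ (integrableZl measurableT B iw)).
  by apply/measurable_EFinP; exact: measurable_funM.
move=> x _; rewrite /= lee_fin normrM mulrC.
have [Ax|/w0 ->] := pselect (A x); last by rewrite normr0 !mulr0 normr0.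
by rewrite normrM ler_wpM2r// (le_trans (kB _ Ax))// ler_norm.
Qed.

Definition ramp s x : R := Num.max (x - s) 0.

Lemma rampE s x : ramp s x = if s <= x then x - s else 0.
Proof.
by rewrite /ramp; case: (leP s x) => sx; [apply/max_idPl|apply/max_idPr];
  rewrite ?subr_ge0 ?subr_le0 ?(ltW sx).
Qed.

Lemma ramp_ge0 s x : 0 <= ramp s x.
Proof. by rewrite rampE; case: (leP s x) => sx; lra. Qed.

Lemma ler_ramp_lip s x y : `|ramp s x - ramp s y| <= `|x - y|.
Proof.
rewrite !rampE; case: (leP s x) => sx; case: (leP s y) => sy;
  rewrite ?subr0 ?sub0r ?normrN //.
- by rewrite (_ : x - s - (y - s) = x - y)//; ring.
- by rewrite !ger0_norm; lra.
- by rewrite ger0_norm ?ler0_norm; lra.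
by rewrite normr0.
Qed.

Lemma ler_ramp_shift s s' x : `|ramp s x - ramp s' x| <= `|s - s'|.
Proof.
have E t : ramp t x = ramp 0 (x - t) by rewrite /ramp subr0.
rewrite !E (le_trans (ler_ramp_lip _ _ _))//.
by rewrite (_ : _ - _ - _ = s' - s) 1?distrC//; ring.
Qed.

Lemma continuous_ramp s : continuous (ramp s).
Proof.
move=> x; apply/cvgrPdist_le => /= e e0; near=> y.
apply: le_trans (ler_ramp_lip _ _ _) _.
by near: y; exact: cvgr_dist_le.
Unshelve. all: by end_near. Qed.

Lemma measurable_ramp s : measurable_fun setT (ramp s).
Proof. exact: continuous_measurable_fun (@continuous_ramp s). Qed.

Lemma ramp_itv_bound l r s x : `[l, r]%classic x -> `|ramp s x| <= `|l| + `|r| + `|s|.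
Proof.
rewrite /= in_itv/= => /andP[lx xr].
rewrite rampE; case: (leP s x) => sx; last first.
  by rewrite normr0 !addr_ge0.
rewrite (le_trans (ler_normB _ _))// lerD2r ler_norml.
have := ler_norm r; have := lerNnormlW (lexx `|l|).
by have := normr_ge0 r; have := normr_ge0 l; lra.
Qed.

Definition hat s h x := (ramp (s - h) x - 2 * ramp s x + ramp (s + h) x) / h ^+ 2.

(** The integral of w against ramp s is continuous in s, so it vanishes for every
   real s. Divided second differences of ramps are hats of mass one around s,
   and the integrals of w against shrinking hats tend to w s at each Lebesgue
   point. In other words, ramps see the second primitive of w. *)
Lemma ae_eq0_of_ramps w (l r : R) : leb.-integrable setT (EFin \o w) ->
  (forall x, ~ `[l, r]%classic x -> w x = 0) ->
  (forall q : rat, \int[leb]_x (w x * ramp (ratr q) x) = 0) ->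
  \forall x \ae leb, w x = 0.
Proof.
move=> iw w0 wq.
have iwr s : leb.-integrable setT (EFin \o (fun x => w x * ramp s x)).
  apply: integrable_mul_supp iw w0 (measurable_ramp s) _ => x xI.
  exact: (ramp_itv_bound s xI).
have inw : leb.-integrable setT (EFin \o (fun x => `|w x|)).
  exact: integrable_norm iw.
have lip s s' : `|\int[leb]_x (w x * ramp s x) - \int[leb]_x (w x * ramp s' x)|
    <= `|s - s'| * \int[leb]_x `|w x|.
  rewrite -RintegralB//; set i := EFin \o (fun x => w x * ramp s x - w x * ramp s' x).
  have ii : leb.-integrable setT i by exact: (integrableB measurableT (iwr s) (iwr s')).
  rewrite (le_trans (le_normr_Rintegral measurableT ii))//.
  rewrite -RintegralZl//; apply: le_Rintegral => //.
  - exact: integrable_norm ii.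
  - exact: (integrableZl measurableT _ inw).
  - by move=> x _; rewrite -mulrBr normrM mulrC ler_wpM2r// ler_ramp_shift.
have K0 s : \int[leb]_x (w x * ramp s x) = 0.
  apply/eqP; rewrite -normr_le0; apply/ler_addgt0Pr => e e0; rewrite add0r.
  have N0 : 0 <= \int[leb]_x `|w x| by exact: Rintegral_ge0.
  have d0 : 0 < e / (\int[leb]_x `|w x| + 1) by rewrite divr_gt0// ltr_wpDl.
  have [q] := @rat_in_itvoo R (s - e / (\int[leb]_x `|w x| + 1)) s ltac:(lra).
  rewrite in_itv/= => /andP[q1 q2].
  have := lip s (ratr q); rewrite wq subr0 => /le_trans; apply.
  rewrite gtr0_norm ?subr_gt0//.
  rewrite (@le_trans _ _ (e / (\int[leb]_x `|w x| + 1) * \int[leb]_x `|w x|))//.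
    by rewrite ler_wpM2r//; lra.
  by rewrite mulrAC ler_pdivrMr ?ltr_wpDl//; nra.
have lw : locally_integrable setT w by apply: open_integrable_locally => //; exact: openT.
apply: aeS (lebesgue_differentiation lw) => s ws.
apply/eqP; rewrite -normr_le0; apply/ler_addgt0Pr => e e0; rewrite add0r.
have e20 : 0 < e / 2 by rewrite divr_gt0.
have ker := lebesgue_pt_kernel iw ws e20 (@ler01 R).
have [h [h0 {ker}]] : exists h, 0 < h /\ forall k, measurable_fun setT k ->
    (forall x, `|k x| <= 1 / h) -> (forall x, ~ ball s h x -> k x = 0) ->
    `|\int[leb]_x (w x * k x) - w s * \int[leb]_x k x| <= e / 2.
  near (0 : R)^'+ => h; exists h; split; near: h => //.
  exact: nbhs_right_gt.
have h20 : 0 < h ^+ 2 by rewrite exprn_gt0.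
have hatE x : hat s h x = if `|x - s| <= h then (h - `|x - s|) / h ^+ 2 else 0.
  rewrite /hat !rampE.
  have [xs|xs] := leP s x.
    rewrite ger0_norm ?subr_ge0//.
    have -> : s - h <= x by lra.
    have [|] := leP (s + h) x; have [|] := leP (x - s) h => h1 h2.
    - by congr (_ / _); lra.
    - by rewrite (_ : _ + _ = 0) ?mul0r//; lra.
    - by congr (_ / _); lra.
    - lra.
  rewrite ltr0_norm ?subr_lt0//.
  have -> : (s + h <= x) = false by apply/negbTE; rewrite -ltNge; lra.
  have [|] := leP (s - h) x; have [|] := leP (- (x - s)) h => h1 h2.
  - by congr (_ / _); lra.
  - lra.
  - lra.
  - by rewrite (_ : _ + _ = 0) ?mul0r//; lra.
have mhat : measurable_fun setT (hat s h).
  apply: measurable_funM => //; apply: measurable_funD; last exact: measurable_ramp.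
  apply: measurable_funB; first exact: measurable_ramp.
  by apply: measurable_funM => //; exact: measurable_ramp.
have hat_ge0 x : 0 <= hat s h x.
  rewrite hatE; case: (leP `|x - s| h) => // xh; rewrite divr_ge0 ?subr_ge0//; exact: ltW.
have hat_le x : `|hat s h x| <= 1 / h.
  rewrite ger0_norm// hatE; case: (leP `|x - s| h) => xh; last by rewrite divr_ge0// ltW.
  rewrite ler_pdivrMr// (_ : 1 / h * h ^+ 2 = h); first by have := normr_ge0 (x - s); lra.
  by field; rewrite gt_eqF.
have hat0 x : ~ ball s h x -> hat s h x = 0.
  rewrite hatE /ball/= distrC => /negP; rewrite -leNgt => xh.
  by case: (leP `|x - s| h) => // xh'; rewrite (_ : _ - _ = 0) ?mul0r//; lra.
move=> /(_ _ mhat hat_le hat0).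
have -> : \int[leb]_x (w x * hat s h x) = 0.
  rewrite (_ : (fun x => _) = (fun x => (w x * ramp (s - h) x -
     2 * (w x * ramp s x) + w x * ramp (s + h) x) * (h ^+ 2)^-1)); last first.
    by apply/funext => x; rewrite /hat; ring.
  have i2 := integrableZl measurableT 2 (iwr s).
  have iB := integrableB measurableT (iwr (s - h)) i2.
  rewrite RintegralZr//; last exact: (integrableD measurableT iB (iwr (s + h))).
  by rewrite RintegralD// RintegralB// RintegralZl// !K0 mulr0 subr0 addr0 mul0r.
have ihat : leb.-integrable setT (EFin \o hat s h).
  apply: (@integrable_bounded_support _ _ (s - h) (s + h) (1 / h)) => // x nx.
  by apply: hat0; apply: contra_not nx; rewrite ball_itv; exact: subset_itv_oo_cc.
(* the hat is at least 1 / (2 h) on the half of its support around s *)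
have half : 2^-1 <= \int[leb]_x hat s h x.
  apply: (@le_trans _ _ (\int[leb]_x ((fun=> (2 * h)^-1) \_ `[s - h / 2, s + h / 2]) x)).
    rewrite -Rintegral_mkcond Rintegral_cst//= lebesgue_measure_itv/= lte_fin.
    rewrite ifT; last by lra.
    rewrite -EFinD/= (_ : _ * _ = 2^-1)//; by field; rewrite gt_eqF.
  apply: le_Rintegral => //.
    apply: (@integrable_bounded_support _ _ (s - h / 2) (s + h / 2) (2 * h)^-1) => //.
    - apply/(measurable_restrictT _ _).1 => //.
    - move=> x; rewrite patchE; case: ifP => _; last by rewrite normr0 invr_ge0 mulr_ge0// ltW.
      by rewrite ger0_norm// invr_ge0 mulr_ge0// ltW.
    - by move=> x nx; rewrite patchE; case: ifPn => //; rewrite inE.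
  move=> x _; rewrite patchE; case: ifPn => // /set_mem /=.
  rewrite in_itv/= => /andP[x1 x2].
  have xs : `|x - s| <= h / 2 by rewrite ler_norml; apply/andP; split; lra.
  rewrite hatE ifT; last by lra.
  rewrite ler_pdivlMr// (_ : (2 * h)^-1 * h ^+ 2 = h / 2); first by lra.
  by field; rewrite gt_eqF.
rewrite sub0r normrN normrM (ger0_norm (Rintegral_ge0 _ _))//.
move=> H; have A := ler_wpM2l (normr_ge0 (w s)) half.
by move: (le_trans A H); lra.
Unshelve. all: by end_near. Qed.

End ramps.

(** * A smooth transition function *)

Section smooth_functions.
Context {R : realType}.
Implicit Types (f g : R -> R) (x a b : R) (n k : nat).

Lemma derivable_is_derive f x : derivable f x 1 -> is_derive x 1 f (derive1 f x).
Proof. by move=> df; rewrite derive1E; apply: DeriveDef. Qed.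

Lemma is_derive_derive1 f x d : is_derive x 1 f d -> derive1 f x = d.
Proof. by move=> df; rewrite derive1E; exact: derive_val. Qed.

(** Differentiability to order n.+1 in a form suited to induction over n. *)
Fixpoint nderivable n f : Prop :=
  (forall x, derivable f x 1) /\
  (if n is m.+1 then nderivable m (derive1 f) else True).

Definition smooth f := forall n, nderivable n f.

Lemma nderivableW n f : nderivable n.+1 f -> nderivable n f.
Proof.
by elim: n f => [|n IH] f [df] dn; split => //; exact: IH.
Qed.

Lemma smoothP f : smooth f <-> forall n x, derivable (derive1n n f) x 1.
Proof.
split=> [sf n|df n].
  have : nderivable n f by exact: sf.
  elim: n f {sf} => [|n IH] f [df] // dn x.
  by rewrite derive1Sn; exact: IH.
elim: n f df => [|n IH] f df; split => //; try exact: (df 0%N).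
by apply: IH => n' x; rewrite -derive1Sn; exact: df.
Qed.

Lemma smooth_derivable f : smooth f -> forall x, derivable f x 1.
Proof. by move=> /(_ 0%N) []. Qed.

Lemma smooth_derive1 f : smooth f -> smooth (derive1 f).
Proof. by move=> sf n; have [] := sf n.+1. Qed.

Lemma smooth_continuous f : smooth f -> continuous f.
Proof.
move=> sf x; apply: differentiable_continuous.
by apply/derivable1_diffP; exact: smooth_derivable.
Qed.

Lemma nderivable_cst n (c : R) : nderivable n (fun=> c).
Proof.
elim: n c => [|n IH] c; split => //.
rewrite (_ : derive1 _ = fun=> 0); first exact: IH.
by apply/funext => x; rewrite derive1_cst.
Qed.

Lemma nderivableD n f g : nderivable n f -> nderivable n g ->
  nderivable n (fun x => f x + g x).
Proof.
elim: n f g => [|n IH] f g [df dnf] [dg dng]; split => //;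
  try by (move=> x; apply: derivableD; [exact: df|exact: dg]).
rewrite (_ : derive1 _ = fun x => derive1 f x + derive1 g x); first exact: IH.
apply/funext => x; apply: is_derive_derive1.
by apply: is_deriveD; exact: derivable_is_derive.
Qed.

Lemma nderivableM n f g : nderivable n f -> nderivable n g ->
  nderivable n (fun x => f x * g x).
Proof.
elim: n f g => [|n IH] f g hf hg.
  have [df _] := hf; have [dg _] := hg; split => // x.
  by apply: derivableM; [exact: df|exact: dg].
have [df dnf] := hf; have [dg dng] := hg; split.
  by move=> x; apply: derivableM; [exact: df|exact: dg].
rewrite (_ : derive1 _ = fun x => f x * derive1 g x + g x * derive1 f x).
  apply: nderivableD; apply: IH => //; exact: nderivableW.
apply/funext => x; apply: is_derive_derive1.
by apply: is_deriveM; exact: derivable_is_derive.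
Qed.

Lemma is_derive_affine a b x : is_derive x 1 (fun y => a * y + b) a.
Proof. by apply: is_derive_eq; rewrite /GRing.scale/= ?mulr1 ?mulr0 ?addr0. Qed.

Lemma nderivable_affine n f a b : nderivable n f ->
  nderivable n (fun x => f (a * x + b)).
Proof.
have D g x : derivable g (a * x + b) 1 ->
    is_derive x 1 (fun y => g (a * y + b)) (derive1 g (a * x + b) * a).
  move=> dg; apply: (@is_derive1_comp R g (fun y => a * y + b)).
    exact: derivable_is_derive.
  exact: is_derive_affine.
elim: n f => [|n IH] f [df dnf]; split => //;
  try by (move=> x; have [] := D _ _ (df (a * x + b))).
rewrite (_ : derive1 _ = fun x => derive1 f (a * x + b) * a).
  by apply: nderivableM; [exact: IH|exact: nderivable_cst].
by apply/funext => x; apply: is_derive_derive1; exact: D.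
Qed.

Lemma nderivableV n f : (forall x, f x != 0) -> nderivable n f ->
  nderivable n (fun x => (f x)^-1).
Proof.
move=> f0; elim: n f f0 => [|n IH] f f0 hf.
  by have [df _] := hf; split => // x; apply: derivableV.
have [df dnf] := hf; split; first by move=> x; apply: derivableV.
rewrite (_ : derive1 _ = fun x => (-1) * (derive1 f x * ((f x)^-1 * (f x)^-1))).
  apply: nderivableM; first exact: nderivable_cst.
  by apply: nderivableM => //; apply: nderivableM; apply: IH => //; exact: nderivableW.
apply/funext => x; apply: is_derive_derive1.
apply: is_derive_eq.
  exact: (@is_deriveV R f x (derive1 f x) 1 (f0 x) (derivable_is_derive (df x))).
by rewrite /GRing.scale/= -exprVn expr2; ring.
Qed.

Lemma is_derive0_quad f x (C : R) :
  (forall h, `|f (x + h) - f x| <= C * h ^+ 2) -> is_derive x 1 f 0.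
Proof.
move=> fC.
have C0 : 0 <= C by have := fC 1; rewrite expr1n mulr1; exact: le_trans.
have L : (h^-1 *: ((f \o shift x) (h *: 1) - f x)) @[h --> (0:R)^'] --> (0 : R).
  apply/cvgrPdist_le => /= e e0; near=> h.
  have h0 : h != 0 by near: h; exact: nbhs_dnbhs_neq.
  rewrite sub0r normrN /GRing.scale/= mulr1 normrM normfV ler_pdivrMl ?normr_gt0//.
  rewrite (addrC h x) (le_trans (fC h))// -real_normK ?num_real// expr2 mulrCA.
  rewrite ler_wpM2l// (@le_trans _ _ (C * (e / (C + 1))))//.
    rewrite ler_wpM2l//; near: h; apply: dnbhs0_le; rewrite divr_gt0//.
    by rewrite ltr_wpDl.
  by rewrite mulrCA ler_piMr ?(ltW e0)// ler_pdivrMr ?ltr_wpDl// mul1r lerDl.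
apply: DeriveDef; first by apply/cvg_ex; exists 0; exact: L.
by apply/cvg_lim => //; exact: L.
Unshelve. all: by end_near. Qed.

(** The derivatives of exp(-1/x), extended by 0 to the left half line, are
   linear combinations of the functions flat k. *)
Definition flat k x : R := if 0 < x then x^-1 ^+ k * expR (- x^-1) else 0.

Lemma flat_ge0 k x : 0 <= flat k x.
Proof.
by rewrite /flat; case: ltP => // x0; rewrite mulr_ge0 ?expR_ge0// exprn_ge0// invr_ge0 ltW.
Qed.

Lemma flatS k x : flat k x = x * flat k.+1 x.
Proof.
rewrite /flat; case: ltP => x0; last by rewrite mulr0.
by rewrite exprS !mulrA mulfV ?mul1r// gt_eqF.
Qed.

Lemma flat_le k x : 0 <= x -> flat k x <= k.+1`!%:R * x.
Proof.
rewrite le_eqVlt => /predU1P[<-|x0]; first by rewrite /flat ltxx mulr0.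
rewrite /flat x0 expRN ler_pdivrMr ?expR_gt0//.
have y0 : 0 <= x^-1 by rewrite invr_ge0 ltW.
have := expR_ge1Dxn k y0.
have -> : x^-1 ^+ k = x * x^-1 ^+ k.+1 by rewrite exprS mulrA mulfV ?mul1r// gt_eqF.
rewrite (mulrC _ x) -mulrA ler_pM2l// => H.
rewrite mulrC -ler_pdivrMr ?ltr0n ?fact_gt0//.
by rewrite (le_trans _ H)// lerDr.
Qed.

Lemma is_derive_flat k x :
  is_derive x 1 (flat k) (flat k.+2 x - k%:R * flat k.+1 x).
Proof.
have [x0|x0|->] := ltgtP x 0.
- rewrite /flat (lt_gtF x0) mulr0 subr0.
  apply: (@near_eq_is_derive R R R (fun=> 0)) => //.
  + near=> y; rewrite ltNge ltW//=; near: y; exact: lt_nbhsl.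
- have x_neq0 : x != 0 by rewrite gt_eqF.
  rewrite /flat x0.
  apply: (@near_eq_is_derive R R R (fun y => y^-1 ^+ k * expR (- y^-1))).
  + near=> y; rewrite ifT//; near: y; exact: lt_nbhsr.
  + have d1 : is_derive x 1 (fun y : R => y^-1) (- x^-1 ^+ 2).
      apply: is_derive_eq; first exact: (@is_deriveV R id x 1 1 x_neq0).
      by rewrite /GRing.scale/= mulr1 exprVn.
    have d2 : is_derive x 1 (fun y : R => - y^-1) (x^-1 ^+ 2).
      by apply: is_derive_eq; rewrite opprK.
    have d3 : is_derive x 1 (fun y : R => expR (- y^-1)) (expR (- x^-1) * x^-1 ^+ 2).
      exact: (@is_derive1_comp R expR (fun y => - y^-1)).
    have d4 : is_derive x 1 (fun y : R => y^-1 ^+ k)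
        ((k%:R * x^-1 ^+ k.-1) * (- x^-1 ^+ 2)).
      by have := @is_deriveX R R (fun y : R => y^-1) k x 1 _ d1; rewrite exprfctE.
    have d5 : is_derive x 1 (fun y : R => y^-1 ^+ k * expR (- y^-1))
        (x^-1 ^+ k * (expR (- x^-1) * x^-1 ^+ 2) +
         expR (- x^-1) * ((k%:R * x^-1 ^+ k.-1) * (- x^-1 ^+ 2))).
      exact: is_deriveM d4 d3.
    apply: (is_derive_eq d5).
    by case: (k) => [|j] /=; rewrite ?mul0r ?exprS ?expr0; ring.
- rewrite {2 3}/flat ltxx mulr0 subr0.
  apply: (@is_derive0_quad _ _ k.+2`!%:R) => h.
  rewrite add0r {2}/flat ltxx subr0 ger0_norm ?flat_ge0//.
  have [h0|h0] := leP h 0; first by rewrite {1}/flat ltNge h0/= mulr_ge0// sqr_ge0.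
  by rewrite flatS expr2 mulrCA ler_pM2l// flat_le// ltW.
Unshelve. all: by end_near. Qed.

Lemma smooth_flat k : smooth (flat k).
Proof.
move=> n; elim: n k => [|n IH] k; split => //;
  try by (move=> x; have [] := is_derive_flat k x).
rewrite (_ : derive1 _ = fun x => flat k.+2 x + - k%:R * flat k.+1 x).
  by apply: nderivableD => //; apply: nderivableM => //; exact: nderivable_cst.
apply/funext => x; apply: is_derive_derive1; rewrite mulNr.
exact: is_derive_flat.
Qed.

Lemma flat0_nd : {homo flat 0 : x y / x <= y}.
Proof.
move=> x y xy; rewrite /flat !expr0 !mul1r.
case: (ltP 0 x) => x0; last by case: ifP; rewrite ?expR_ge0.
by rewrite (lt_le_trans x0 xy) ler_expR lerN2 lef_pV2 ?posrE// (lt_le_trans x0 xy).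
Qed.

Lemma flat0_gt0 x : 0 < x -> 0 < flat 0 x.
Proof. by move=> x0; rewrite /flat x0 mulr_gt0 ?expR_gt0// expr0. Qed.

Lemma flat0_le0 x : x <= 0 -> flat 0 x = 0.
Proof. by move=> x0; rewrite /flat ltNge x0. Qed.

(** The classical smooth transition from 0 to 1. *)
Definition sstep x : R := flat 0 x / (flat 0 x + flat 0 (1 - x)).

Lemma sstep_denom_gt0 x : 0 < flat 0 x + flat 0 (1 - x).
Proof.
have [x0|x0] := ltP 0 x; first by rewrite ltr_pwDl ?flat0_gt0// flat_ge0.
by rewrite ltr_wpDl ?flat_ge0// flat0_gt0//; lra.
Qed.

Lemma smooth_sstep : smooth sstep.
Proof.
move=> n; apply: nderivableM; first exact: smooth_flat.
apply: nderivableV => [x|]; first by rewrite gt_eqF// sstep_denom_gt0.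
apply: nderivableD; first exact: smooth_flat.
rewrite (_ : (fun x => _) = fun x => flat 0 ((-1) * x + 1)).
  by apply: nderivable_affine; exact: smooth_flat.
by apply/funext => x; rewrite mulN1r addrC.
Qed.

Lemma sstep_le0 x : x <= 0 -> sstep x = 0.
Proof. by move=> x0; rewrite /sstep flat0_le0// mul0r. Qed.

Lemma sstep_ge1 x : 1 <= x -> sstep x = 1.
Proof.
move=> x1; rewrite /sstep (flat0_le0 (_ : 1 - x <= 0)) ?subr_le0// addr0.
by rewrite mulfV// gt_eqF// flat0_gt0// (lt_le_trans _ x1).
Qed.

Lemma sstep_nd : {homo sstep : x y / x <= y}.
Proof.
move=> x y xy; rewrite /sstep ler_pdivrMr ?sstep_denom_gt0// mulrAC.
rewrite ler_pdivlMr ?sstep_denom_gt0// !mulrDr (mulrC (flat 0 y) (flat 0 x)) lerD2l.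
by rewrite ler_pM ?flat_ge0 ?flat0_nd// lerB.
Qed.

Lemma sstep_ge0 x : 0 <= sstep x.
Proof. by rewrite /sstep divr_ge0 ?flat_ge0// ltW// sstep_denom_gt0. Qed.

Lemma sstep_le1 x : sstep x <= 1.
Proof. by rewrite /sstep ler_pdivrMr ?sstep_denom_gt0// mul1r lerDl flat_ge0. Qed.

End smooth_functions.

(** * Weak derivatives in dimension one *)

Section weak_derivatives.
Context {R : realType}.
Notation leb := (@lebesgue_measure R).
Implicit Types (f g p q w psi : R -> R) (s x e : R).

Lemma near_right0P (P : R -> Prop) : (\forall h \near 0^'+, P h) ->
  exists2 d, 0 < d & forall h, 0 < h -> h < d -> P h.
Proof.
move=> -[d /= d0 dP]; exists d => // h h0 hd; apply: dP => //.
by rewrite /ball_/= sub0r normrN gtr0_norm.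
Qed.

Lemma Rintegral_FTC2 f (F : R -> R) a b : a < b -> continuous f ->
  (forall x, is_derive x 1 F (f x)) ->
  \int[leb]_(x in `[a, b]) f x = F b - F a.
Proof.
move=> ab cf dF.
have cF : continuous F.
  by move=> x; apply: differentiable_continuous; apply/derivable1_diffP; have [] := dF x.
rewrite /Rintegral (@continuous_FTC2 _ f F)//.
- exact: continuous_subspaceT.
- split => [x _||]; first by have [] := dF x.
    exact/cvg_at_right_filter/cF.
  exact/cvg_at_left_filter/cF.
- by move=> x _; apply: is_derive_derive1.
Qed.

Lemma is_derive_near_cst f x (c : R) :
  (\forall y \near x, f y = c) -> is_derive x 1 f 0.
Proof.
move=> fc; apply: (@near_eq_is_derive R R R (fun=> c)).
by apply: filterS fc => y ->.
Qed.

Lemma test_fun_derive1 (U : set R) psi : test_fun U psi -> test_fun U (derive1 psi).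
Proof.
move=> [dpsi [K [cK KU] K0]]; split=> [n x|]; first by rewrite -derive1Sn; exact: dpsi.
exists K => // x nKx; apply: is_derive_derive1; apply: (@is_derive_near_cst _ _ 0).
have : nbhs x (~` K).
  apply: open_nbhs_nbhs; split => //; rewrite openC.
  exact: compact_closed.
by apply: filterS => y; exact: K0.
Qed.

Lemma test_fun_smooth (U : set R) psi : test_fun U psi -> smooth psi.
Proof. by move=> [dpsi _]; apply/smoothP. Qed.

Definition rstep s e x : R := sstep (e^-1 * x + - (s / e)).

Lemma smooth_rstep s e : smooth (rstep s e).
Proof. by move=> n; apply: nderivable_affine; exact: smooth_sstep. Qed.

Lemma rstep_argE s e x : 0 < e -> e^-1 * x + - (s / e) = (x - s) / e.
Proof. by move=> e0; rewrite mulrBl mulrC. Qed.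

Lemma rstep_lt s e x : 0 < e -> x <= s -> rstep s e x = 0.
Proof.
move=> e0 xs; rewrite /rstep rstep_argE// sstep_le0//.
by rewrite pmulr_lle0 ?invr_gt0// subr_le0.
Qed.

Lemma rstep_gt s e x : 0 < e -> s + e <= x -> rstep s e x = 1.
Proof.
move=> e0 xs; rewrite /rstep rstep_argE// sstep_ge1//.
by rewrite ler_pdivlMr// mul1r; lra.
Qed.

Lemma rstep_ge0 s e x : 0 <= rstep s e x. Proof. exact: sstep_ge0. Qed.
Lemma rstep_le1 s e x : rstep s e x <= 1. Proof. exact: sstep_le1. Qed.

Lemma rstep_nincr s s' e x : 0 < e -> s <= s' -> rstep s' e x <= rstep s e x.
Proof.
move=> e0 ss; apply: sstep_nd; rewrite lerD2l lerN2.
by rewrite ler_pM2r ?invr_gt0.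
Qed.

Lemma derive1_sstep_bounded : exists2 C : R, 0 <= C & forall x, `|derive1 sstep x| <= C.
Proof.
have sd : continuous (derive1 (@sstep R)).
  by apply: smooth_continuous; apply: smooth_derive1; exact: smooth_sstep.
have cd : {within `[(-1 : R), 2], continuous (fun x => `|derive1 sstep x|)}.
  apply: continuous_subspaceT => x.
  by apply: cvg_norm; exact: sd.
have le12 : -1 <= 2 :> R by lra.
have [c _ cmax] := EVT_max le12 cd.
exists `|derive1 sstep c| => // x.
have [x1|x1] := ltP x (-1).
  suff -> : derive1 sstep x = 0 by rewrite normr0.
  apply: is_derive_derive1.
  apply: (@is_derive_near_cst _ _ 0); near=> y; apply: sstep_le0.
  by apply: ltW; near: y; apply: lt_nbhsl; rewrite (lt_trans x1)//; lra.
have [x2|x2] := leP x 2; first by apply: cmax; rewrite in_itv/= x1 x2.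
suff -> : derive1 sstep x = 0 by rewrite normr0.
apply: is_derive_derive1.
apply: (@is_derive_near_cst _ _ 1); near=> y; apply: sstep_ge1.
by apply: ltW; near: y; apply: lt_nbhsr; rewrite (lt_trans _ x2)//; lra.
Unshelve. all: by end_near. Qed.

Lemma derive1_rstep s e x : derive1 (rstep s e) x =
  derive1 sstep (e^-1 * x + - (s / e)) * e^-1.
Proof.
apply: is_derive_derive1.
apply: (@is_derive1_comp R sstep (fun y => e^-1 * y + - (s / e))).
  by apply: derivable_is_derive; exact: (smooth_derivable (@smooth_sstep R)).
exact: is_derive_affine.
Qed.

Lemma derive1_rstep_out s e x : 0 < e -> x < s \/ s + e < x ->
  derive1 (rstep s e) x = 0.
Proof.
move=> e0 xs; apply: is_derive_derive1; case: xs => xs.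
  apply: (@is_derive_near_cst _ _ 0); near=> y; apply: rstep_lt => //.
  by apply: ltW; near: y; apply: lt_nbhsl.
apply: (@is_derive_near_cst _ _ 1); near=> y; apply: rstep_gt => //.
by apply: ltW; near: y; apply: lt_nbhsr.
Unshelve. all: by end_near. Qed.

Lemma continuous_derive1_rstep s e : continuous (derive1 (rstep s e)).
Proof. by apply: smooth_continuous; apply: smooth_derive1; exact: smooth_rstep. Qed.

Lemma Rintegral_derive1_rstep s e : 0 < e ->
  \int[leb]_x derive1 (rstep s e) x = 1.
Proof.
move=> e0; rewrite (_ : (fun x => _) = (derive1 (rstep s e)) \_ `[s, s + e]); last first.
  apply/funext => x; rewrite patchE; case: ifPn => // /negP xI.
  apply: derive1_rstep_out => //; apply/orP; rewrite -[X in X || _]negbK.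
  rewrite -leNgt -implybE; apply/implyP => sx; rewrite ltNge; apply/negP => xs.
  by apply: xI; rewrite inE/= in_itv/= sx.
have D x : is_derive x 1 (rstep s e) (derive1 (rstep s e) x).
  by apply: derivable_is_derive; apply: smooth_derivable; exact: smooth_rstep.
have se : s < s + e by rewrite ltrDl.
rewrite -Rintegral_mkcond (Rintegral_FTC2 se (@continuous_derive1_rstep s e) D).
by rewrite rstep_gt// rstep_lt// subr0.
Qed.

(** The derivative of a steep smooth step is a kernel of mass one at the step. *)
Lemma cvg_test_rstep w s e : leb.-integrable setT (EFin \o w) ->
  lebesgue_pt w s -> 0 < e ->
  exists2 d, 0 < d & forall h, 0 < h -> h < d ->
    `|\int[leb]_x (w x * derive1 (rstep s h) x) - w s| <= e.
Proof.
move=> iw ws e0; have [C C0 CP] := derive1_sstep_bounded.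
have := lebesgue_pt_kernel iw ws e0 (_ : 0 <= 2 * C); rewrite mulr_ge0// => /(_ erefl).
move=> /near_right0P[d d0 dP]; exists (d / 2); first by rewrite divr_gt0.
move=> h h0 hd.
have := dP (2 * h) _ _ (derive1 (rstep s h)).
rewrite mulr_gt0// (_ : 2 * h < d) ?(Rintegral_derive1_rstep s h0); last by lra.
rewrite mulr1; apply => //.
- exact: continuous_measurable_fun (@continuous_derive1_rstep s h).
- move=> x; rewrite derive1_rstep normrM (_ : 2 * C / (2 * h) = C * h^-1); last first.
    by field; rewrite gt_eqF.
  by rewrite [`|h^-1|]ger0_norm ?invr_ge0 ?(ltW h0)// ler_wpM2r ?invr_ge0 ?(ltW h0).
- move=> x xb; apply: derive1_rstep_out => //.
  have [xs|xs] := ltP x s; [by left|right].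
  rewrite ltNge; apply/negP => xs'; apply: xb.
  by rewrite /ball/= ler0_norm; lra.
Qed.

Definition cutoff s s' h x := rstep s h x - rstep s' h x.

Lemma derive1_cutoff s s' h x :
  derive1 (cutoff s s' h) x = derive1 (rstep s h) x - derive1 (rstep s' h) x.
Proof.
by apply: is_derive_derive1; apply: is_deriveB; apply: derivable_is_derive;
  apply: smooth_derivable; exact: smooth_rstep.
Qed.

Lemma cutoff_ge0 s s' h x : 0 < h -> s <= s' -> 0 <= cutoff s s' h x.
Proof. by move=> h0 ss; rewrite subr_ge0 rstep_nincr. Qed.

Lemma test_fun_cutoff l r s s' h : 0 < h -> l < s -> s <= s' -> s' + h < r ->
  test_fun `]l, r[%classic (cutoff s s' h).
Proof.
move=> h0 ls ss sr; split.
  apply/smoothP => n; rewrite (_ : cutoff s s' h =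
    fun x => rstep s h x + (-1) * rstep s' h x); last first.
    by apply/funext => x; rewrite mulN1r.
  apply: nderivableD; first exact: smooth_rstep.
  by apply: nderivableM; [exact: nderivable_cst|exact: smooth_rstep].
exists `[s, s' + h]%classic.
  split; first exact: segment_compact.
  by apply: subset_itv; rewrite bnd_simp.
move=> x xI; rewrite /cutoff.
have [xs|xs] := leP x s; first by rewrite !rstep_lt ?subr0// (le_trans xs).
rewrite !rstep_gt ?subrr//.
  by rewrite leNgt; apply/negP => xs'; apply: xI; rewrite /= in_itv/= (ltW xs) ltW.
rewrite leNgt; apply/negP => xs'; apply: xI; rewrite /= in_itv/= (ltW xs)/= ltW//.
by rewrite (lt_le_trans xs')// lerD2r.
Qed.

(** The cutoff differs from the indicator of [s, s'] only on [s, s + h] and on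
   [s', s' + h], where the integral of |q| is small by absolute continuity. *)
Lemma integral_cutoff_close q s s' e : leb.-integrable setT (EFin \o q) ->
  s <= s' -> 0 < e ->
  exists2 d, 0 < d & forall h, 0 < h -> h < d ->
    `|\int[leb]_x (q x * cutoff s s' h x) - \int[leb]_(x in `[s, s']) q x| <= e.
Proof.
move=> iq ss e0; have e20 : 0 < e / 2 by rewrite divr_gt0.
have [d [d0 dP]] := integral_normr_continuous iq e20.
exists d => // h h0 hd.
have small (c : R) : \int[leb]_(x in `[c, c + h]) `|q x| <= e / 2.
  apply: ltW; apply: dP => //.
  rewrite /= lebesgue_measure_itv/= lte_fin ltrDl h0 -EFinD lte_fin; lra.
have iqc : leb.-integrable setT (EFin \o (fun x => q x * cutoff s s' h x)).
  apply: (@integrable_mul_bounded _ _ _ 2) => //.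
    apply: measurable_funB; apply: continuous_measurable_fun;
    apply: smooth_continuous; exact: smooth_rstep.
  move=> x; rewrite (le_trans (ler_normB _ _))// !ger0_norm ?rstep_ge0//.
  by have := rstep_le1 s h x; have := rstep_le1 s' h x; lra.
have iqI (A : set R) : measurable A -> leb.-integrable setT (EFin \o (q \_ A)).
  move=> mA; rewrite -restrict_EFin; apply/(integrable_mkcond _ _).1 => //.
  exact: integrableS iq.
rewrite [X in _ - X]Rintegral_mkcond -RintegralB//; last exact: iqI.
have inq (A : set R) : measurable A -> leb.-integrable setT (EFin \o ((fun x => `|q x|) \_ A)).
  move=> mA; rewrite -restrict_EFin; apply/(integrable_mkcond _ _).1 => //.
  by apply: integrableS (integrable_norm iq).
have iB := integrableB measurableT iqc (iqI _ (measurable_itv `[s, s'])).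
apply: (le_trans (le_normr_Rintegral measurableT iB)).
apply: (@le_trans _ _ (\int[leb]_x (((fun x => `|q x|) \_ `[s, s + h]) x +
   ((fun x => `|q x|) \_ `[s', s' + h]) x))); last first.
  rewrite RintegralD//; [|exact: inq..].
  by rewrite -!Rintegral_mkcond; have := small s; have := small s'; lra.
have i1 := inq _ (measurable_itv `[s, s + h]).
have i2 := inq _ (measurable_itv `[s', s' + h]).
apply: le_Rintegral => //.
- exact: integrable_norm iB.
- exact: (integrableD measurableT i1 i2).
move=> x _; rewrite !patchE /cutoff.
have I (a b : R) : (x \in `[a, b]%classic) = (a <= x <= b).
  by apply/idP/idP => [/set_mem|H]; rewrite ?inE /= in_itv.
rewrite !I; have q0 := normr_ge0 (q x).
have B (c : R) : `|q x * (rstep s h x - rstep s' h x) - c * q x| =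
    `|q x| * `|rstep s h x - rstep s' h x - c|.
  by rewrite -normrM; congr (`|_|); ring.
have B1 := B 1; have B0 := B 0; rewrite mul1r in B1; rewrite mul0r in B0.
have [xs|sx] := ltP x s.
  rewrite !rstep_lt//; try by apply: ltW; rewrite // (lt_le_trans xs).
  have -> : (s' <= x) = false by apply/negbTE; rewrite -ltNge (lt_le_trans xs).
  by rewrite /= subrr mulr0 subrr normr0 addr0.
have [xs'|s'x] := ltP x s'.
  rewrite [rstep s' h x]rstep_lt ?(ltW xs')//= subr0.
  rewrite addr0 (_ : q x * _ - q x = - (q x * (1 - rstep s h x))); last by ring.
  have [xh|xh] := leP x (s + h); last by rewrite rstep_gt ?(ltW xh)// subrr mulr0 oppr0 normr0.
  rewrite normrN normrM ler_piMr// ger0_norm ?subr_ge0 ?rstep_le1//.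
  by rewrite lerBlDr lerDl rstep_ge0.
have [xh'|xh'] := leP x (s' + h); last first.
  rewrite !rstep_gt ?(ltW xh')//; last by rewrite (le_trans _ (ltW xh'))// lerD2r.
  have -> : (x <= s') = false by apply/negbTE; rewrite -ltNge (lt_trans _ xh')// ltrDl.
  have -> : (x <= s + h) = false.
    by apply/negbTE; rewrite -ltNge (le_lt_trans _ xh')// lerD2r.
  by rewrite /= subrr mulr0 subrr normr0 addr0.
have D0 : 0 <= (if x <= s + h then `|q x| else 0 : R) by case: ifP.
rewrite /=; apply: (@le_trans _ _ `|q x|); last by rewrite lerDr.
have r1 := rstep_le1 s h x; have r0 := rstep_ge0 s' h x.
have r2 := rstep_nincr x h0 ss; have r3 := rstep_ge0 s h x.
case: ifP => _; last first.
  by rewrite subr0 normrM ler_piMr// ger0_norm ?subr_ge0//; lra.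
rewrite B1 ler_piMr// ler_norml; apply/andP; split; lra.
Qed.

(** Testing with the cutoff, a smooth approximation of the indicator of [s, s'],
   reads off the increment of p between two of its Lebesgue points. *)
Lemma weak_deriv_increment l r p q s s' :
  leb.-integrable `]l, r[ (EFin \o p) -> leb.-integrable `]l, r[ (EFin \o q) ->
  weak_deriv `]l, r[%classic p q -> l < s -> s <= s' -> s' < r ->
  lebesgue_pt (p \_ `]l, r[) s -> lebesgue_pt (p \_ `]l, r[) s' ->
  p s' - p s = \int[leb]_(x in `[s, s']) q x.
Proof.
have aux (I1 I2 I3 I4 u v c : R) : `|I1 - u| <= c / 3 -> `|I2 - v| <= c / 3 ->
    `|I3 - I4| <= c / 3 -> I1 - I2 = - I3 -> `|v - u - I4| <= c.
  rewrite !ler_norml => /andP[a1 a2] /andP[a3 a4] /andP[a5 a6] F.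
  by apply/andP; split; lra.
move=> ip iq pq ls ss sr ps ps'.
have mO : measurable (`]l, r[%classic : set R) by exact: measurable_itv.
set pO := (p \_ `]l, r[) in ps ps' *; set qO := (q \_ `]l, r[).
have ipO : leb.-integrable setT (EFin \o pO).
  by rewrite -restrict_EFin; apply/(integrable_mkcond _ _).1.
have iqO : leb.-integrable setT (EFin \o qO).
  by rewrite -restrict_EFin; apply/(integrable_mkcond _ _).1.
have pOE x : l < x -> x < r -> pO x = p x.
  by move=> lx xr; rewrite /pO patchE ifT// inE/= in_itv/= lx xr.
have -> : \int[leb]_(x in `[s, s']) q x = \int[leb]_(x in `[s, s']) qO x.
  apply: eq_Rintegral => x /set_mem /=; rewrite in_itv/= => /andP[sx xs].
  by rewrite /qO patchE ifT// inE/= in_itv/= (lt_le_trans ls)//= (le_lt_trans xs).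
apply/eqP; rewrite -subr_eq0 -normr_le0; apply/ler_addgt0Pr => e e0; rewrite add0r.
have e30 : 0 < e / 3 by rewrite divr_gt0.
have [d1 d10 dP1] := cvg_test_rstep ipO ps e30.
have [d2 d20 dP2] := cvg_test_rstep ipO ps' e30.
have [d3 d30 dP3] := integral_cutoff_close iqO ss e30.
have d40 : 0 < r - s' by lra.
have [h [h0 h1 h2 h3 h4]] : exists h, [/\ 0 < h, h < d1, h < d2, h < d3 & h < r - s'].
  exists (Num.min (Num.min d1 d2) (Num.min d3 (r - s')) / 2).
  have m0 : 0 < Num.min (Num.min d1 d2) (Num.min d3 (r - s')).
    by rewrite !lt_min d10 d20 d30.
  have lt2 (y : R) : Num.min (Num.min d1 d2) (Num.min d3 (r - s')) <= y ->
    Num.min (Num.min d1 d2) (Num.min d3 (r - s')) / 2 < y by lra.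
  split; first by rewrite divr_gt0.
  - by apply: lt2; rewrite !ge_min lexx.
  - by apply: lt2; rewrite !ge_min lexx !orbT.
  - by apply: lt2; rewrite !ge_min lexx !orbT.
  - by apply: lt2; rewrite !ge_min lexx !orbT.
have := pq _ (@test_fun_cutoff l r s s' h h0 ls ss _); rewrite (_ : s' + h < r)//; last lra.
move=> /(_ erefl).
rewrite Rintegral_mkcond [X in _ = - X]Rintegral_mkcond.
rewrite (_ : (_ \_ _) = fun x => pO x * derive1 (rstep s h) x -
    pO x * derive1 (rstep s' h) x); last first.
  apply/funext => x; rewrite /pO !patchE derive1_cutoff mulrBr.
  by case: (x \in _); rewrite ?mul0r ?subr0.
rewrite (_ : (fun x => q x * _) \_ _ = fun x => qO x * cutoff s s' h x); last first.
  by apply/funext => x; rewrite /qO !patchE; case: (x \in _); rewrite ?mul0r.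
have ik (c : R) : leb.-integrable setT (EFin \o (fun x => pO x * derive1 (rstep c h) x)).
  have [C C0 CP] := derive1_sstep_bounded.
  apply: (@integrable_mul_bounded _ _ _ (C * `|h^-1|)) => //.
    exact: continuous_measurable_fun (@continuous_derive1_rstep c h).
  by move=> x; rewrite derive1_rstep normrM ler_wpM2r.
rewrite RintegralB// => E.
have lr' : s < r by exact: le_lt_trans sr.
have ls' : l < s' by exact: lt_le_trans ss.
have := aux _ _ _ _ _ _ _ (dP1 _ h0 h1) (dP2 _ h0 h2) (dP3 _ h0 h3) E.
by rewrite (pOE _ ls lr') (pOE _ ls' sr).
Qed.

End weak_derivatives.

(** * Convex potentials *)

Section essential_bounds.
Context d (X : measurableType d) (R : realType).
Variable mu : {measure set X -> \bar R}.
Implicit Types (D : set X) (f : X -> R).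

Lemma Lp_norm_oo_le D f (C : R) : (Lp_norm mu D +oo f <= C%:E)%E ->
  \forall x \ae mu, D x -> `|f x| <= C.
Proof.
rewrite /Lp_norm unlock; case: ifPn => [_ /ess_supP|].
  apply: aeS => x; rewrite /= patchE => + Dx.
  by rewrite mem_set// lee_fin.
rewrite -leNgt => mu0 _; exists setT; split => //.
by apply/eqP; rewrite eq_le mu0 measure_ge0.
Qed.

Lemma le_Lp_norm_oo D f (C : R) : 0 <= C -> (forall x, D x -> `|f x| <= C) ->
  (Lp_norm mu D +oo f <= C%:E)%E.
Proof.
move=> C0 fC; rewrite /Lp_norm unlock; case: ifPn => [_|_]; last by rewrite lee_fin.
apply/ess_supP; apply: aeW => x /=; rewrite patchE; case: ifPn => [/set_mem Dx|_].
  by rewrite /= lee_fin fC.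
by rewrite /= normr0 lee_fin.
Qed.

Lemma in_Lp_oo_bounded D f : in_Lp mu D +oo f ->
  exists2 C, 0 <= C & \forall x \ae mu, D x -> `|f x| <= C.
Proof.
move=> [mf]; move: (Lp_norm_oo_le (D := D) (f := f)).
have : (0 <= Lp_norm mu D +oo f)%E by exact: Lnorm_ge0.
case: Lp_norm => [c|//|//] c0 H _; exists c; first by rewrite -lee_fin.
exact: H.
Qed.

Lemma ae_bounded_integrable D f (C : R) : measurable D -> (mu D < +oo)%E ->
  measurable_fun D f -> (\forall x \ae mu, D x -> `|f x| <= C) ->
  mu.-integrable D (EFin \o f).
Proof.
move=> mD Doo mf fC; apply/integrableP; split; first exact/measurable_EFinP.
apply: (@le_lt_trans _ _ (\int[mu]_(x in D) `|C|%:E)%E).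
  apply: ae_ge0_le_integral => //.
  - by apply: measurableT_comp => //; exact/measurable_EFinP.
  - apply: (aeS _ fC) => x fCx Dx; rewrite /= lee_fin.
    by rewrite (le_trans (fCx Dx))// ler_norm.
by rewrite integral_cst// lte_mul_pinfty.
Qed.

End essential_bounds.

Section potentials.
Context {R : realType}.
Notation leb := (@lebesgue_measure R).
Implicit Types (Phi f g : R -> R) (l r s x e : R).

Lemma ae_exists_itv (P : R -> Prop) (a b : R) : a < b ->
  (\forall x \ae leb, P x) -> exists2 x, a < x < b & P x.
Proof.
move=> ab [A [mA A0 PA]]; apply: contrapT => noP.
have : (leb `]a, b[%classic <= leb A)%E.
  apply: le_measure; rewrite ?inE//.
  move=> x /=; rewrite in_itv/= => xab; apply: (PA x) => /= Px.
  by apply: noP; exists x.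
rewrite [X in (_ <= X)%E]A0 /= lebesgue_measure_itv/= lte_fin ab -EFinD lee_fin.
by rewrite subr_le0 leNgt ab.
Qed.

Lemma within_open_continuous (T : topologicalType) (U : set R) (f : R -> T) x :
  open U -> U x -> {within U, continuous f} -> {for x, continuous f}.
Proof.
move=> oU Ux /subspace_continuousP/(_ x Ux) cf P nP.
have nU : nbhs x U by exact: open_nbhs_nbhs.
apply: (@filterS _ (nbhs x) _ _ (f @^-1` P) _ (filterI nU (cf P nP))) => y [Uy H].
exact: H.
Qed.

Lemma lebesgue_pt_restrict_open (U : set R) f x : open U -> U x ->
  measurable_fun U f -> {for x, continuous f} -> lebesgue_pt (f \_ U) x.
Proof.
move=> oU Ux mf cf; have nU : nbhs x U by exact: open_nbhs_nbhs.
apply: (@continuous_lebesgue_pt _ _ _ U) => //.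
- exact: open_measurable.
- have mU : measurable U by exact: open_measurable.
  have mRf : measurable_fun U (f \_ U).
    by apply/(measurable_restrict f mU mU); rewrite setIid.
  exact: mRf.
rewrite /prop_for /continuous_at patchE mem_set//.
apply: cvg_trans cf; apply: near_eq_cvg; near=> y; rewrite patchE mem_set//.
by near: y.
Unshelve. all: by end_near. Qed.

Lemma itvooP (l r x : R) : `]l, r[%classic x <-> l < x < r.
Proof. by rewrite /= in_itv. Qed.

Lemma measurable_C1 (U : set R) Phi : open U -> C1_on U Phi ->
  measurable_fun U Phi /\ measurable_fun U (derive1 Phi).
Proof.
move=> oU [dPhi cPhi']; split; apply: open_continuous_measurable_fun => //.
  move=> x /set_mem Ux; apply: differentiable_continuous.
  by apply/derivable1_diffP; exact: dPhi.
by move=> x /set_mem Ux; exact: (within_open_continuous oU Ux cPhi').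
Qed.

Section potential.
Variables (l r : R) (Phi : R -> R).
Hypothesis (lr : l < r).
Notation Omega := (`]l, r[%classic : set R).
Hypotheses (Phi1 : C1_on Omega Phi) (PhiW : W1oo Omega Phi).

Let mO : measurable (Omega : set (measurableTypeR R)).
Proof. exact: measurable_itv. Qed.

Let oO : open Omega. Proof. exact: itv_open. Qed.

Let Ooo : (leb Omega < +oo)%E.
Proof. by rewrite /= lebesgue_measure_itv/= lte_fin lr -EFinD ltry. Qed.

Lemma potential_cont x : l < x < r -> {for x, continuous Phi}.
Proof.
move=> /itvooP xO; have [dPhi _] := Phi1.
by apply: differentiable_continuous; apply/derivable1_diffP; exact: dPhi.
Qed.

Lemma potential_derive1_cont x : l < x < r -> {for x, continuous (derive1 Phi)}.
Proof. by move=> /itvooP xO; have [_] := Phi1; exact: within_open_continuous. Qed.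

(** The weak derivative g of W^{1,oo} has the increments of Phi as its integrals
   by weak_deriv_increment, so Lebesgue differentiation gives Phi' = g almost
   everywhere. The essential bound of g is then a bound of Phi' at every point,
   because Phi' is continuous. *)
Lemma potential_derive1 : exists C,
  (forall x, l < x < r -> `|derive1 Phi x| <= C) /\ weak_deriv Omega Phi (derive1 Phi).
Proof.
have [LPhi [g wg Lg]] := PhiW; have [dPhi _] := Phi1.
have [mPhi mPhi'] := measurable_C1 oO Phi1.
have [C0 C00 PhiC] := in_Lp_oo_bounded LPhi.
have [C C0' gC] := in_Lp_oo_bounded Lg.
have iPhi := ae_bounded_integrable mO Ooo LPhi.1 PhiC.
have ig := ae_bounded_integrable mO Ooo Lg.1 gC.
have inc s s' : l < s -> s <= s' -> s' < r ->
    Phi s' - Phi s = \int[leb]_(x in `[s, s']) g x.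
  move=> ls ss sr; apply: (weak_deriv_increment iPhi ig wg) => //.
    apply: lebesgue_pt_restrict_open => //; first by rewrite /= in_itv/= ls (le_lt_trans ss).
    by apply: potential_cont; rewrite ls (le_lt_trans ss).
  apply: lebesgue_pt_restrict_open => //; first by rewrite /= in_itv/= sr (lt_le_trans ls).
  by apply: potential_cont; rewrite sr (lt_le_trans ls).
pose gO := (g \_ Omega).
have igO : leb.-integrable setT (EFin \o gO).
  by rewrite -restrict_EFin; apply/(integrable_mkcond _ _).1.
have lgO : locally_integrable setT gO.
  by apply: open_integrable_locally => //; exact: openT.
have Phi'g : \forall x \ae leb, Omega x -> derive1 Phi x = g x.
  apply: aeS (lebesgue_differentiation lgO) => x xleb /itvooP/andP[lx xr].
  pose a := (l + x) / 2; pose b := (x + r) / 2.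
  have [la ax xb br] : [/\ l < a, a < x, x < b & b < r].
    by rewrite /a /b; split; lra.
  have iab : leb.-integrable [set` Interval (BLeft a) (BRight b)] (EFin \o gO).
    exact: integrableS igO.
  have ax' : (BLeft a < BRight x)%E by rewrite lte_fin.
  have [dF] := FTC1_lebesgue_pt xb iab ax' xleb.
  rewrite {2}/gO patchE mem_set/=; last by rewrite in_itv/= lx.
  move=> <-; apply: is_derive_derive1.
  have : is_derive x 1 (fun y => Phi a + \int[leb]_(t in `[a, y]) gO t)
     (derive1 (fun y => \int[leb]_(t in `[a, y]) gO t) x).
    apply: is_derive_eq; first apply: is_deriveD.
      exact: derivable_is_derive.
    by rewrite add0r.
  apply: near_eq_is_derive; near=> y.
  have ya : a < y by near: y; exact: lt_nbhsr.
  have yb : y < b by near: y; exact: lt_nbhsl.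
  have -> : \int[leb]_(t in `[a, y]) gO t = \int[leb]_(t in `[a, y]) g t.
    apply: eq_Rintegral => t /set_mem /=; rewrite in_itv/= => /andP[at' ty].
    by rewrite /gO patchE mem_set//= in_itv/= (lt_le_trans la)//= (le_lt_trans ty)// (lt_trans yb).
  by rewrite -inc ?(ltW ya)//; [ring|rewrite (lt_trans yb)].
exists C; split.
  move=> x xO; apply/ler_addgt0Pr => e e0.
  have cx := potential_derive1_cont xO.
  have [d d0 dP] : exists2 d, 0 < d & forall y, `|x - y| < d -> `|derive1 Phi x - derive1 Phi y| < e.
    by have /cvgrPdist_lt/(_ _ e0)[d /= d0 dP] := cx; exists d.
  have [] := @ae_exists_itv (fun y => (Omega y -> derive1 Phi y = g y) /\ (Omega y -> `|g y| <= C))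
     x (Num.min (x + d) r).
  - by rewrite lt_min ltrDl d0; case/andP: xO.
  - exact: aeI.
  move=> y /andP[xy]; rewrite lt_min => /andP[yd yr] [E B].
  have yO : Omega y by apply/itvooP; rewrite yr andbT (lt_trans _ xy)//; case/andP: xO.
  have := dP y; rewrite ltr0_norm ?subr_lt0// => /(_ ltac:(lra)).
  move: (B yO); rewrite -E// => B1 B2.
  have -> : derive1 Phi x = (derive1 Phi x - derive1 Phi y) + derive1 Phi y by ring.
  by rewrite (le_trans (ler_normD _ _))// addrC lerD// ltW.
move=> psi tpsi; rewrite wg//; congr (- _).
have tb : measurable_fun Omega psi.
  apply: measurable_funTS; apply: continuous_measurable_fun.
  exact: smooth_continuous (test_fun_smooth tpsi).
rewrite /Rintegral; congr fine; apply: ae_eq_integral => //.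
- apply/measurable_EFinP; apply: measurable_funM => //.
  exact: (Lg.1).
- by apply/measurable_EFinP; apply: measurable_funM.
- by apply: aeS Phi'g => x /= E Ox; rewrite E.
Unshelve. all: by end_near. Qed.

Lemma potential_bounded : exists C, forall x, l < x < r -> `|Phi x| <= C.
Proof.
have [C [PhiC _]] := potential_derive1; have [dPhi _] := Phi1.
pose m := (l + r) / 2; have mO' : l < m < r by rewrite /m; have := lr; move=> ?; apply/andP; split; lra.
have C0 : 0 <= C by rewrite (le_trans _ (PhiC _ mO')).
have lip x y : l < x -> x <= y -> y < r -> `|Phi y - Phi x| <= C * (y - x).
  move=> lx; rewrite le_eqVlt => /predU1P[<-|xy yr]; first by rewrite !subrr mulr0 normr0.
  have [c | | c cO ->] := MVT (f := Phi) (df := derive1 Phi) xy.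
  - rewrite in_itv/= => /andP[xc cy]; apply: derivable_is_derive; apply: dPhi.
    by apply/itvooP; rewrite (lt_trans lx)//= (lt_trans cy).
  - apply: continuous_in_subspaceT => c /set_mem /=; rewrite in_itv/= => /andP[xc cy].
    by apply: potential_cont; rewrite (lt_le_trans lx)//= (le_lt_trans cy).
  rewrite normrM (gtr0_norm (_ : 0 < y - x)) ?subr_gt0// ler_wpM2r ?subr_ge0 ?(ltW xy)//.
  move: cO; rewrite in_itv/= => /andP[xc cy].
  by apply: PhiC; rewrite (lt_trans lx)//= (lt_trans cy).
exists (`|Phi m| + C * (r - l)) => x /andP[lx xr]; move: mO' => /andP[lm mr].
have -> : Phi x = Phi m + (Phi x - Phi m) by ring.
rewrite (le_trans (ler_normD _ _))// lerD2l.
have [xm|xm] := leP x m.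
  rewrite distrC (le_trans (lip _ _ _ _ _))// ler_wpM2l//; lra.
by rewrite (le_trans (lip _ _ _ _ _)) ?(ltW xm)// ler_wpM2l//; lra.
Qed.

Hypothesis PhiD : distr_deriv2_ge0 Omega Phi.

(** The derivative of the cutoff between x and y is a difference of two
   approximate Dirac masses, so testing Phi'' >= 0 with it gives
   Phi' x - Phi' y <= 0 in the limit. *)
Lemma potential_derive1_nd x y : l < x -> x <= y -> y < r ->
  derive1 Phi x <= derive1 Phi y.
Proof.
have aux (I1 I2 u v c : R) : `|I1 - u| <= c / 2 -> `|I2 - v| <= c / 2 ->
    0 <= - (I1 - I2) -> u <= v + c.
  by rewrite !ler_norml => /andP[a1 a2] /andP[a3 a4]; lra.
move=> lx; rewrite le_eqVlt => /predU1P[->//|xy yr].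
have [C [PhiC wPhi]] := potential_derive1.
have [mPhi mPhi'] := measurable_C1 oO Phi1.
have iPhi' : leb.-integrable Omega (EFin \o derive1 Phi).
  apply: (@ae_bounded_integrable _ _ _ leb Omega _ C) => //.
  by apply: aeW => z /itvooP; exact: PhiC.
pose w := (derive1 Phi \_ Omega).
have iw : leb.-integrable setT (EFin \o w).
  by rewrite -restrict_EFin; apply/(integrable_mkcond _ _).1.
have wleb z : l < z < r -> lebesgue_pt w z.
  move=> zO; apply: lebesgue_pt_restrict_open => //.
  exact: potential_derive1_cont.
have wE z : l < z < r -> w z = derive1 Phi z.
  by move=> zO; rewrite /w patchE mem_set//; by apply/itvooP.
have xO : l < x < r by rewrite lx (lt_trans xy).
have yO : l < y < r by rewrite yr (lt_trans lx).
apply/ler_addgt0Pr => e e0.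
have e20 : 0 < e / 2 by rewrite divr_gt0.
have [d1 d10 dP1] := cvg_test_rstep iw (wleb _ xO) e20.
have [d2 d20 dP2] := cvg_test_rstep iw (wleb _ yO) e20.
have [h [h0 h1 h2 h3]] : exists h, [/\ 0 < h, h < d1, h < d2 & h < r - y].
  exists (Num.min d1 (Num.min d2 (r - y)) / 2).
  have m0 : 0 < Num.min d1 (Num.min d2 (r - y)) by rewrite !lt_min d10 d20 subr_gt0.
  have lt2 (z : R) : Num.min d1 (Num.min d2 (r - y)) <= z ->
    Num.min d1 (Num.min d2 (r - y)) / 2 < z by lra.
  split; first by rewrite divr_gt0.
  - by apply: lt2; rewrite !ge_min lexx.
  - by apply: lt2; rewrite !ge_min lexx !orbT.
  - by apply: lt2; rewrite !ge_min lexx !orbT.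
have tc : test_fun Omega (cutoff x y h).
  by apply: test_fun_cutoff; rewrite ?(ltW xy)//; lra.
have := PhiD tc (fun z => cutoff_ge0 z h0 (ltW xy)).
rewrite (_ : derive1n 2 _ = derive1 (derive1 (cutoff x y h)))//.
rewrite (wPhi _ (test_fun_derive1 tc)) Rintegral_mkcond.
rewrite (_ : (_ \_ _) = fun z => w z * derive1 (rstep x h) z -
    w z * derive1 (rstep y h) z); last first.
  apply/funext => z; rewrite /w !patchE; case: ifP => _; last by rewrite !mul0r subr0.
  by rewrite derive1_cutoff mulrBr.
have ik (c : R) : leb.-integrable setT (EFin \o (fun z => w z * derive1 (rstep c h) z)).
  have [D D0 DP] := @derive1_sstep_bounded R.
  apply: (@integrable_mul_bounded _ _ _ (D * `|h^-1|)) => //.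
    exact: continuous_measurable_fun (@continuous_derive1_rstep _ c h).
  by move=> z; rewrite derive1_rstep normrM ler_wpM2r.
rewrite RintegralB// => H.
by have := aux _ _ _ _ _ (dP1 _ h0 h1) (dP2 _ h0 h2) H; rewrite !wE.
Qed.

(** The mean value theorem turns monotonicity of Phi' into the tangent
   inequality, the only form of convexity that the minimization uses. *)
Lemma potential_tangent c x : l < c < r -> l < x < r ->
  Phi c + derive1 Phi c * (x - c) <= Phi x.
Proof.
move=> cO xO; have [dPhi _] := Phi1.
have mvt a b : l < a -> a < b -> b < r -> exists2 z, a < z < b &
    Phi b - Phi a = derive1 Phi z * (b - a).
  move=> la ab br.
  have [z | | z zab ->] := MVT (f := Phi) (df := derive1 Phi) ab.
  - rewrite in_itv/= => /andP[az zb]; apply: derivable_is_derive; apply: dPhi.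
    by apply/itvooP; rewrite (lt_trans la)//= (lt_trans zb).
  - apply: continuous_in_subspaceT => z /set_mem /=; rewrite in_itv/= => /andP[az zb].
    by apply: potential_cont; rewrite (lt_le_trans la)//= (le_lt_trans zb).
  by exists z => //; move: zab; rewrite in_itv.
move: cO xO => /andP[lc cr] /andP[lx xr].
have [xc|cx|->] := ltgtP x c; last by rewrite subrr mulr0 addr0.
- have [z /andP[xz zc] E] := mvt _ _ lx xc cr.
  have D := potential_derive1_nd (lt_trans lx xz) (ltW zc) cr.
  have := @ler_wpM2r _ (c - x) _ _ _ D; rewrite subr_ge0 (ltW xc) => /(_ erefl).
  lra.
- have [z /andP[cz zx] E] := mvt _ _ lc cx xr.
  have D := potential_derive1_nd lc (ltW cz) (lt_trans zx xr).
  have := @ler_wpM2r _ (x - c) _ _ _ D; rewrite subr_ge0 (ltW cx) => /(_ erefl).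
  lra.
Qed.

(** At the end points of Omega the limit exists because Phi' is bounded and
   monotone. *)
Lemma potential_drift_at x : l <= x <= r -> exists v : R, drift_at Omega Phi x v.
Proof.
move=> /andP[lx xr].
have [C [PhiC _]] := potential_derive1.
pose D := [set derive1 Phi y | y in Omega].
pose m := (l + r) / 2; have mOm : Omega m by apply/itvooP; rewrite /m; have := lr; move=> ?; apply/andP; split; lra.
have D0 : D !=set0 by exists (derive1 Phi m); exists m.
have Dub : has_ubound D.
  exists C => _ [y /itvooP yO <-]; by rewrite (le_trans (ler_norm _))// PhiC.
have Dlb : has_lbound D.
  exists (- C) => _ [y /itvooP yO <-]; by rewrite lerNl (le_trans (ler_norm _))// normrN PhiC.
move: lx; rewrite le_eqVlt => /predU1P[<-|lx].
  exists (inf D); apply/cvgrPdist_le => /= e e0.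
  have [_ [y /itvooP/andP[ly yr] <-] ye] := inf_adherent e0 (conj D0 Dlb).
  near=> z.
  have zO : Omega z by near: z; exact: withinT.
  have zy : z < y by near: z; apply: cvg_within; exact: lt_nbhsl.
  have /itvooP/andP[lz zr] := zO.
  have h1 : inf D <= derive1 Phi z by apply: ge_inf => //; exists z.
  have h2 := potential_derive1_nd lz (ltW zy) yr.
  by rewrite ler_norml; apply/andP; split; lra.
move: xr; rewrite le_eqVlt => /predU1P[->|xr].
  exists (sup D); apply/cvgrPdist_le => /= e e0.
  have [_ [y /itvooP/andP[ly yr] <-] ye] := sup_adherent e0 (conj D0 Dub).
  near=> z.
  have zO : Omega z by near: z; exact: withinT.
  have yz : y < z by near: z; apply: cvg_within; exact: lt_nbhsr.
  have /itvooP/andP[lz zr] := zO.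
  have h1 : derive1 Phi z <= sup D by apply: ub_le_sup => //; exists z.
  have h2 := potential_derive1_nd ly (ltW yz) zr.
  by rewrite ler_norml; apply/andP; split; lra.
exists (derive1 Phi x); apply: cvg_trans; last first.
  by apply: potential_derive1_cont; rewrite lx.
by apply: cvg_app; exact: cvg_within.
Unshelve. all: by end_near. Qed.

End potential.

End potentials.

(** * Measures with densities *)

Section reals_measurable_structures.
Context {R : realType}.

(** The identity from the real line to the measurable type that carries the
   Lebesgue measure: the two sigma-algebras are the same, their structures are
   not. *)
Definition toTypeR : R -> measurableTypeR R := id.

Lemma measurable_toTypeR : measurable_fun setT toTypeR.
Proof. by move=> _ Y mY; rewrite setTI; exact: mY. Qed.

Variable mu : {measure set R -> \bar R}.

Definition toR := pushforward mu toTypeR.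

HB.instance Definition _ := isMeasure.Build _ _ _ toR
  (@measure0 _ _ _ mu) (measure_ge0 mu) (@measure_semi_sigma_additive _ _ _ mu).

Lemma toR_integral (D : set R) (g : R -> \bar R) : measurable D ->
  mu.-integrable D g ->
  toR.-integrable D g /\ (\int[toR]_(x in D) g x = \int[mu]_(x in D) g x)%E.
Proof.
move=> mD ig.
have mDR : measurable (D : set (measurableTypeR R)) by exact: mD.
have igD : mu.-integrable setT (g \_ D) by apply/(integrable_mkcond _ _).1.
have mgD : measurable_fun [set: measurableTypeR R] (g \_ D).
  by have := measurable_int _ igD; exact.
split.
  apply/(integrable_mkcond _ mDR).2.
  by apply: (@integrable_pushforward _ _ _ _ _ toTypeR measurable_toTypeR mu).
rewrite integral_mkcond [RHS]integral_mkcond.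
have igT : mu.-integrable (toTypeR @^-1` setT) ((g \_ D) \o toTypeR).
  by rewrite preimage_setT.
by rewrite (integral_pushforward measurable_toTypeR mgD igT).
Qed.

End reals_measurable_structures.

Section densities.
Context {R : realType}.
Notation leb := (@lebesgue_measure R).
Implicit Types (f g : R -> R) (Omega A D : set R) (M : R).
Implicit Type mu : {measure set R -> \bar R}.

Lemma in_PM_finite Omega M mu : in_PM Omega M mu -> (mu setT < +oo)%E.
Proof. by move=> [_ ->]; rewrite ltry. Qed.

Lemma in_PM_Omega Omega M mu : measurable Omega -> in_PM Omega M mu ->
  mu Omega = M%:E.
Proof.
move=> mO [muC muT]; have mOC := measurableC mO.
have E : mu setT = (mu Omega + mu (~` Omega))%E.
  by rewrite -measureU ?setUv//; exact: setICr.
by move: E; rewrite muT muC adde0.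
Qed.

Lemma in_PM_integrable Omega M mu (g : R -> R) : measurable Omega -> in_PM Omega M mu ->
  measurable_fun Omega g -> (exists C, forall x, Omega x -> `|g x| <= C) ->
  mu.-integrable Omega (EFin \o g).
Proof.
move=> mO PMmu mg [C gC].
apply: (@ae_bounded_integrable _ _ _ mu Omega _ C) => //.
  by rewrite (in_PM_Omega mO PMmu) ltry.
exact: aeW.
Qed.

(** A density of a finite measure is its Radon-Nikodym derivative, which gives
   its sign and the change of variables. *)
Lemma has_density_props Omega M mu f : measurable Omega -> in_PM Omega M mu ->
  has_density Omega mu f ->
  [/\ leb.-integrable Omega (EFin \o f),
      \forall x \ae leb, Omega x -> 0 <= f x &
      forall D g, measurable D -> D `<=` Omega -> mu.-integrable D (EFin \o g) ->
        leb.-integrable D (EFin \o (fun x => g x * f x)) /\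
        \int[mu]_(x in D) g x = \int[leb]_(x in D) (g x * f x)].
Proof.
move=> mO PMmu [mf muf].
have moo : (toR mu setT < +oo)%E by exact: in_PM_finite PMmu.
pose nu : {finite_measure set (measurableTypeR R) -> \bar R} :=
  mfrestr measurableT moo.
have nuE (A : set R) : nu A = mu A by rewrite /nu /= /mfrestr /mrestr setIT.
have numu : nu `<< leb.
  apply/null_content_dominatesP => A mA A0; rewrite nuE muf//.
  have mAO : measurable (A `&` Omega) by exact: measurableI.
  apply: null_set_integral => //.
    by apply/measurable_EFinP; exact: measurable_funS mf.
  apply/eqP; rewrite -measure_le0 -A0.
  by apply: le_measure; rewrite ?inE//; exact: subIsetl.
pose phi := Radon_Nikodym_SigmaFinite.f nu leb.
have phi0 := Radon_Nikodym_SigmaFinite.f_ge0 numu.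
have iphi := Radon_Nikodym_SigmaFinite.f_integrable numu.
have mOR : measurable (Omega : set (measurableTypeR R)) by exact: mO.
have iphiO : leb.-integrable Omega phi by exact: integrableS iphi.
have phif : ae_eq leb Omega phi (EFin \o f).
  apply: integral_ae_eq => //; first exact/measurable_EFinP.
  move=> E EO mE; rewrite -(Radon_Nikodym_SigmaFinite.f_integral numu mE).
  by rewrite nuE muf// setIidl.
have phifd : ae_eq leb Omega
    (Radon_Nikodym (charge_of_finite_measure nu) leb) (EFin \o f).
  apply: ae_eq_trans phif; apply: ae_eq_sym.
  exact: ae_eq_Radon_Nikodym_SigmaFinite.
have mphi := measurable_int _ iphiO.
have if_ : leb.-integrable Omega (EFin \o f).
  apply/integrableP; split; first exact/measurable_EFinP.
  have /integrableP[_] := iphiO; apply: le_lt_trans.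
  rewrite le_eqVlt; apply/orP; left; apply/eqP.
  apply: ae_eq_integral => //.
  - by apply: measurableT_comp => //; exact/measurable_EFinP.
  - exact: measurableT_comp.
  - by apply: aeS phif => x E Ox; rewrite E.
have f0 : \forall x \ae leb, Omega x -> 0 <= f x.
  by apply: aeS phif => x E Ox; rewrite -lee_fin -[(f x)%:E]E.
have CV D g : measurable D -> D `<=` Omega -> mu.-integrable D (EFin \o g) ->
   measurable_fun D (fun x => (g x * f x)%:E) /\
   (\int[mu]_(x in D) (g x)%:E = \int[leb]_(x in D) ((g x * f x)%:E))%E.
  move=> mD DO ig.
  have mDR : measurable (D : set (measurableTypeR R)) by exact: mD.
  have [ig' Eg] := toR_integral mD ig.
  have ign : nu.-integrable D (EFin \o g).
    apply/integrableP; split; first exact: (measurable_int _ ig').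
    have /integrableP[_] := ig'; apply: le_lt_trans.
    rewrite le_eqVlt; apply/orP; left; apply/eqP.
    by apply: eq_measure_integral => A mA _; exact: nuE.
  have mg := measurable_int _ ig'.
  have RNfD : ae_eq leb D
      (Radon_Nikodym (charge_of_finite_measure nu) leb) (EFin \o f).
    by apply: aeS phifd => x E /DO Ox; exact: E.
  have mfD : measurable_fun D (EFin \o f).
    by apply/measurable_EFinP; exact: measurable_funS mf.
  have mgf : measurable_fun D (fun x => (g x * f x)%:E) by exact: (emeasurable_funM mg mfD).
  split => //.
  rewrite -Eg (_ : \int[toR mu]_(x in D) _ = \int[nu]_(x in D) (g x)%:E)%E; last first.
    by apply: eq_measure_integral => A mA _; exact/esym/nuE.
  rewrite -(Radon_Nikodym_change_of_variables numu mDR ign).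
  apply: ae_eq_integral => //.
  - apply: emeasurable_funM => //; apply: measurable_funTS.
    have H := @Radon_Nikodym_integrable _ _ _ (charge_of_finite_measure nu) leb numu.
    exact: measurable_int H.
  - by apply: aeS RNfD => x E Dx /=; rewrite E.
split => // D g mD DO ig.
have [mgf CVg] := CV D g mD DO ig.
split; last by rewrite /Rintegral CVg.
have mDR : measurable (D : set (measurableTypeR R)) by exact: mD.
have iag := integrable_norm ig.
have [maf CVa] := CV D _ mD DO iag.
apply/integrableP; split => //.
rewrite (_ : (\int[leb]_(x in D) _ = \int[leb]_(x in D) ((`|g x| * f x)%:E))%E); last first.
  apply: ae_eq_integral => //; first exact: measurableT_comp.
  by apply: aeS f0 => x fx /DO Ox; rewrite /= normrM (ger0_norm (fx Ox)).
rewrite -CVa.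
by have /integrableP[_] := iag; apply: le_lt_trans; apply: le_trans (le_abse_integral _ _ _) => //;
  [exact: lee_abs|exact: measurable_int iag].
Qed.

End densities.

(** * The bathtub principle *)

Section bathtub.
Context {R : realType}.
Notation leb := (@lebesgue_measure R).
Implicit Types (f g h : R -> R) (D : set R) (x y z : R).

Lemma ae_le_Rintegral f g : leb.-integrable setT (EFin \o f) ->
  leb.-integrable setT (EFin \o g) -> (\forall x \ae leb, f x <= g x) ->
  \int[leb]_x f x <= \int[leb]_x g x.
Proof.
move=> jf jg fg.
have mf : measurable_fun setT f by apply/measurable_EFinP; exact: measurable_int jf.
have mg : measurable_fun setT g by apply/measurable_EFinP; exact: measurable_int jg.
have mm : measurable_fun setT (fun x => Num.min (f x) (g x)) by exact: measurable_minr.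
have E : (\int[leb]_x (f x)%:E = \int[leb]_x (Num.min (f x) (g x))%:E)%E.
  apply: ae_eq_integral => //; try exact/measurable_EFinP.
  by apply: aeS fg => x fx _; rewrite min_l.
have jm : leb.-integrable setT (EFin \o (fun x => Num.min (f x) (g x))).
  have jfg := integrableD measurableT (integrable_norm jf) (integrable_norm jg).
  apply: le_integrable jfg => //; first exact/measurable_EFinP.
  move=> x _; rewrite /= lee_fin.
  rewrite [leRHS]ger0_norm ?addr_ge0//.
  by case: (leP (f x) (g x)) => _; rewrite ?lerDl ?lerDr.
rewrite /Rintegral E; apply: le_Rintegral => // x _.
by rewrite ge_min lexx orbT.
Qed.

Lemma integrable_restrictT f D : measurable D -> leb.-integrable D (EFin \o f) ->
  leb.-integrable setT (EFin \o (f \_ D)).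
Proof.
by move=> mD; rewrite -restrict_EFin; move/(integrable_mkcond _ _).1; exact.
Qed.

Section moments.
Variables (l r : R).
Notation Omega := (`]l, r[%classic : set R).

Definition bounded_meas g := measurable_fun Omega g /\
  exists C, forall x, Omega x -> `|g x| <= C.

Lemma bounded_meas_lin (a b : R) g h : bounded_meas g -> bounded_meas h ->
  bounded_meas (fun x => a * g x + b * h x).
Proof.
move=> [mg [C gC]] [mh [B hB]]; split.
  by apply: measurable_funD; apply: measurable_funM.
exists (`|a| * C + `|b| * B) => x Ox.
rewrite (le_trans (ler_normD _ _))// !normrM.
by rewrite lerD// ler_wpM2l//; [exact: gC|exact: hB].
Qed.

Lemma bounded_meas_cst (c : R) : bounded_meas (fun=> c).
Proof. by split => //; exists `|c|. Qed.

Lemma bounded_meas_id : bounded_meas id.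
Proof.
split => //; exists (`|l| + `|r|) => x /=; rewrite in_itv/= => /andP[lx xr].
have := ler_norm r; have := lerNnormlW (lexx `|l|).
have := normr_ge0 r; have := normr_ge0 l => ? ? ? ?.
by rewrite ler_norml; apply/andP; split; lra.
Qed.

Lemma bounded_meas_affine (a b : R) : bounded_meas (fun x => a * x + b).
Proof.
have := bounded_meas_lin a b bounded_meas_id (bounded_meas_cst 1).
by congr bounded_meas; apply/funext => x; rewrite mulr1.
Qed.

Variables (D : set R).
Hypotheses (mD : measurable (D : set (measurableTypeR R))) (DO : D `<=` Omega).

Lemma integrable_bounded_mul f g : leb.-integrable D (EFin \o f) ->
  bounded_meas g -> leb.-integrable D (EFin \o (fun x => g x * f x)).
Proof.
move=> jf [mg [C gC]].
have := @integrableMr _ _ _ leb D mD g (EFin \o f).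
apply => //; first exact: measurable_funS mg.
exists C; split; first exact: num_real.
by move=> B CB x Dx /=; rewrite (le_trans (gC _ (DO Dx)))// ltW.
Qed.

Lemma Rintegral_lin f (a b : R) g h : leb.-integrable D (EFin \o f) ->
  bounded_meas g -> bounded_meas h ->
  \int[leb]_(x in D) ((a * g x + b * h x) * f x) =
  a * \int[leb]_(x in D) (g x * f x) + b * \int[leb]_(x in D) (h x * f x).
Proof.
move=> jf bg bh.
have jg := integrable_bounded_mul jf bg; have jh := integrable_bounded_mul jf bh.
rewrite -RintegralZl// -RintegralZl// -RintegralD//.
- by apply: eq_Rintegral => x _; ring.
- exact: (integrableZl mD a jg).
- exact: (integrableZl mD b jh).
Qed.

Lemma Rintegral_affine f (a b : R) : leb.-integrable D (EFin \o f) ->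
  \int[leb]_(x in D) ((a * x + b) * f x) =
  a * \int[leb]_(x in D) (x * f x) + b * \int[leb]_(x in D) f x.
Proof.
move=> jf; have := Rintegral_lin a b jf bounded_meas_id (bounded_meas_cst 1).
under [X in _ = _ + _ * X -> _]eq_Rintegral do rewrite mul1r.
by under eq_Rintegral do rewrite mulr1.
Qed.

(** The bathtub principle. Pointwise g * f dominates g * \1_(]a, b[), since
   shrinking f <= 1 on the region where g <= 0 and adding mass where g >= 0 can
   only increase the integral. *)
Lemma bathtub f g a b : `]a, b[ `<=` Omega -> leb.-integrable D (EFin \o f) ->
  (\forall x \ae leb, D x -> 0 <= f x <= 1) -> bounded_meas g ->
  (forall x, Omega x -> a < x < b -> g x <= 0) ->
  (forall x, D x -> x <= a \/ b <= x -> 0 <= g x) ->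
  \int[leb]_(x in `]a, b[) g x <= \int[leb]_(x in D) (g x * f x).
Proof.
move=> IO jf f01 bg gI gO.
have mI : measurable (`]a, b[%classic : set (measurableTypeR R)) by exact: measurable_itv.
have jg : leb.-integrable `]a, b[ (EFin \o g).
  have [mg [C gC]] := bg.
  apply: (@ae_bounded_integrable _ _ _ leb _ _ C) => //.
  - rewrite /= lebesgue_measure_itv/=; case: ifP => // _; by rewrite -EFinB ltry.
  - exact: measurable_funS mg.
  - by apply: aeW => x /IO; exact: gC.
rewrite Rintegral_mkcond [leRHS]Rintegral_mkcond.
apply: ae_le_Rintegral.
- exact: integrable_restrictT.
- exact/integrable_restrictT/integrable_bounded_mul.
apply: aeS f01 => x f01; rewrite !patchE.
case: ifPn => [/set_mem xI|/negP xI]; case: ifPn => [/set_mem Dx|_] //.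
- have /andP[f0 f1] := f01 Dx; have := gI x (DO Dx).
  by rewrite /= in_itv/= in xI; move=> /(_ xI) g0; nra.
- by move: (xI); rewrite /= in_itv/=; exact/gI/IO.
have /andP[f0 f1] := f01 Dx; rewrite mulr_ge0//; apply: gO => //.
case: (leP x a) => xa; [by left|right; rewrite leNgt; apply/negP => xb].
by apply: xI; rewrite inE/= in_itv/= xa.
Qed.

End moments.

Lemma Rintegral_patch_affine (y M a b : R) : 0 < M ->
  \int[leb]_(x in `]y, y + M[) (a * x + b) = a * (M * y + M ^+ 2 / 2) + b * M.
Proof.
move=> M0; have yM : y < y + M by rewrite ltrDl.
have cf : continuous (fun x : R => a * x + b).
  move=> x; apply: differentiable_continuous; apply/derivable1_diffP.
  by have [] := is_derive_affine a b x.
have dF x : is_derive x 1 (fun x => a / 2 * x ^+ 2 + b * x) (a * x + b).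
  have d1 : is_derive x 1 (fun x : R => x ^+ 2) (2 * x).
    have := @is_deriveX R R id 2 x 1 1 (is_derive_id _ _).
    by rewrite exprfctE /GRing.scale/= expr1 mulr1.
  have d2 : is_derive x 1 (fun x => a / 2 * x ^+ 2) (a / 2 * (2 * x)).
    exact: (@is_deriveZ R R R (fun x => x ^+ 2) (a / 2) x 1 _ d1).
  have d3 : is_derive x 1 (fun x => b * x) b.
    have := is_derive_affine b 0 x; rewrite (_ : (fun y => _) = (fun y => b * y))//.
    by apply/funext => t; rewrite addr0.
  by apply: (is_derive_eq (is_deriveD d2 d3)); field.
have jc : leb.-integrable `[y, y + M] (EFin \o (fun x => a * x + b)).
  by apply: continuous_compact_integrable; [exact: segment_compact|exact: continuous_subspaceT].
have := Rintegral_FTC2 yM cf dF.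
rewrite -Rintegral_itv_bndo_bndc; last by apply: integrableS jc => //; apply: subset_itv; rewrite bnd_simp.
rewrite -Rintegral_itv_obnd_cbnd; last by apply: integrableS jc => //; apply: subset_itv; rewrite bnd_simp.
by move=> ->; field.
Qed.

End bathtub.

(** * Means, lines and cuts *)

Section competitors.
Context {R : realType}.
Notation leb := (@lebesgue_measure R).
Implicit Types (f g h Phi dPhi : R -> R) (D : set R) (x y z : R).

(** The extreme first moments are those of the indicators of ]c, c + m[ and of
   ]d - m, d[, by the bathtub principle for an affine g vanishing at the inner
   end point. *)
Lemma mean_bounds (c d m : R) D f : c < d -> 0 < m ->
  measurable (D : set (measurableTypeR R)) -> D `<=` `]c, d[ ->
  leb.-integrable D (EFin \o f) -> (\forall x \ae leb, D x -> 0 <= f x <= 1) ->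
  \int[leb]_(x in D) f x = m ->
  c * m + m ^+ 2 / 2 <= \int[leb]_(x in D) (x * f x) <= (d - m) * m + m ^+ 2 / 2.
Proof.
move=> cd m0 mD Dcd jf f01 fm.
(* the larger interval contains the extreme patches whether or not m <= d - c *)
have DO : D `<=` `]c - m, d + m[.
  move=> x /Dcd; rewrite /= !in_itv/= => /andP[cx xd]; apply/andP; split; lra.
have BA := @bounded_meas_affine R (c - m) (d + m).
have A := @Rintegral_affine R (c - m) (d + m) D mD DO f.
have B := @bathtub R (c - m) (d + m) D mD DO f.
apply/andP; split.
- have := B (fun x => 1 * x + - (c + m)) c (c + m).
  rewrite Rintegral_patch_affine// A// fm => H.
  have /H : `]c, c + m[ `<=` `]c - m, d + m[.
    by apply: subset_itv; rewrite bnd_simp; lra.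
  move=> /(_ jf f01 (BA _ _)) => {}H.
  have gI x : `]c - m, d + m[%classic x -> c < x < c + m -> 1 * x + - (c + m) <= 0.
    by move=> _ /andP[_ xc]; lra.
  have gO x : D x -> x <= c \/ c + m <= x -> 0 <= 1 * x + - (c + m).
    by move=> /Dcd; rewrite /= in_itv/= => /andP[cx xd] [xc|xc]; lra.
  by move: (H gI gO) => {}H; clear -H; lra.
- have := B (fun x => (-1) * x + (d - m)) (d - m) d.
  rewrite (_ : `]d - m, d[%classic = `]d - m, d - m + m[%classic); last by rewrite subrK.
  rewrite Rintegral_patch_affine// A// fm => H.
  have /H : `]d - m, d - m + m[ `<=` `]c - m, d + m[.
    by apply: subset_itv; rewrite bnd_simp; lra.
  move=> /(_ jf f01 (BA _ _)) => {}H.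
  have gI x : `]c - m, d + m[%classic x -> d - m < x < d ->
      (-1) * x + (d - m) <= 0.
    by move=> _ /andP[xc _]; lra.
  have gO x : D x -> x <= d - m \/ d <= x -> 0 <= (-1) * x + (d - m).
    by move=> /Dcd; rewrite /= in_itv/= => /andP[cx xd] [xc|xc]; lra.
  by move: (H gI gO) => {}H; clear -H; lra.
Qed.

(** The line is the chord of the convex function Phi over ]y, y + M[. If one end
   point of the patch is an end point of ]l, r[, where Phi has no value, it is
   the line of slope C or - C through the other end point. *)
Lemma patch_line (l r C y M : R) Phi dPhi :
  (forall c x, l < c < r -> l < x < r -> Phi c + dPhi c * (x - c) <= Phi x) ->
  (forall x, l < x < r -> `|dPhi x| <= C) ->
  0 < M -> l <= y -> y + M <= r -> M < r - l ->
  exists a b, (forall x, l < x < r -> y < x < y + M -> Phi x <= a * x + b) /\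
    (forall x, l < x < r -> x <= y \/ y + M <= x -> a * x + b <= Phi x).
Proof.
move=> tan dC M0 ly yr Mlr.
have dC' x : l < x < r -> - C <= dPhi x <= C by move=> /dC; rewrite ler_norml.
have [yl|yl] := leP y l.
  have {yl ly} -> : y = l by apply/eqP; rewrite eq_le yl.
  have bO : l < l + M < r by apply/andP; split; lra.
  exists (- C), (Phi (l + M) + C * (l + M)); split => x xO.
    move=> /andP[_ xb]; have := tan _ _ xO bO; have /andP[d1 d2] := dC' _ xO.
    by clear -d1 xb; nra.
  case=> [xl|bx]; first by move: xO => /andP[lx _]; lra.
  have := tan _ _ bO xO; have /andP[d1 d2] := dC' _ bO.
  by clear -d1 bx; nra.
have [ry|ry] := leP r (y + M).
  have {ry yr} E : y + M = r by apply/eqP; rewrite eq_le yr.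
  have yO : l < y < r by apply/andP; split; lra.
  exists C, (Phi y - C * y); split => x xO.
    move=> /andP[yx _]; have := tan _ _ xO yO; have /andP[d1 d2] := dC' _ xO.
    by clear -d2 yx; nra.
  case=> [xy|bx]; last by move: xO => /andP[_ xr]; lra.
  have := tan _ _ yO xO; have /andP[d1 d2] := dC' _ yO.
  by clear -d2 xy; nra.
have yO : l < y < r by apply/andP; split; lra.
have bO : l < y + M < r by apply/andP; split; lra.
pose a := (Phi (y + M) - Phi y) / M.
have aM : a * M = Phi (y + M) - Phi y by rewrite /a mulfVK// gt_eqF.
exists a, (Phi y - a * y); split => x xO.
  move=> /andP[yx xb]; have := tan _ _ xO yO; have := tan _ _ xO bO.
  clear -aM yx xb M0; move: (dPhi x) (Phi x) (Phi y) (Phi (y + M)) aM => d p py pb aM t1 t2.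
  rewrite leNgt; apply/negP => H.
  have h1 : (d - a) * (y + M - x) < 0 by lra.
  have h2 : 0 < (d - a) * (x - y) by lra.
  have h3 : d - a < 0 by rewrite -(pmulr_llt0 _ (_ : 0 < y + M - x))//; lra.
  have h4 : 0 < d - a by rewrite -(pmulr_lgt0 _ (_ : 0 < x - y))//; lra.
  lra.
case=> [xy|bx].
  have := tan _ _ yO xO; have := tan _ _ yO bO.
  clear -aM xy M0; move: (dPhi y) (Phi x) (Phi y) (Phi (y + M)) aM => d p py pb aM t1 t2.
  have : (d - a) * M <= 0 by lra.
  rewrite pmulr_lle0// => da; nra.
have := tan _ _ bO xO; have := tan _ _ bO yO.
clear -aM bx M0; move: (dPhi (y + M)) (Phi x) (Phi y) (Phi (y + M)) aM => d p py pb aM t1 t2.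
have : 0 <= (d - a) * M by lra.
rewrite pmulr_lge0// => da; nra.
Qed.

Lemma Rintegral_split (l z r : R) f : l < z -> z < r ->
  leb.-integrable `]l, r[ (EFin \o f) ->
  \int[leb]_(x in `]l, r[) f x =
  \int[leb]_(x in `]l, z[) f x + \int[leb]_(x in `]z, r[) f x.
Proof.
move=> lz zr jf.
have jz : leb.-integrable `]l, z[ (EFin \o f).
  by apply: integrableS jf => //; apply: subset_itv; rewrite bnd_simp// ltW.
rewrite (Rintegral_itv_bndo_bndc jz).
rewrite -(@Rintegral_itvB R f (BRight l) (BLeft r) z jf) ?bnd_simp ?(ltW lz)//.
by rewrite addrC subrK.
Qed.

(** The mass to the left of z depends continuously on z, so the intermediate
   value theorem applies. *)
Lemma exists_cut (l r m : R) f : l < r -> leb.-integrable `]l, r[ (EFin \o f) ->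
  0 < m -> m < \int[leb]_(x in `]l, r[) f x ->
  exists2 z, l < z < r & \int[leb]_(x in `]l, z[) f x = m.
Proof.
move=> lr jf m0 mf.
pose F := (f \_ `]l, r[).
have jF : leb.-integrable setT (EFin \o F) by exact: integrable_restrictT.
have jFc : leb.-integrable `[l, r] (EFin \o F) by exact: integrableS jF.
have cF := parameterized_integral_continuous (ltW lr) jFc.
have FE z : l <= z -> z <= r ->
    parameterized_integral leb l z F = \int[leb]_(x in `]l, z[) f x.
  move=> lz zr; rewrite /parameterized_integral.
  have jz : leb.-integrable `[l, z] (EFin \o F) by exact: integrableS jF.
  rewrite -Rintegral_itv_obnd_cbnd; last first.
    by apply: integrableS jz => //; apply: subset_itv; rewrite bnd_simp.
  rewrite -Rintegral_itv_bndo_bndc; last first.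
    by apply: integrableS jz => //; apply: subset_itv; rewrite bnd_simp.
  apply: eq_Rintegral => x /set_mem/=; rewrite in_itv/= => /andP[lx xz].
  by rewrite /F patchE mem_set//= in_itv/= lx (lt_le_trans xz).
have F0 : parameterized_integral leb l l F = 0.
  by rewrite FE ?(ltW lr)// set_itv_ge ?bnd_simp ?ltxx// Rintegral_set0.
have Fr : parameterized_integral leb l r F = \int[leb]_(x in `]l, r[) f x.
  by rewrite FE// ltW.
have [|z] := IVT (v := m) (ltW lr) cF.
  by rewrite F0 Fr ge_min (ltW m0)/= le_max (ltW mf) orbT.
rewrite in_itv/= => /andP[lz zr] zm.
have lz' : l < z.
  by rewrite lt_neqAle lz andbT; apply: contraTneq m0 => E; rewrite -zm -E F0 ltxx.
have zr' : z < r.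
  by rewrite lt_neqAle zr andbT; apply: contraTneq mf => E; rewrite -zm E Fr ltxx.
by exists z; rewrite ?lz'// -FE.
Qed.

End competitors.

(** * Competitors for one step of the scheme *)

Section competitor.
Context {R : realType}.
Notation leb := (@lebesgue_measure R).
Implicit Types (f g h Phi dPhi : R -> R) (x y z : R).

(** The left end of the patch of length M whose first moment is X. *)
Definition patch_left (M X : R) : R := X / M - M / 2.

Lemma patch_leftE (M X : R) : 0 < M -> X = M * patch_left M X + M ^+ 2 / 2.
Proof. by move=> M0; rewrite /patch_left; field; rewrite gt_eqF. Qed.

(** If patches at y1 and y2 would overlap, moving them apart with fixed total
   first moment until they touch at z1 and z2 lowers the squared displacements
   from a1 and a2, which are at least as far apart as z1 and z2. *)
Lemma displacement_decrease (M1 M2 a1 a2 y1 y2 z1 z2 : R) : 0 < M1 -> 0 < M2 ->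
  a2 + M2 <= a1 -> y1 - y2 < M2 -> z1 - z2 = M2 ->
  M1 * y1 + M2 * y2 = M1 * z1 + M2 * z2 ->
  M1 * (z1 - a1) ^+ 2 + M2 * (z2 - a2) ^+ 2 <
  M1 * (y1 - a1) ^+ 2 + M2 * (y2 - a2) ^+ 2.
Proof.
move=> M10 M20 a21 y12 z12 E.
have E1 : M1 * (z1 - y1) = M2 * (y2 - z2) by lra.
have d0 : 0 < z1 - y1.
  rewrite ltNge; apply/negP => H.
  have h1 : y2 - z2 < z1 - y1 -> False.
    by move=> h2; have : M2 * (y2 - z2) <= 0; [rewrite -E1; nra|]; nra.
  have : 0 < (z1 - y1) + (y2 - z2) by lra.
  move=> h3; have : M2 * (y2 - z2) <= 0 by rewrite -E1; nra.
  by rewrite pmulr_rle0//; lra.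
have key : 0 < M1 * (z1 - y1) * ((y1 - a1) + (z1 - a1) - (y2 - a2) - (z2 - a2)) * -1.
  rewrite mulrN1 oppr_gt0 pmulr_rlt0 ?mulr_gt0//; lra.
have : M1 * (y1 - a1) ^+ 2 + M2 * (y2 - a2) ^+ 2 -
  (M1 * (z1 - a1) ^+ 2 + M2 * (z2 - a2) ^+ 2) =
  - (M1 * (z1 - y1)) * ((y1 - a1) + (z1 - a1))
  + (M2 * (y2 - z2)) * ((y2 - a2) + (z2 - a2)) by ring.
rewrite -E1 => E2.
rewrite -subr_gt0 E2.
by move: key; congr (0 < _); ring.
Qed.

Lemma patch_left_bounds (a b M : R) (D : set R) f : a < b -> 0 < M ->
  measurable (D : set (measurableTypeR R)) -> D `<=` `]a, b[ ->
  leb.-integrable D (EFin \o f) -> (\forall x \ae leb, D x -> 0 <= f x <= 1) ->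
  \int[leb]_(x in D) f x = M ->
  a <= patch_left M (\int[leb]_(x in D) (x * f x)) /\
  patch_left M (\int[leb]_(x in D) (x * f x)) + M <= b.
Proof.
move=> ab M0 mD Dab jf f01 fM.
move: (mean_bounds ab M0 mD Dab jf f01 fM).
have := patch_leftE (\int[leb]_(x in D) (x * f x)) M0.
move: (\int[leb]_(x in D) (x * f x)) => X.
move: (patch_left M X) => y E /andP[h1 h2]; split.
  by rewrite -(ler_pM2r M0); clear -h1 E; lra.
by rewrite -(ler_pM2r M0); clear -h2 E; lra.
Qed.

(** The bathtub principle for Phi minus the line of patch_line. The slope a is the
   Lagrange multiplier of the first moment, so the correction disappears for
   densities with the first moment of the patch. *)
Lemma patch_energy_le (l r C : R) Phi dPhi (y M : R) :
  (forall c x, l < c < r -> l < x < r -> Phi c + dPhi c * (x - c) <= Phi x) ->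
  (forall x, l < x < r -> `|dPhi x| <= C) -> bounded_meas l r Phi ->
  0 < M -> l <= y -> y + M <= r -> M < r - l ->
  exists a, forall (D : set R) f, measurable (D : set (measurableTypeR R)) ->
    D `<=` `]l, r[ -> leb.-integrable D (EFin \o f) ->
    (\forall x \ae leb, D x -> 0 <= f x <= 1) -> \int[leb]_(x in D) f x = M ->
    \int[leb]_(x in `]y, y + M[) Phi x +
      a * (\int[leb]_(x in D) (x * f x) - (M * y + M ^+ 2 / 2)) <=
    \int[leb]_(x in D) (Phi x * f x).
Proof.
move=> tan dC bPhi M0 ly yr Mlr.
have [a [b [below above]]] := patch_line tan dC M0 ly yr Mlr.
have IO : `]y, y + M[ `<=` `]l, r[ by apply: subset_itv; rewrite bnd_simp.
have mI : measurable (`]y, y + M[%classic : set (measurableTypeR R)).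
  exact: measurable_itv.
have I1 : leb.-integrable `]y, y + M[ (EFin \o (fun=> 1 : R)).
  apply: (@ae_bounded_integrable _ _ _ leb _ _ 1) => //.
  - by rewrite /= lebesgue_measure_itv/=; case: ifP => // _; rewrite -EFinB ltry.
  - by apply: aeW => x _; rewrite normr1.
exists a => D f mD DO jf f01 fM.
pose g x := 1 * Phi x + (-1) * (a * x + b).
have bg : bounded_meas l r g.
  by apply: bounded_meas_lin => //; exact: bounded_meas_affine.
have := bathtub mD DO IO jf f01 bg.
have gI x : `]l, r[%classic x -> y < x < y + M -> g x <= 0.
  by move=> /itvooP xO /(below x xO); rewrite /g; lra.
have gO x : D x -> x <= y \/ y + M <= x -> 0 <= g x.
  by move=> /DO/itvooP xO /(above x xO); rewrite /g; lra.
move=> /(_ gI gO).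
rewrite /g (Rintegral_lin mD DO)//; last exact: bounded_meas_affine.
rewrite (Rintegral_affine mD DO)// fM.
have -> : \int[leb]_(x in `]y, y + M[) (1 * Phi x + -1 * (a * x + b)) =
    \int[leb]_(x in `]y, y + M[) ((1 * Phi x + -1 * (a * x + b)) * 1).
  by apply: eq_Rintegral => x _; rewrite mulr1.
rewrite (Rintegral_lin mI IO)//; last exact: bounded_meas_affine.
under eq_Rintegral do rewrite mulr1.
have -> : \int[leb]_(x in `]y, y + M[) ((a * x + b) * 1) = a * (M * y + M ^+ 2 / 2) + b * M.
  by rewrite -Rintegral_patch_affine//; apply: eq_Rintegral => x _; rewrite mulr1.
clear; move: (\int[leb]_(x in D) (x * f x)) (\int[leb]_(x in D) (Phi x * f x)).
by move: (\int[leb]_(x in `]y, y + M[) Phi x) => u v w; lra.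
Qed.

Variables (l r C : R) (Phi1 Phi2 dPhi1 dPhi2 : R -> R).
Notation Omega := (`]l, r[%classic : set R).

Hypothesis tan1 : forall c x, l < c < r -> l < x < r ->
  Phi1 c + dPhi1 c * (x - c) <= Phi1 x.
Hypothesis tan2 : forall c x, l < c < r -> l < x < r ->
  Phi2 c + dPhi2 c * (x - c) <= Phi2 x.
Hypothesis dC1 : forall x, l < x < r -> `|dPhi1 x| <= C.
Hypothesis dC2 : forall x, l < x < r -> `|dPhi2 x| <= C.
Hypothesis bPhi1 : bounded_meas l r Phi1.
Hypothesis bPhi2 : bounded_meas l r Phi2.

Section step.
Variables (M1 M2 a1 a2 : R) (f1 f2 : R -> R).
Hypotheses (M10 : 0 < M1) (M20 : 0 < M2) (M12 : M1 + M2 < r - l).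
Hypothesis a21 : a2 + M2 <= a1.
Hypotheses (jf1 : leb.-integrable Omega (EFin \o f1))
  (jf2 : leb.-integrable Omega (EFin \o f2)).
Hypothesis f12 : \forall x \ae leb, Omega x ->
  [/\ 0 <= f1 x, 0 <= f2 x & f1 x + f2 x <= 1].
Hypotheses (mf1 : \int[leb]_(x in Omega) f1 x = M1)
  (mf2 : \int[leb]_(x in Omega) f2 x = M2).

Let lr : l < r. Proof. by have := M12; have := M10; have := M20; move=> *; lra. Qed.

Let mO : measurable (Omega : set (measurableTypeR R)).
Proof. exact: measurable_itv. Qed.

Let f1_01 : \forall x \ae leb, Omega x -> 0 <= f1 x <= 1.
Proof. by apply: aeS f12 => x H /H[h1 h2 h3]; apply/andP; split; lra. Qed.

Let f2_01 : \forall x \ae leb, Omega x -> 0 <= f2 x <= 1.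
Proof. by apply: aeS f12 => x H /H[h1 h2 h3]; apply/andP; split; lra. Qed.

Let y1 := patch_left M1 (\int[leb]_(x in Omega) (x * f1 x)).
Let y2 := patch_left M2 (\int[leb]_(x in Omega) (x * f2 x)).

Hypothesis dec12 : forall x y, l < x -> x <= y -> y < r ->
  Phi1 y - Phi2 y <= Phi1 x - Phi2 x.

Let F x := f1 x + f2 x.

(** The sum F is cut at z into a left part of mass M2 and a right part of mass M1.
   As many particles of the first kind leave ]l, z[ as enter from the second
   kind, and this exchange lowers the drift energy because Phi1 - Phi2 is
   nonincreasing. *)
Lemma sorting : exists z S1 S2 X1 X2,
  [/\ l < z < r,
      [/\ \int[leb]_(x in `]z, r[) F x = M1, \int[leb]_(x in `]l, z[) F x = M2,
          \int[leb]_(x in `]z, r[) (Phi1 x * F x) = S1 &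
          \int[leb]_(x in `]l, z[) (Phi2 x * F x) = S2],
      S1 + S2 <= \int[leb]_(x in Omega) (Phi1 x * f1 x) +
                 \int[leb]_(x in Omega) (Phi2 x * f2 x),
      \int[leb]_(x in `]z, r[) (x * F x) = X1 /\
      \int[leb]_(x in `]l, z[) (x * F x) = X2 &
      X1 + X2 = \int[leb]_(x in Omega) (x * f1 x) + \int[leb]_(x in Omega) (x * f2 x)].
Proof.
have jF : leb.-integrable Omega (EFin \o F) by exact: (integrableD mO jf1 jf2).
have mF : \int[leb]_(x in Omega) F x = M1 + M2 by rewrite RintegralD// mf1 mf2.
have [|z /andP[lz zr] zM] := @exists_cut R l r M2 F lr jF M20; first by rewrite mF ltrDr.
have D1O : `]z, r[ `<=` Omega by apply: subset_itv; rewrite bnd_simp// ltW.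
have D2O : `]l, z[ `<=` Omega by apply: subset_itv; rewrite bnd_simp// ltW.
have mD1 : measurable (`]z, r[%classic : set (measurableTypeR R)) by exact: measurable_itv.
have mD2 : measurable (`]l, z[%classic : set (measurableTypeR R)) by exact: measurable_itv.
have j1 f : leb.-integrable Omega (EFin \o f) -> leb.-integrable `]z, r[ (EFin \o f).
  by apply: integrableS.
have j2 f : leb.-integrable Omega (EFin \o f) -> leb.-integrable `]l, z[ (EFin \o f).
  by apply: integrableS.
have sp f := @Rintegral_split R l z r f lz zr.
have zM1 : \int[leb]_(x in `]z, r[) F x = M1.
  by have := sp F jF; rewrite mF zM addrC => /addrI.
have jm f g : leb.-integrable Omega (EFin \o f) -> bounded_meas l r g ->
    leb.-integrable Omega (EFin \o (fun x => g x * f x)).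
  exact: (@integrable_bounded_mul R l r Omega mO).
have addF (D : set R) (g : R -> R) : measurable (D : set (measurableTypeR R)) ->
    D `<=` Omega -> bounded_meas l r g ->
    \int[leb]_(x in D) (g x * F x) =
    \int[leb]_(x in D) (g x * f1 x) + \int[leb]_(x in D) (g x * f2 x).
  move=> mD DO bg; rewrite -RintegralD//.
  - by apply: eq_Rintegral => x _; rewrite /F mulrDr.
  - by apply: integrableS (jm f1 g jf1 bg).
  - by apply: integrableS (jm f2 g jf2 bg).
exists z, (\int[leb]_(x in `]z, r[) (Phi1 x * F x)), (\int[leb]_(x in `]l, z[) (Phi2 x * F x)).
exists (\int[leb]_(x in `]z, r[) (x * F x)), (\int[leb]_(x in `]l, z[) (x * F x)).
have zO : l < z < r by rewrite lz.
have bid := @bounded_meas_id R l r.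
split => //; last first.
  rewrite (addF _ id mD1 D1O bid) (addF _ id mD2 D2O bid).
  rewrite (sp _ (jm f1 id jf1 bid)) (sp _ (jm f2 id jf2 bid)).
  have aux (u1 u2 u3 u4 : R) : u1 + u2 + (u3 + u4) = u3 + u1 + (u4 + u2) by ring.
  exact: aux.
rewrite (addF _ Phi1 mD1 D1O bPhi1) (addF _ Phi2 mD2 D2O bPhi2).
rewrite (sp _ (jm f1 Phi1 jf1 bPhi1)) (sp _ (jm f2 Phi2 jf2 bPhi2)).
have bpsi : bounded_meas l r (fun x => 1 * Phi1 x + (-1) * Phi2 x).
  exact: bounded_meas_lin.
pose c := Phi1 z - Phi2 z.
have swap : \int[leb]_(x in `]l, z[) f1 x = \int[leb]_(x in `]z, r[) f2 x.
  have e1 : \int[leb]_(x in `]l, z[) F x =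
    \int[leb]_(x in `]l, z[) f1 x + \int[leb]_(x in `]l, z[) f2 x.
    by rewrite RintegralD//; [exact: j2|exact: j2].
  have := sp f2 jf2; rewrite mf2 -zM e1 [RHS]addrC; exact: addIr.
have le1 : c * \int[leb]_(x in `]l, z[) f1 x <=
    1 * \int[leb]_(x in `]l, z[) (Phi1 x * f1 x) +
    (-1) * \int[leb]_(x in `]l, z[) (Phi2 x * f1 x).
  rewrite -(Rintegral_lin mD2 D2O 1 (-1) (j2 _ jf1) bPhi1 bPhi2) -RintegralZl//; last exact: j2.
  rewrite Rintegral_mkcond [leRHS]Rintegral_mkcond; apply: ae_le_Rintegral.
  - apply: integrable_restrictT => //; exact: (integrableZl mD2 c (j2 _ jf1)).
  - apply: integrable_restrictT => //.
    by have := integrable_bounded_mul mD2 D2O (j2 _ jf1) bpsi.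
  apply: aeS f1_01 => x fx; rewrite !patchE; case: ifPn => // /set_mem Dx.
  have /andP[f0 _] := fx (D2O _ Dx); rewrite ler_wpM2r//.
  move: Dx => /itvooP/andP[lx xz].
  by have := dec12 lx (ltW xz) zr; rewrite /c mul1r mulN1r.
have le2 : 1 * \int[leb]_(x in `]z, r[) (Phi1 x * f2 x) +
    (-1) * \int[leb]_(x in `]z, r[) (Phi2 x * f2 x) <= c * \int[leb]_(x in `]z, r[) f2 x.
  rewrite -(Rintegral_lin mD1 D1O 1 (-1) (j1 _ jf2) bPhi1 bPhi2) -RintegralZl//; last exact: j1.
  rewrite Rintegral_mkcond [leRHS]Rintegral_mkcond; apply: ae_le_Rintegral.
  - apply: integrable_restrictT => //.
    by have := integrable_bounded_mul mD1 D1O (j1 _ jf2) bpsi.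
  - apply: integrable_restrictT => //; exact: (integrableZl mD1 c (j1 _ jf2)).
  apply: aeS f2_01 => x fx; rewrite !patchE; case: ifPn => // /set_mem Dx.
  have /andP[f0 _] := fx (D1O _ Dx); rewrite ler_wpM2r//.
  move: Dx => /itvooP/andP[zx xr].
  by have := dec12 lz (ltW zx) xr; rewrite /c mul1r mulN1r.
rewrite swap in le1.
have := le_trans le2 le1.
have aux (u1 u2 u3 u4 v1 v2 v3 v4 : R) : 1 * u1 + (-1) * u2 <= 1 * u3 + (-1) * u4 ->
   v1 + u1 + (u4 + v2) <= u3 + v1 + (v2 + u2) by lra.
exact: aux.
Qed.

(** The competitor for one step of the scheme. If the patches with the means of
   f1 and f2 do not overlap they do better by the bathtub principle, with equal
   means. Otherwise the pair (f1, f2) is interpolated with its sorted version: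
   the drift energy is affine along the interpolation and not larger at the
   sorted end, the means move apart, and at the time at which the patches with
   the interpolated means touch, displacement_decrease gives a strict gain. *)
Lemma better_patches : exists z1 z2,
  [/\ l <= z2, z2 + M2 <= z1, z1 + M1 <= r,
      \int[leb]_(x in `]z1, z1 + M1[) Phi1 x + \int[leb]_(x in `]z2, z2 + M2[) Phi2 x <=
      \int[leb]_(x in Omega) (Phi1 x * f1 x) + \int[leb]_(x in Omega) (Phi2 x * f2 x) &
      (z1 = y1 /\ z2 = y2) \/
      M1 * (z1 - a1) ^+ 2 + M2 * (z2 - a2) ^+ 2 <
      M1 * (y1 - a1) ^+ 2 + M2 * (y2 - a2) ^+ 2].
Proof.
have OO : Omega `<=` Omega by [].
have [ly1 y1r] := patch_left_bounds lr M10 mO OO jf1 f1_01 mf1.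
have [ly2 y2r] := patch_left_bounds lr M20 mO OO jf2 f2_01 mf2.
rewrite -/y1 in ly1 y1r; rewrite -/y2 in ly2 y2r.
have M1r : M1 < r - l by apply: le_lt_trans M12; rewrite lerDl ltW.
have M2r : M2 < r - l by apply: le_lt_trans M12; rewrite lerDr ltW.
have Y1 := patch_leftE (\int[leb]_(x in Omega) (x * f1 x)) M10.
have Y2 := patch_leftE (\int[leb]_(x in Omega) (x * f2 x)) M20.
rewrite -/y1 in Y1; rewrite -/y2 in Y2.
have [y21|y12] := leP (y2 + M2) y1.
  exists y1, y2; split => //; last by left.
  have [b1 /(_ Omega f1 mO OO jf1 f1_01 mf1)] := patch_energy_le tan1 dC1 bPhi1 M10 ly1 y1r M1r.
  have [b2 /(_ Omega f2 mO OO jf2 f2_01 mf2)] := patch_energy_le tan2 dC2 bPhi2 M20 ly2 y2r M2r.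
  rewrite Y1 Y2 !subrr !mulr0 !addr0 => e2 e1; exact: lerD.
have [z [S1 [S2 [X1 [X2 [/andP[lz zr] [m1 m2 S1E S2E] S12 [X1E X2E] X12]]]]]] := sorting.
have D1O : `]z, r[ `<=` Omega by apply: subset_itv; rewrite bnd_simp// ltW.
have D2O : `]l, z[ `<=` Omega by apply: subset_itv; rewrite bnd_simp// ltW.
have mD1 : measurable (`]z, r[%classic : set (measurableTypeR R)) by exact: measurable_itv.
have mD2 : measurable (`]l, z[%classic : set (measurableTypeR R)) by exact: measurable_itv.
have jF : leb.-integrable Omega (EFin \o F) by exact: (integrableD mO jf1 jf2).
have jF1 : leb.-integrable `]z, r[ (EFin \o F) by exact: integrableS jF.
have jF2 : leb.-integrable `]l, z[ (EFin \o F) by exact: integrableS jF.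
have F01 (D : set R) : D `<=` Omega -> \forall x \ae leb, D x -> 0 <= F x <= 1.
  move=> DO; apply: aeS f12 => x H /DO/H[h1 h2 h3].
  by rewrite /F h3 addr_ge0.
have [zs1 s1r] := patch_left_bounds zr M10 mD1 (@subset_refl _ _) jF1 (F01 _ D1O) m1.
have [ls2 s2z] := patch_left_bounds lz M20 mD2 (@subset_refl _ _) jF2 (F01 _ D2O) m2.
have Z1 := patch_leftE (\int[leb]_(x in `]z, r[) (x * F x)) M10.
have Z2 := patch_leftE (\int[leb]_(x in `]l, z[) (x * F x)) M20.
move: zs1 s1r ls2 s2z Z1 Z2; rewrite X1E X2E.
set s1 := patch_left M1 X1; set s2 := patch_left M2 X2 => zs1 s1r ls2 s2z Z1 Z2.
(* the interpolation parameter at which the two patches touch *)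
pose t := (M2 - (y1 - y2)) / ((s1 - s2) - (y1 - y2)).
have den : 0 < (s1 - s2) - (y1 - y2).
  by move: (s1) (s2) (y1) (y2) zs1 s2z y12 => ? ? ? ? *; lra.
have t0 : 0 <= t.
  by rewrite /t divr_ge0 ?(ltW den)//; move: (y1) (y2) y12 => ? ? *; lra.
have t1 : t <= 1.
  rewrite /t ler_pdivrMr// mul1r.
  by move: (s1) (s2) (y1) (y2) zs1 s2z y12 => ? ? ? ? *; lra.
have tE : t * ((s1 - s2) - (y1 - y2)) = M2 - (y1 - y2) by rewrite /t mulfVK// gt_eqF.
have t1' : 0 <= 1 - t by rewrite subr_ge0.
pose z1 := (1 - t) * y1 + t * s1; pose z2 := (1 - t) * y2 + t * s2.
have z12 : z1 - z2 = M2.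
  have -> : z1 - z2 = (y1 - y2) + t * ((s1 - s2) - (y1 - y2)) by rewrite /z1 /z2; ring.
  by rewrite tE; ring.
have conv (u v c : R) : c <= u -> c <= v -> c <= (1 - t) * u + t * v.
  move=> cu cv; have := lerD (ler_wpM2l t1' cu) (ler_wpM2l t0 cv).
  by apply: le_trans; rewrite -mulrDl subrK mul1r.
have conv' (u v c : R) : u <= c -> v <= c -> (1 - t) * u + t * v <= c.
  move=> cu cv; have := lerD (ler_wpM2l t1' cu) (ler_wpM2l t0 cv).
  by move/le_trans; apply; rewrite -mulrDl subrK mul1r.
have lz2 : l <= z2 by exact: conv.
have z1r : z1 + M1 <= r.
  by rewrite -lerBrDr; apply: conv'; rewrite lerBrDr.
have lz1 : l <= z1 by apply: conv => //; exact: le_trans (ltW lz) zs1.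
have z2r : z2 + M2 <= r.
  rewrite -lerBrDr; apply: conv'; rewrite lerBrDr//.
  exact: le_trans s2z (ltW zr).
exists z1, z2; split => //.
- by rewrite -lerBrDl z12.
- have [b1 e1] := patch_energy_le tan1 dC1 bPhi1 M10 lz1 z1r M1r.
  have [b2 e2] := patch_energy_le tan2 dC2 bPhi2 M20 lz2 z2r M2r.
  have := e1 Omega f1 mO OO jf1 f1_01 mf1.
  have := e1 _ F mD1 D1O jF1 (F01 _ D1O) m1.
  have := e2 Omega f2 mO OO jf2 f2_01 mf2.
  have := e2 _ F mD2 D2O jF2 (F01 _ D2O) m2.
  rewrite X1E X2E S1E S2E Y1 Y2 Z1 Z2.
  move: S12.
  move: (\int[leb]_(x in Omega) (Phi1 x * f1 x)) (\int[leb]_(x in Omega) (Phi2 x * f2 x)).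
  move: (\int[leb]_(x in `]z1, z1 + M1[) Phi1 x) (\int[leb]_(x in `]z2, z2 + M2[) Phi2 x).
  move=> P1 P2 A1 A2 S12 h1 h2 h3 h4.
  have cc (P A S b m y s w : R) : w = (1 - t) * y + t * s ->
      P + b * (m * y + m ^+ 2 / 2 - (m * w + m ^+ 2 / 2)) <= A ->
      P + b * (m * s + m ^+ 2 / 2 - (m * w + m ^+ 2 / 2)) <= S ->
      P <= (1 - t) * A + t * S.
    move=> wE hA hS; have := lerD (ler_wpM2l t1' hA) (ler_wpM2l t0 hS).
    by apply: le_trans; rewrite wE le_eqVlt; apply/orP; left; apply/eqP; ring.
  have c1 := cc _ _ _ _ _ _ _ _ (erefl z1) h4 h3.
  have c2 := cc _ _ _ _ _ _ _ _ (erefl z2) h2 h1.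
  apply: le_trans (lerD c1 c2) _; rewrite addrACA -!mulrDr.
  exact: conv'.
- right; apply: displacement_decrease => //.
    by move: (y1) (y2) y12 => ? ? *; lra.
  have XX : M1 * s1 + M2 * s2 = M1 * y1 + M2 * y2.
    move: X12; rewrite Y1 Y2 Z1 Z2.
    by move: (s1) (s2) (y1) (y2) => ? ? ? ? *; lra.
  rewrite /z1 /z2.
  transitivity ((1 - t) * (M1 * y1 + M2 * y2) + t * (M1 * s1 + M2 * s2)); last by ring.
  by rewrite XX; ring.
Qed.

End step.

End competitor.

(** * Squared ramps and transport costs *)

Section ramp_primitives.
Context {R : realType}.
Notation leb := (@lebesgue_measure R).
Implicit Types (s x y M a b : R).

Definition rampsq s x : R := ramp s x ^+ 2 / 2.

Lemma is_derive_rampsq s x : is_derive x 1 (rampsq s) (ramp s x).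
Proof.
have sq (c t : R) : is_derive t 1 (fun u : R => (u - c) ^+ 2 / 2) (t - c).
  have d1 : is_derive t 1 (fun u : R => u - c) 1.
    have := is_derive_affine 1 (- c) t; rewrite (_ : (fun y => _) = (fun u => u - c))//.
    by apply/funext => u; rewrite mul1r.
  have d2 : is_derive t 1 (fun u : R => (u - c) ^+ 2) (2 * (t - c)).
    have := @is_deriveX R R (fun u => u - c) 2 t 1 1 d1.
    by rewrite exprfctE /GRing.scale/= expr1 mulr1.
  have := is_derive_affine 2^-1 0 ((t - c) ^+ 2) => d3.
  have := @is_derive1_comp R (fun u => 2^-1 * u + 0) (fun u => (u - c) ^+ 2) t _ _ d3 d2.
  rewrite mulrA mulVf// mul1r; congr (is_derive _ _ _ _).
  by apply/funext => u /=; rewrite addr0 mulrC.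
have [xs|sx|->] := ltgtP x s.
- rewrite rampE leNgt xs/=.
  apply: (@is_derive_near_cst _ _ _ 0); near=> y.
  rewrite /rampsq rampE leNgt ifF ?expr0n ?mul0r//.
  by apply/negbTE; rewrite negbK; near: y; exact: lt_nbhsl.
- rewrite rampE (ltW sx).
  apply: near_eq_is_derive (sq s x); near=> y.
  by rewrite /rampsq rampE ifT//; apply: ltW; near: y; exact: lt_nbhsr.
- rewrite rampE lexx subrr.
  apply: (@is_derive0_quad _ _ _ 2^-1) => h.
  rewrite /rampsq (_ : ramp s s = 0) ?expr0n ?mul0r ?subr0; last by rewrite rampE lexx subrr.
  rewrite ger0_norm ?divr_ge0 ?sqr_ge0// mulrC ler_pM2l ?invr_gt0//.
  rewrite -[leRHS]real_normK ?num_real// ler_sqr ?nnegrE ?ramp_ge0//.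
  have := ler_ramp_lip s (s + h) s.
  have -> : s + h - s = h by ring.
  have -> : ramp s s = 0 by rewrite rampE lexx subrr.
  by rewrite subr0 (ger0_norm (ramp_ge0 _ _)).
Unshelve. all: by end_near. Qed.

Lemma Rintegral_FTC2_oo (f F : R -> R) a b : a < b -> continuous f ->
  (forall x, is_derive x 1 F (f x)) ->
  \int[leb]_(x in `]a, b[) f x = F b - F a.
Proof.
move=> ab cf dF.
have jc : leb.-integrable `[a, b] (EFin \o f).
  by apply: continuous_compact_integrable; [exact: segment_compact
    |exact: continuous_subspaceT].
rewrite -(Rintegral_FTC2 ab cf dF).
rewrite -Rintegral_itv_obnd_cbnd; last first.
  by apply: integrableS jc => //; apply: subset_itv; rewrite bnd_simp.
rewrite Rintegral_itv_bndo_bndc//.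
by apply: integrableS jc => //; apply: subset_itv; rewrite bnd_simp.
Qed.

Lemma Rintegral_patch_ramp s y M : 0 < M ->
  \int[leb]_(x in `]y, y + M[) ramp s x = rampsq s (y + M) - rampsq s y.
Proof.
move=> M0; have yM : y < y + M by rewrite ltrDl.
exact: (Rintegral_FTC2_oo yM (@continuous_ramp _ s) (is_derive_rampsq s)).
Qed.

Lemma ramp_shift s x h : ramp s (x + h) = ramp (s - h) x.
Proof. by rewrite /ramp opprB addrA. Qed.

Lemma rampsq_shift s x h : rampsq s (x + h) = rampsq (s - h) x.
Proof. by rewrite /rampsq ramp_shift. Qed.

(** The derivative of the integral in the position y is the increment of the ramp
   across the patch, which is at most M. *)
Lemma patch_ramp_lip s y y' M : 0 < M ->
  `|\int[leb]_(x in `]y, y + M[) ramp s x - \int[leb]_(x in `]y', y' + M[) ramp s x| <=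
  M * `|y - y'|.
Proof.
move=> M0; rewrite !Rintegral_patch_ramp//.
wlog yy' : y y' / y' < y.
  move=> H; have [/H//|/H|->] := ltgtP y' y; last by rewrite !subrr normr0 mulr0.
  by rewrite distrC (distrC y).
pose G x := rampsq (s - M) x - rampsq s x.
have dG x : is_derive x 1 G (ramp (s - M) x - ramp s x).
  by apply: is_deriveB; exact: is_derive_rampsq.
have cG : {within `[y', y], continuous G}.
  apply: continuous_subspaceT => x; apply: differentiable_continuous.
  by apply/derivable1_diffP; have [] := dG x.
have [c _ E] := MVT yy' (fun x _ => dG x) cG.
rewrite !rampsq_shift -/(G y) -/(G y') E normrM ler_wpM2r//.
by rewrite (le_trans (ler_ramp_shift _ _ _))// (_ : s - M - s = - M) ?normrN ?gtr0_norm//; ring.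
Qed.

End ramp_primitives.

Section wasserstein.
Context {R : realType}.
Implicit Types (mu nu : {measure set R -> \bar R}).

Definition transport_cost mu nu : \bar R :=
  ereal_inf [set (\int[pi]_z ((z.1 - z.2) ^+ 2)%:E)%E | pi in coupling mu nu].

Lemma transport_cost_ge0 mu nu : (0 <= transport_cost mu nu)%E.
Proof.
apply/ereal_infP => _ [pi _ <-]; apply: integral_ge0 => z _.
by rewrite lee_fin sqr_ge0.
Qed.

Lemma W2_sqr mu nu : (W2 mu nu ^+ 2 = transport_cost mu nu)%E.
Proof.
have c0 := transport_cost_ge0 mu nu.
rewrite /W2 -/(transport_cost mu nu) poweR12_sqrt//.
exact: sqr_sqrte.
Qed.

Lemma W2_lt_coupling mu nu (e : R) : 0 < e -> (W2 mu nu < e%:E)%E ->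
  exists2 pi : {measure set (R * R) -> \bar R}, coupling mu nu pi &
    (\int[pi]_z ((z.1 - z.2) ^+ 2)%:E < (e ^+ 2)%:E)%E.
Proof.
move=> e0 We.
have c0 := transport_cost_ge0 mu nu.
have : (transport_cost mu nu < (e ^+ 2)%:E)%E.
  rewrite -W2_sqr; have W0 : (0 <= W2 mu nu)%E by exact: poweR_ge0.
  move: W0 We; case: (W2 mu nu) => [w|//|//].
  rewrite lee_fin lte_fin => w0 we; rewrite -EFin_expe lte_fin.
  by rewrite ltr_pXn2r// nnegrE// ltW.
by move=> /ereal_inf_lt[_ [pi cpi <-] H]; exists pi.
Qed.

End wasserstein.

(** * Couplings on an interval *)

Section couplings.
Context {R : realType}.
Notation leb := (@lebesgue_measure R).
Implicit Types (mu nu : {measure set R -> \bar R}) (s h x : R).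

Section estimates.
Variables (l r M : R) (mu nu : {measure set R -> \bar R})
  (pi : {measure set (R * R) -> \bar R}).
Notation Omega := (`]l, r[%classic : set R).
Hypotheses (PMmu : in_PM Omega M mu) (PMnu : in_PM Omega M nu)
  (cpi : coupling mu nu pi).

Let mO : measurable Omega. Proof. exact: measurable_itv. Qed.

(** Bounded and equal to the identity on Omega, which carries both measures:
   with it all integrands are bounded on the whole plane. *)
Let clip : R -> R := id \_ Omega.

Let mclip : measurable_fun setT clip.
Proof. by apply/(measurable_restrictT id mO); exact: measurable_id. Qed.

Let clipE x : Omega x -> clip x = x.
Proof. by move=> Ox; rewrite /clip patchE mem_set. Qed.

Let B := `|l| + `|r|.

Let B0 : 0 <= B. Proof. by rewrite /B addr_ge0. Qed.

Let clipB x : `|clip x| <= B.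
Proof.
rewrite /clip patchE; case: ifPn => [/set_mem|_]; last by rewrite normr0.
rewrite /= in_itv/= => /andP[lx xr]; rewrite /B.
have := ler_norm r; have := lerNnormlW (lexx `|l|).
have := normr_ge0 r; have := normr_ge0 l => ? ? ? ?.
by rewrite ler_norml; apply/andP; split; lra.
Qed.

Let piT : pi setT = M%:E.
Proof.
have [+ _] := cpi measurableT; rewrite setXTT => ->.
by case: PMmu.
Qed.

Lemma bounded_integrable_pi (f : R * R -> R) (b : R) : measurable_fun setT f ->
  (forall z, `|f z| <= b) -> pi.-integrable setT (EFin \o f).
Proof.
move=> mf fb; apply: (@ae_bounded_integrable _ _ _ pi setT _ b) => //.
  by rewrite piT ltry.
by apply: aeW => z _.
Qed.

Let mfst : measurable_fun setT (fst : R * R -> R). Proof. exact: measurable_fst. Qed.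
Let msnd : measurable_fun setT (snd : R * R -> R). Proof. exact: measurable_snd. Qed.

Lemma Rintegral_fst (f : R -> R) (b : R) : measurable_fun setT f ->
  (forall x, `|f x| <= b) -> \int[pi]_z f z.1 = \int[mu]_x f x.
Proof.
move=> mf fb; rewrite /Rintegral; congr fine.
have jf : pi.-integrable (fst @^-1` setT) ((EFin \o f) \o fst).
  rewrite preimage_setT; apply: (@bounded_integrable_pi (f \o fst) b) => [|z]; [exact: measurableT_comp|exact: fb].
have meF : measurable_fun setT (EFin \o f) by exact/measurable_EFinP.
have := integral_pushforward mfst meF jf measurableT.
rewrite preimage_setT => <-; apply: eq_measure_integral => A mA _.
rewrite /pushforward /=; have [<- _] := cpi mA; congr (pi _).
by apply/seteqP; split => [[x y] /=|[x y] /= []].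
Qed.

Lemma Rintegral_snd (f : R -> R) (b : R) : measurable_fun setT f ->
  (forall x, `|f x| <= b) -> \int[pi]_z f z.2 = \int[nu]_x f x.
Proof.
move=> mf fb; rewrite /Rintegral; congr fine.
have jf : pi.-integrable (snd @^-1` setT) ((EFin \o f) \o snd).
  rewrite preimage_setT; apply: (@bounded_integrable_pi (f \o snd) b) => [|z]; [exact: measurableT_comp|exact: fb].
have meF : measurable_fun setT (EFin \o f) by exact/measurable_EFinP.
have := integral_pushforward msnd meF jf measurableT.
rewrite preimage_setT => <-; apply: eq_measure_integral => A mA _.
rewrite /pushforward /=; have [_ <-] := cpi mA; congr (pi _).
by apply/seteqP; split => [[x y] /=|[x y] /= []].
Qed.

Lemma Rintegral_clip (m : {measure set R -> \bar R}) (g : R -> R) :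
  in_PM Omega M m -> measurable_fun setT g ->
  \int[m]_x g (clip x) = \int[m]_(x in Omega) g x.
Proof.
move=> [mC _] mg; rewrite [RHS]Rintegral_mkcond /Rintegral; congr fine.
apply: ae_eq_integral => //.
- by apply/measurable_EFinP; exact: measurableT_comp.
- apply/measurable_EFinP; apply/(measurable_restrictT g mO).
  exact: measurable_funTS.
exists (~` Omega); split => //; first exact: measurableC.
move=> x /= H Ox; apply: H => _; rewrite patchE mem_set//.
by rewrite clipE.
Qed.

Let ae_Omega : \forall z \ae pi, Omega z.1 /\ Omega z.2.
Proof.
have mOC : measurable (~` Omega) by exact: measurableC.
apply: aeI.
  exists (~` Omega `*` setT); split.
  - exact: measurableX.
  - by have [-> _] := cpi mOC; case: PMmu.
  - by move=> z /= nO; split.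
exists (setT `*` ~` Omega); split.
- exact: measurableX.
- by have [_ ->] := cpi mOC; case: PMnu.
- by move=> z /= nO; split.
Qed.

Let d (h : R) (z : R * R) : R := clip z.1 - clip z.2 - h.

Let md h : measurable_fun setT (d h).
Proof.
apply: measurable_funB => //; apply: measurable_funB; exact: measurableT_comp.
Qed.

Let dB h z : `|d h z| <= B + B + `|h|.
Proof.
rewrite (le_trans (ler_normB _ _))// lerD2r (le_trans (ler_normB _ _))//.
by rewrite lerD.
Qed.

Let md2 h : measurable_fun setT (fun z => d h z ^+ 2).
Proof. by apply: measurable_funX. Qed.

Let d2B h z : `|d h z ^+ 2| <= (B + B + `|h|) ^+ 2.
Proof.
by rewrite normrX ler_pXn2r// nnegrE// addr_ge0// addr_ge0.
Qed.

Let jd2 h : pi.-integrable setT (EFin \o (fun z => d h z ^+ 2)).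
Proof. exact: bounded_integrable_pi (md2 h) (d2B h). Qed.

(** K h is the quadratic cost of the coupling after nu has been translated by h.
   Expanding the square gives the dependence on h; for h the displacement of the
   means it separates the cost of the translation from the rest. The last
   estimate is Young's inequality |d| <= k / 2 + d^2 / (2 k) for the 1-Lipschitz
   ramp. *)
Lemma coupling_estimates : exists K : R -> R,
  [/\ forall h, 0 <= K h,
      (\int[pi]_z ((z.1 - z.2) ^+ 2)%:E = (K 0)%:E)%E,
      forall h, K 0 = 2 * h * (\int[mu]_(x in Omega) x - \int[nu]_(x in Omega) x)
        - h ^+ 2 * M + K h &
      forall h s k, 0 < k ->
        `|\int[mu]_(x in Omega) ramp s x - \int[nu]_(x in Omega) ramp (s - h) x|
        <= k * M / 2 + K h / (2 * k)].
Proof.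
have M0 : 0 <= M by rewrite -lee_fin -piT measure_ge0.
exists (fun h => \int[pi]_z (d h z ^+ 2)); split.
- by move=> h; apply: Rintegral_ge0 => z _; exact: sqr_ge0.
- rewrite /Rintegral fineK; last exact: (integrable_fin_num measurableT (jd2 0)).
  apply: ae_eq_integral => //.
  + apply/measurable_EFinP; apply: measurable_funX.
    exact: measurable_funB.
  + exact/measurable_EFinP.
  + by apply: aeS ae_Omega => z [h1 h2] _; rewrite /d !clipE// subr0.
- move=> h.
  have jc1 : pi.-integrable setT (EFin \o (fun z => clip z.1)).
    by apply: (@bounded_integrable_pi _ B) => //; exact: measurableT_comp.
  have jc2 : pi.-integrable setT (EFin \o (fun z => clip z.2)).
    by apply: (@bounded_integrable_pi _ B) => //; exact: measurableT_comp.
  have jc : pi.-integrable setT (EFin \o (fun=> h ^+ 2)).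
    by apply: (@bounded_integrable_pi _ `|h ^+ 2|).
  have jB := integrableB measurableT jc1 jc2.
  have jZ := integrableZl measurableT (2 * h) jB.
  have jZc := integrableB measurableT jZ jc.
  rewrite (_ : (fun z => d 0 z ^+ 2) = (fun z => (2 * h * (clip z.1 - clip z.2) - h ^+ 2) +
      d h z ^+ 2)); last by apply/funext => z; rewrite /d; ring.
  rewrite RintegralD// RintegralB// RintegralZl// RintegralB//.
  rewrite (Rintegral_fst mclip clipB) (Rintegral_snd mclip clipB).
  rewrite (Rintegral_clip PMmu (@measurable_id _ _ setT)).
  rewrite (Rintegral_clip PMnu (@measurable_id _ _ setT)).
  by rewrite Rintegral_cst// piT.
- move=> h s k k0.
  have mr t : measurable_fun setT (fun x => ramp t (clip x)).
    exact: measurableT_comp (measurable_ramp t) mclip.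
  have rB t x : `|ramp t (clip x)| <= B + `|t|.
    rewrite rampE; case: (leP t (clip x)) => _; last by rewrite normr0 addr_ge0.
    by rewrite (le_trans (ler_normB _ _))// lerD2r.
  have mrT (t : R) : measurable_fun setT (ramp t) by exact: measurable_ramp.
  rewrite -(Rintegral_clip PMmu (mrT s)) -(Rintegral_clip PMnu (mrT (s - h))).
  rewrite -(Rintegral_fst (mr s) (rB s)) -(Rintegral_snd (mr (s - h)) (rB (s - h))).
  have j1 : pi.-integrable setT (EFin \o (fun z => ramp s (clip z.1))).
    apply: (@bounded_integrable_pi _ (B + `|s|)) => [|z]; last exact: rB.
    exact: measurableT_comp (mr s) mfst.
  have j2 : pi.-integrable setT (EFin \o (fun z => ramp (s - h) (clip z.2))).
    apply: (@bounded_integrable_pi _ (B + `|s - h|)) => [|z]; last exact: rB.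
    exact: measurableT_comp (mr (s - h)) msnd.
  have jB := integrableB measurableT j1 j2.
  rewrite -RintegralB// (le_trans (le_normr_Rintegral measurableT jB))//.
  have jk : pi.-integrable setT (EFin \o (fun=> k / 2)).
    by apply: (@bounded_integrable_pi _ `|k / 2|).
  have jdk := integrableZl measurableT (2 * k)^-1 (jd2 h).
  have jR := integrableD measurableT jk jdk.
  have -> : k * M / 2 + (\int[pi]_z (d h z ^+ 2)) / (2 * k) =
      \int[pi]_z (k / 2 + (2 * k)^-1 * d h z ^+ 2).
    have Ec : \int[pi]_z (k / 2) = k / 2 * M by rewrite Rintegral_cst// piT.
    rewrite RintegralD// Ec RintegralZl//.
    by rewrite [X in _ + X]mulrC mulrAC.
  apply: le_Rintegral => //; first exact: integrable_norm jB.
  move=> z _; rewrite -ramp_shift (le_trans (ler_ramp_lip _ _ _))//.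
  have -> : clip z.1 - (clip z.2 + h) = d h z by rewrite /d; ring.
  have : 0 <= (`|d h z| - k) ^+ 2 by exact: sqr_ge0.
  rewrite -(real_normK (num_real (d h z))); move: (`|d h z|) => t t0.
  rewrite -(ler_pM2l (_ : 0 < 2 * k)) ?mulr_gt0//.
  have -> : 2 * k * (k / 2 + (2 * k)^-1 * t ^+ 2) = k ^+ 2 + t ^+ 2.
    by field; rewrite gt_eqF.
  by rewrite -subr_ge0; move: t0; congr (0 <= _); ring.
Qed.

End estimates.

End couplings.

(** * Patches as measures *)

Section patch_measures.
Context {R : realType}.
Notation leb := (@lebesgue_measure R).
Implicit Types (mu nu : {measure set R -> \bar R}) (y a M h : R).

(* Names the measure structure of a pushforward by the proof mf that the map is
   measurable. *)
Local Notation pushm m mf :=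
  (measure_function_pushforward__canonical__measure_function_Measure m mf).

Lemma lebesgue_measure_shift (A : set R) h : measurable A ->
  leb ((fun x => x + h) @^-1` A) = leb A.
Proof.
move=> mA; pose sh (x : measurableTypeR R) : measurableTypeR R := x + h.
have msh : measurable_fun setT sh by exact: measurable_funD.
apply/esym; apply: (@lebesgue_measure_unique R (pushm leb msh)) => // X.
move=> /ocitvP[->|[[b c] /= bc ->]].
  by rewrite !measure0.
rewrite /pushforward (_ : sh @^-1` _ = `]b - h, c - h]%classic); last first.
  by apply/seteqP; split => x /=; rewrite !in_itv/= ltrBlDr lerBrDr.
rewrite /= !lebesgue_measure_itv/= !lte_fin ltrD2r; case: ifP => // _.
by rewrite -!EFinD; congr (_%:E); ring.
Qed.

Definition is_patchm mu y M := forall A, measurable A ->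
  mu A = leb (A `&` `]y, y + M[).

Lemma exists_patchm y M : exists mu, is_patchm mu y M.
Proof.
have mI : measurable (`]y, y + M[%classic : set (measurableTypeR R)).
  exact: measurable_itv.
have mid : measurable_fun [set: measurableTypeR R] (id : measurableTypeR R -> R).
  by move=> _ Y mY; rewrite setTI; exact: mY.
by exists (pushm (mrestr leb mI) mid) => A mA.
Qed.

Lemma lebesgue_measure_patch y M : 0 < M -> leb `]y, y + M[ = M%:E.
Proof.
move=> M0; rewrite /= lebesgue_measure_itv/= lte_fin ltrDl M0 -EFinD.
by congr (_%:E); ring.
Qed.

Lemma is_patchm_PM (Omega : set R) mu y M : measurable Omega ->
  0 < M -> `]y, y + M[ `<=` Omega -> is_patchm mu y M -> in_PM Omega M mu.
Proof.
move=> mO M0 IO pmu; split.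
  rewrite pmu; last exact: measurableC.
  rewrite (_ : _ `&` _ = set0) ?measure0//; apply/seteqP; split => // x [nO /IO].
  exact: nO.
by rewrite pmu// setTI lebesgue_measure_patch.
Qed.

Lemma is_patchm_density (Omega : set R) mu y M : measurable Omega ->
  `]y, y + M[ `<=` Omega -> is_patchm mu y M ->
  has_density Omega mu (\1_(`]y, y + M[%classic)).
Proof.
move=> mO IO pmu; split; first exact: measurable_indic.
move=> A mA; rewrite pmu// integral_indic//; last exact: measurableI.
congr (leb _); apply/seteqP; split => [x [Ax Ix]|x [Ix [Ax _]]] //.
by split => //; split => //; exact: IO.
Qed.

(** The translation is a coupling of two patches of the same length. *)
Lemma transport_cost_patch mu nu y a M : 0 < M ->
  is_patchm mu y M -> is_patchm nu a M ->
  (transport_cost mu nu <= (M * (y - a) ^+ 2)%:E)%E.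
Proof.
move=> M0 pmu pnu; pose g (x : R) : R * R := (x, x + (a - y)).
have mg : measurable_fun setT g.
  by apply: measurable_fun_pair => //; exact: measurable_funD.
apply: ge_ereal_inf.
exists (\int[pushm mu mg]_z ((z.1 - z.2) ^+ 2)%:E)%E.
  exists (pushm mu mg) => //= A mA; split.
    by rewrite /pushforward; congr (mu _); apply/seteqP; split => [x []|].
  transitivity (mu ((fun x => x + (a - y)) @^-1` A)).
    by rewrite /pushforward; congr (mu _); apply/seteqP; split => [x []|].
  have mA' : measurable ((fun x : R => x + (a - y)) @^-1` A).
    rewrite -[X in measurable X]setTI.
    have msh : measurable_fun setT (fun x : R => x + (a - y)) by exact: measurable_funD.
    exact: msh.
  rewrite pmu// pnu// -(@lebesgue_measure_shift (A `&` `]a, a + M[) (a - y)); last first.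
    by apply: measurableI.
  congr (leb _); rewrite preimage_setI; congr (_ `&` _).
  by apply/seteqP; split => x /=; rewrite !in_itv/= => /andP[h1 h2]; apply/andP; split; lra.
have mc : measurable_fun setT (fun z : R * R => ((z.1 - z.2) ^+ 2)%:E).
  apply/measurable_EFinP; apply: measurable_funX; apply: measurable_funB.
    exact: measurable_fst.
  exact: measurable_snd.
have c0 : {in setT, forall z : R * R, (0 <= ((z.1 - z.2) ^+ 2)%:E)%E}.
  by move=> z _; rewrite lee_fin sqr_ge0.
rewrite (ge0_integral_pushforward mg _ measurableT mc c0) preimage_setT /=.
rewrite (_ : (\int[mu]_x _ = \int[mu]_x ((y - a) ^+ 2)%:E)%E); last first.
  by apply: eq_integral => x _; congr (_%:E); ring.
rewrite integral_cst// pmu// setTI lebesgue_measure_patch// -EFinM.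
by rewrite mulrC.
Qed.

Section patch_of_ramps.
Variables (l r M : R) (mu : {measure set R -> \bar R}) (f : R -> R).
Notation Omega := (`]l, r[%classic : set R).
Hypotheses (M0 : 0 < M) (PMmu : in_PM Omega M mu) (df : has_density Omega mu f).

Let mO : measurable (Omega : set (measurableTypeR R)).
Proof. exact: measurable_itv. Qed.

Lemma density_mass : \int[leb]_(x in Omega) f x = M.
Proof.
have [_ /(_ Omega)] := df; rewrite setIid => /(_ mO) E.
by rewrite /Rintegral -E (in_PM_Omega mO PMmu).
Qed.

Lemma density_Rintegral g : bounded_meas l r g ->
  leb.-integrable Omega (EFin \o (fun x => g x * f x)) /\
  \int[mu]_(x in Omega) g x = \int[leb]_(x in Omega) (g x * f x).
Proof.
move=> [mg gC]; have [_ _ H] := has_density_props mO PMmu df.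
exact: (H Omega g mO (@subset_refl _ _) (in_PM_integrable mO PMmu mg gC)).
Qed.

Lemma bounded_meas_ramp s : bounded_meas l r (ramp s).
Proof.
split; first exact: measurable_funS (measurable_ramp s).
exists (`|l| + `|r| + `|s|) => x xO; apply: ramp_itv_bound.
by move: xO; rewrite /= !in_itv/= => /andP[lx xr]; rewrite !ltW.
Qed.

Let y := patch_left M (\int[leb]_(x in Omega) (x * f x)).

(** On Omega the ramp starting at l is x - l, so the first moments are close. *)
Lemma ramps_close_left e y' : l <= y' ->
  (forall s, `|\int[mu]_(x in Omega) ramp s x -
               \int[leb]_(x in `]y', y' + M[) ramp s x| <= e) ->
  M * `|y - y'| <= e.
Proof.
move=> ly' /(_ l); rewrite (density_Rintegral (bounded_meas_ramp l)).2.
have -> : \int[leb]_(x in Omega) (ramp l x * f x) =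
    \int[leb]_(x in Omega) ((1 * x + - l) * f x).
  apply: eq_Rintegral => x /set_mem /=; rewrite in_itv/= => /andP[lx _].
  by rewrite rampE (ltW lx) mul1r.
have [jf _ _] := has_density_props mO PMmu df.
rewrite (Rintegral_affine mO (@subset_refl _ _) 1 (- l) jf) density_mass.
have -> : \int[leb]_(x in `]y', y' + M[) ramp l x = \int[leb]_(x in `]y', y' + M[) (1 * x + - l).
  apply: eq_Rintegral => x /set_mem /=; rewrite in_itv/= => /andP[lx _].
  by rewrite rampE (ltW (le_lt_trans ly' lx)) mul1r.
rewrite Rintegral_patch_affine// (patch_leftE (\int[leb]_(x in Omega) (x * f x)) M0) -/y.
have -> : 1 * (M * y + M ^+ 2 / 2) + - l * M - (1 * (M * y' + M ^+ 2 / 2) + - l * M) =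
  M * (y - y') by ring.
by rewrite normrM (gtr0_norm M0).
Qed.

(** The positions of the approximating patches converge to y, hence mu has the
   ramp integrals of the patch at y, and ramps determine a density. *)
Lemma patch_of_ramps : l < r ->
  (forall e, 0 < e -> exists y', [/\ l <= y', y' + M <= r &
     forall s, `|\int[mu]_(x in Omega) ramp s x -
                 \int[leb]_(x in `]y', y' + M[) ramp s x| <= e]) ->
  [/\ l <= y, y + M <= r,
      \forall x \ae leb, Omega x -> f x = \1_(`]y, y + M[) x &
      is_patchm mu y M].
Proof.
move=> lr close.
have near_y e : 0 < e -> exists y', [/\ l <= y', y' + M <= r, `|y - y'| <= e &
    forall s, `|\int[mu]_(x in Omega) ramp s x -
                \int[leb]_(x in `]y', y' + M[) ramp s x| <= M * e].
  move=> e0; have [y' [h1 h2 h3]] := close (M * e) (mulr_gt0 M0 e0).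
  exists y'; split => //; rewrite -(ler_pM2l M0); exact: ramps_close_left.
have ly : l <= y.
  apply/ler_addgt0Pr => e /near_y[y' [h1 h2]].
  rewrite ler_norml => /andP[h3 h4] _.
  by move: (y) h3 h4 => t h3 h4; lra.
have yr : y + M <= r.
  apply/ler_addgt0Pr => e /near_y[y' [h1 h2]].
  rewrite ler_norml => /andP[h3 h4] _.
  by move: (y) h3 h4 => t h3 h4; lra.
have E s : \int[mu]_(x in Omega) ramp s x = \int[leb]_(x in `]y, y + M[) ramp s x.
  apply/eqP; rewrite -subr_eq0 -normr_le0; apply/ler_addgt0Pr => e e0; rewrite add0r.
  have e'0 : 0 < e / (2 * M) by rewrite divr_gt0// mulr_gt0.
  have [y' [h1 h2 h3 h4]] := near_y _ e'0.
  have -> : e = M * (e / (2 * M)) + M * (e / (2 * M)) by field; rewrite gt_eqF.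
  rewrite -(subrKA (\int[leb]_(x in `]y', y' + M[) ramp s x)).
  rewrite (le_trans (ler_normD _ _))// lerD//.
  rewrite (le_trans (patch_ramp_lip _ _ _ M0))// ler_wpM2l ?(ltW M0)//.
  by rewrite distrC.
have [jf f0 _] := has_density_props mO PMmu df.
have IO : `]y, y + M[ `<=` Omega by apply: subset_itv; rewrite bnd_simp.
have mI : measurable (`]y, y + M[%classic : set (measurableTypeR R)).
  exact: measurable_itv.
pose ind : R -> R := \1_(`]y, y + M[).
have jind : leb.-integrable setT (EFin \o ind) by exact: integrable_indic_itv.
have jfO : leb.-integrable setT (EFin \o (f \_ Omega)) by exact: integrable_restrictT.
pose w x := (f \_ Omega) x - ind x.
have jw : leb.-integrable setT (EFin \o w) by exact: (integrableB measurableT jfO jind).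
have w0 x : ~ `[l, r]%classic x -> w x = 0.
  move=> nx; have nO : x \notin Omega.
    by apply/negP => /set_mem xO; apply: nx; apply: subset_itv_oo_cc xO.
  rewrite /w patchE (negbTE nO) /ind indicE memNset ?subrr//.
  by move=> /IO xO; move: nO; rewrite mem_set.
have fI : \forall x \ae leb, Omega x -> f x = ind x.
  suff : \forall x \ae leb, w x = 0.
    apply: aeS => x + Ox; rewrite /w patchE mem_set// => /eqP.
    by rewrite subr_eq0 => /eqP.
  apply: (ae_eq0_of_ramps jw w0) => q; set s := ratr q.
  have j1 : leb.-integrable setT (EFin \o (fun x => (f \_ Omega) x * ramp s x)).
    have := (density_Rintegral (bounded_meas_ramp s)).1.
    move=> /(integrable_restrictT mO); congr (_.-integrable _ (EFin \o _)).
    by apply/funext => x; rewrite !patchE; case: (x \in _); rewrite ?mul0r// mulrC.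
  have j2 : leb.-integrable setT (EFin \o (fun x => ind x * ramp s x)).
    apply: (integrable_mul_supp (A := `[l, r]) jind _ (measurable_ramp s)).
      move=> x nx; rewrite /ind indicE memNset// => /IO xO.
      by apply: nx; apply: subset_itv_oo_cc xO.
    by move=> x; exact: ramp_itv_bound.
  under eq_Rintegral do rewrite mulrBl.
  rewrite RintegralB//.
  have -> : \int[leb]_x ((f \_ Omega) x * ramp s x) = \int[leb]_(x in Omega) (ramp s x * f x).
    rewrite [RHS]Rintegral_mkcond; apply: eq_Rintegral => x _.
    by rewrite !patchE; case: (x \in _); rewrite ?mul0r// mulrC.
  have -> : \int[leb]_x (ind x * ramp s x) = \int[leb]_(x in `]y, y + M[) ramp s x.
    rewrite [RHS]Rintegral_mkcond; apply: eq_Rintegral => x _.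
    by rewrite patchE /ind indicE; case: (x \in _); rewrite ?mul0r ?mul1r.
  by rewrite -(density_Rintegral (bounded_meas_ramp s)).2 E subrr.
split => // A mA; have [mf mufA] := df.
have mAO : measurable (A `&` Omega : set (measurableTypeR R)) by exact: measurableI.
rewrite mufA//.
rewrite (_ : (\int[leb]_(x in A `&` Omega) (f x)%:E = \int[leb]_(x in A `&` Omega) (ind x)%:E)%E).
  rewrite integral_indic//; congr (leb _).
  apply/seteqP; split => [x [Ix [Ax _]]|x [Ax Ix]] //.
  by split => //; split => //; exact: IO.
apply: ae_eq_integral => //.
- by apply/measurable_EFinP; exact: measurable_funS mf.
- by apply/measurable_EFinP; apply: measurable_funTS; exact: measurable_indic.
- by apply: aeS fI => x H [_ /H ->].
Qed.

End patch_of_ramps.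

End patch_measures.

(** * Transport costs to a patch *)

Section jko.
Context {R : realType}.
Notation leb := (@lebesgue_measure R).
Implicit Types (mu nu : {measure set R -> \bar R}).

Lemma subset_patch (l r y M : R) : l <= y -> y + M <= r ->
  `]y, y + M[%classic `<=` (`]l, r[%classic : set R).
Proof. by move=> ly yr; apply: subset_itv; rewrite bnd_simp. Qed.

Lemma patch_Rintegral (l r a M : R) nu (g : R -> R) : 0 < M -> l <= a -> a + M <= r ->
  is_patchm nu a M -> bounded_meas l r g ->
  \int[nu]_(x in `]l, r[) g x = \int[leb]_(x in `]a, a + M[) g x /\
  (\int[nu]_(x in `]l, r[) (g x)%:E = (\int[leb]_(x in `]a, a + M[) g x)%:E)%E.
Proof.
move=> M0 la ar pnu bg; have IO := subset_patch la ar.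
have mO : measurable (`]l, r[%classic : set R) by exact: measurable_itv.
have PMnu := is_patchm_PM mO M0 IO pnu.
have dnu := is_patchm_density mO IO pnu.
have jg : nu.-integrable `]l, r[ (EFin \o g).
  by case: bg => mg gC; exact: (in_PM_integrable mO PMnu mg gC).
have E : \int[nu]_(x in `]l, r[) g x = \int[leb]_(x in `]a, a + M[) g x.
  have [_ ->] := density_Rintegral PMnu dnu bg.
  rewrite Rintegral_mkcond [RHS]Rintegral_mkcond; apply: eq_Rintegral => x _.
  rewrite !patchE indicE; case: ifPn => [_|/negP nO].
    by case: (x \in _); rewrite ?mulr1 ?mulr0.
  by rewrite ifF//; apply/negP => /set_mem/IO xO; apply: nO; rewrite inE.
split=> //; rewrite -E /Rintegral fineK//.
exact: integrable_fin_num.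
Qed.

Section mean.
Variables (l r a M : R) (nu mu : {measure set R -> \bar R}) (f : R -> R).
Notation Omega := (`]l, r[%classic : set R).
Hypotheses (lr : l < r) (M0 : 0 < M) (la : l <= a) (ar : a + M <= r).
Hypotheses (pnu : is_patchm nu a M) (PMmu : in_PM Omega M mu) (df : has_density Omega mu f).

Let mO : measurable (Omega : set (measurableTypeR R)).
Proof. exact: measurable_itv. Qed.

Let y := patch_left M (\int[leb]_(x in Omega) (x * f x)).

Lemma coupling_split (pi : {measure set (R * R) -> \bar R}) : coupling mu nu pi ->
  exists K : R -> R, [/\ forall h, 0 <= K h,
    (\int[pi]_z ((z.1 - z.2) ^+ 2)%:E = (M * (y - a) ^+ 2 + K (y - a))%:E)%E,
    (\int[pi]_z ((z.1 - z.2) ^+ 2)%:E = (K 0)%:E)%E &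
    forall h s k, 0 < k ->
      `|\int[mu]_(x in Omega) ramp s x - \int[leb]_(x in `]a, a + M[) ramp (s - h) x|
      <= k * M / 2 + K h / (2 * k)].
Proof.
have PMnu : in_PM Omega M nu by exact: (is_patchm_PM mO M0 (subset_patch la ar) pnu).
move=> cpi; have [K [K0 KE Kh Kr]] := coupling_estimates PMmu PMnu cpi.
exists K; split => //; last first.
  move=> h s k k0.
  by rewrite -(patch_Rintegral M0 la ar pnu (bounded_meas_ramp l r (s - h))).1; exact: Kr.
rewrite KE (Kh (y - a)) (density_Rintegral PMmu df (bounded_meas_id l r)).2.
rewrite (patch_Rintegral M0 la ar pnu (bounded_meas_id l r)).1.
have -> : \int[leb]_(x in `]a, a + M[) id x = \int[leb]_(x in `]a, a + M[) (1 * x + 0).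
  by apply: eq_Rintegral => x _; rewrite mul1r addr0.
rewrite Rintegral_patch_affine// (patch_leftE (\int[leb]_(x in Omega) (x * f x)) M0) -/y.
by congr (_%:E); ring.
Qed.

(** The cost left after translating away the displacement of the means is
   nonnegative. *)
Lemma transport_cost_ge_mean : ((M * (y - a) ^+ 2)%:E <= transport_cost mu nu)%E.
Proof.
apply/ereal_infP => _ [pi /coupling_split[K [K0 -> _ _]] <-].
by rewrite lee_fin lerDl.
Qed.

(** Almost optimal couplings have cost K (y - a) close to zero after the
   translation by y - a, hence mu has the ramp integrals of the translate. *)
Lemma patch_of_min_cost : l <= y -> y + M <= r ->
  (transport_cost mu nu <= (M * (y - a) ^+ 2)%:E)%E -> is_patchm mu y M.
Proof.
move=> ly yr cost.
suff H e : 0 < e -> forall s, `|\int[mu]_(x in Omega) ramp s x -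
    \int[leb]_(x in `]y, y + M[) ramp s x| <= e.
  have [] := patch_of_ramps M0 PMmu df lr; last by [].
  by move=> e e0; exists y; split => //; exact: H.
move=> e0 s; pose k := e / M.
have k0 : 0 < k by rewrite divr_gt0.
have : (transport_cost mu nu < (M * (y - a) ^+ 2 + k * e)%:E)%E.
  by rewrite (le_lt_trans cost)// lte_fin ltrDl mulr_gt0.
move=> /ereal_inf_lt[_ [pi /coupling_split[K [K0 E _ Kr]] <-]].
rewrite E lte_fin ltrD2l => Ke.
have := Kr (y - a) s k k0.
have -> : \int[leb]_(x in `]a, a + M[) ramp (s - (y - a)) x =
    \int[leb]_(x in `]y, y + M[) ramp s x.
  rewrite !Rintegral_patch_ramp// -!rampsq_shift.
  by congr (rampsq _ _ - rampsq _ _); ring.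
move=> /le_trans; apply.
have -> : k * M / 2 = e / 2 by rewrite /k mulfVK// gt_eqF.
have k20 : 0 < 2 * k by rewrite mulr_gt0.
have E2 : e = e / 2 + (k * e) / (2 * k) by field; rewrite gt_eqF.
by rewrite [leRHS]E2 lerD2l ler_pM2r ?invr_gt0// ltW.
Qed.

End mean.

(** A coupling of cost less than e^2, with the parameter k = e of
   coupling_estimates. *)
Lemma W2_ramps_close (l r a M e : R) nu mu :
  0 < M -> l <= a -> a + M <= r -> is_patchm nu a M ->
  in_PM `]l, r[ M mu -> 0 < e -> (W2 nu mu < e%:E)%E ->
  forall s, `|\int[mu]_(x in `]l, r[) ramp s x - \int[leb]_(x in `]a, a + M[) ramp s x|
    <= e * (M + 1) / 2.
Proof.
move=> M0 la ar pnu PMmu e0 /(W2_lt_coupling e0)[pi cpi He] s.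
have mO : measurable (`]l, r[%classic : set R) by exact: measurable_itv.
have PMnu := is_patchm_PM mO M0 (subset_patch la ar) pnu.
have [K [K0 KE _ Kr]] := coupling_estimates PMnu PMmu cpi.
have := Kr 0 s e e0; rewrite subr0 distrC.
rewrite (patch_Rintegral M0 la ar pnu (bounded_meas_ramp l r s)).1 => /le_trans; apply.
move: He; rewrite KE lte_fin => Ke.
have e20 : 0 < 2 * e by rewrite mulr_gt0.
have -> : e * (M + 1) / 2 = e * M / 2 + e ^+ 2 / (2 * e) by field; rewrite gt_eqF.
by rewrite lerD2l ler_pM2r ?invr_gt0// ltW.
Qed.

End jko.

(** * One step of the minimizing movement scheme *)

Section jko_scheme.
Context {R : realType}.
Notation leb := (@lebesgue_measure R).
Variables (l r C M1 M2 : R) (Phi1 Phi2 dPhi1 dPhi2 : R -> R).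
Notation Omega := (`]l, r[%classic : set R).
Hypothesis tan1 : forall c x, l < c < r -> l < x < r ->
  Phi1 c + dPhi1 c * (x - c) <= Phi1 x.
Hypothesis tan2 : forall c x, l < c < r -> l < x < r ->
  Phi2 c + dPhi2 c * (x - c) <= Phi2 x.
Hypothesis dC1 : forall x, l < x < r -> `|dPhi1 x| <= C.
Hypothesis dC2 : forall x, l < x < r -> `|dPhi2 x| <= C.
Hypothesis bPhi1 : bounded_meas l r Phi1.
Hypothesis bPhi2 : bounded_meas l r Phi2.
Hypothesis dec12 : forall x y, l < x -> x <= y -> y < r ->
  Phi1 y - Phi2 y <= Phi1 x - Phi2 x.
Hypotheses (M10 : 0 < M1) (M20 : 0 < M2) (M12 : M1 + M2 < r - l).

Let lr : l < r. Proof. by have := M12; have := M10; have := M20; move=> *; lra. Qed.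

Let mO : measurable (Omega : set (measurableTypeR R)).
Proof. exact: measurable_itv. Qed.

Definition ordered_patches (mu1 mu2 : {measure set R -> \bar R}) (z1 z2 : R) :=
  [/\ is_patchm mu1 z1 M1, is_patchm mu2 z2 M2, l <= z2, z2 + M2 <= z1 & z1 + M1 <= r].

Lemma F_oo_patches mu1 mu2 z1 z2 : ordered_patches mu1 mu2 z1 z2 ->
  F_oo Omega mu1 mu2 = 0%E.
Proof.
move=> [p1 p2 lz2 z21 z1r]; rewrite /F_oo ifT//; apply/asboolP.
have lz1 : l <= z1 by rewrite (le_trans lz2)// (le_trans _ z21)// lerDl ltW.
have z2r : z2 + M2 <= r by rewrite (le_trans z21)// (le_trans _ z1r)// lerDl ltW.
exists (\1_(`]z1, z1 + M1[%classic)), (\1_(`]z2, z2 + M2[%classic)); split.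
- exact: (is_patchm_density mO (subset_patch lz1 z1r) p1).
- exact: (is_patchm_density mO (subset_patch lz2 z2r) p2).
apply: le_Lp_norm_oo => // x _ /=; rewrite !indicE.
case: (boolP (x \in `]z1, z1 + M1[%classic)) => [/set_mem|_]; last first.
  by case: (x \in _); rewrite add0r ?normr1 ?normr0.
rewrite /= in_itv/= => /andP[z1x _].
rewrite memNset ?addr0 ?normr1//= in_itv/= => /andP[_ x2].
by have := lt_le_trans x2 z21; rewrite ltNge (ltW z1x).
Qed.

Lemma JKO_energy_patches (tau a1 a2 z1 z2 : R) nu1 nu2 mu1 mu2 : 0 < tau ->
  ordered_patches nu1 nu2 a1 a2 -> ordered_patches mu1 mu2 z1 z2 ->
  (JKO_energy Omega Phi1 Phi2 tau nu1 nu2 mu1 mu2 <=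
   (\int[leb]_(x in `]z1, z1 + M1[) Phi1 x + \int[leb]_(x in `]z2, z2 + M2[) Phi2 x +
    (2 * tau)^-1 * (M1 * (z1 - a1) ^+ 2 + M2 * (z2 - a2) ^+ 2))%:E)%E.
Proof.
move=> tau0 [q1 q2 la2 a21 a1r] pmu; have F0 := F_oo_patches pmu.
case: pmu => p1 p2 lz2 z21 z1r.
have lz1 : l <= z1 by rewrite (le_trans lz2)// (le_trans _ z21)// lerDl ltW.
have z2r : z2 + M2 <= r by rewrite (le_trans z21)// (le_trans _ z1r)// lerDl ltW.
rewrite /JKO_energy F0 add0e /G_drift.
rewrite (patch_Rintegral M10 lz1 z1r p1 bPhi1).2 (patch_Rintegral M20 lz2 z2r p2 bPhi2).2.
rewrite !W2_sqr mulrDr -addeA.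
have t0 : (0 <= ((2 * tau)^-1)%:E)%E by rewrite lee_fin invr_ge0 mulr_ge0// ltW.
have h1 := lee_wpmul2l t0 (transport_cost_patch M10 p1 q1).
have h2 := lee_wpmul2l t0 (transport_cost_patch M20 p2 q2).
have := leeD h1 h2; rewrite -!EFinM -EFinD => h.
by rewrite -[X in (X + _ <= _)%E]EFinD [X in (_ <= X)%E]EFinD; exact: leeD2l.
Qed.

Lemma finite_costs (c A B P : R) (w1 w2 : \bar R) : 0 < c -> (0 <= w1)%E -> (0 <= w2)%E ->
  (A%:E + B%:E + c%:E * w1 + c%:E * w2 <= P%:E)%E ->
  exists u1 u2, [/\ w1 = u1%:E, w2 = u2%:E & A + B + c * u1 + c * u2 <= P].
Proof.
move=> c0; case: w1 => [u1 _|_ w20|//]; last first.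
  rewrite gt0_muley ?lte_fin// -EFinD addey//= addye ?leye_eq//.
  by rewrite gt_eqF// (lt_le_trans _ (mule_ge0 _ w20))// lee_fin ltW.
case: w2 => [u2 _|_|//]; last by rewrite gt0_muley ?lte_fin// addey// leye_eq.
by rewrite -!EFinM -!EFinD lee_fin => h; exists u1, u2.
Qed.

(** The patches of better_patches have at most the drift energy of the minimizer,
   while the transport cost of the minimizer is bounded below by the
   displacement of its means. Minimality excludes the strict gain and forces
   equality in the latter bound, which holds for translates only. *)
Lemma jko_step (tau a1 a2 : R) nu1 nu2 mu1 mu2 : 0 < tau ->
  ordered_patches nu1 nu2 a1 a2 ->
  JKO_minimizer Omega Phi1 Phi2 M1 M2 tau nu1 nu2 mu1 mu2 ->
  exists z1 z2, ordered_patches mu1 mu2 z1 z2.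
Proof.
move=> tau0 onu [PM1 PM2 minE].
have [q1 q2 la2 a21 a1r] := onu.
have la1 : l <= a1 by rewrite (le_trans la2)// (le_trans _ a21)// lerDl ltW.
have a2r : a2 + M2 <= r by rewrite (le_trans a21)// (le_trans _ a1r)// lerDl ltW.
have patch_PM z1 z2 s1 s2 : ordered_patches s1 s2 z1 z2 ->
    in_PM Omega M1 s1 /\ in_PM Omega M2 s2.
  move=> [p1 p2 lz2 z21 z1r].
  have lz1 : l <= z1 by rewrite (le_trans lz2)// (le_trans _ z21)// lerDl ltW.
  have z2r : z2 + M2 <= r by rewrite (le_trans z21)// (le_trans _ z1r)// lerDl ltW.
  by split; [exact: (is_patchm_PM mO M10 (subset_patch lz1 z1r) p1)
    |exact: (is_patchm_PM mO M20 (subset_patch lz2 z2r) p2)].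
have bound z1 z2 : l <= z2 -> z2 + M2 <= z1 -> z1 + M1 <= r ->
    (JKO_energy Omega Phi1 Phi2 tau nu1 nu2 mu1 mu2 <=
     (\int[leb]_(x in `]z1, z1 + M1[) Phi1 x + \int[leb]_(x in `]z2, z2 + M2[) Phi2 x +
      (2 * tau)^-1 * (M1 * (z1 - a1) ^+ 2 + M2 * (z2 - a2) ^+ 2))%:E)%E.
  move=> lz2 z21 z1r; have [s1 p1] := exists_patchm z1 M1; have [s2 p2] := exists_patchm z2 M2.
  have os : ordered_patches s1 s2 z1 z2 by split.
  have [h1 h2] := patch_PM _ _ _ _ os.
  by apply: le_trans (minE s1 s2 h1 h2) _; exact: JKO_energy_patches.
have c0 : 0 < (2 * tau)^-1 by rewrite invr_gt0 mulr_gt0.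
have ipm i (Phi : R -> R) (mu : {measure set R -> \bar R}) : in_PM Omega i mu ->
    bounded_meas l r Phi -> (\int[mu]_(x in Omega) (Phi x)%:E = (\int[mu]_(x in Omega) Phi x)%:E)%E.
  move=> PM [mP bP]; rewrite /Rintegral fineK//.
  exact: integrable_fin_num (in_PM_integrable mO PM mP bP).
have w10 := transport_cost_ge0 mu1 nu1; have w20 := transport_cost_ge0 mu2 nu2.
have Ffin : F_oo Omega mu1 mu2 = 0%E.
  have := bound a1 a2 la2 a21 a1r.
  rewrite /JKO_energy /F_oo; case: ifP => // _.
  rewrite /G_drift (ipm _ _ _ PM1 bPhi1) (ipm _ _ _ PM2 bPhi2) !W2_sqr.
  have cW m1 m2 : (((2 * tau)^-1)%:E * transport_cost m1 m2 != -oo)%E.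
    rewrite gt_eqF// (lt_le_trans _ (mule_ge0 _ (transport_cost_ge0 m1 m2)))//.
    by rewrite lee_fin ltW.
  by rewrite -EFinD addye// addye ?cW// addye ?cW.
have [f1 [f2 [d1 d2 f12]]] : exists f1 f2 : R -> R, [/\ has_density Omega mu1 f1,
         has_density Omega mu2 f2 &
         (Lp_norm leb Omega +oo (f1 \+ f2)%R <= 1)%E].
  by move: Ffin; rewrite /F_oo; case: ifP => // /asboolP.
have [jf1 f10 _] := has_density_props mO PM1 d1.
have [jf2 f20 _] := has_density_props mO PM2 d2.
have f12_01 : \forall x \ae leb, Omega x -> [/\ 0 <= f1 x, 0 <= f2 x & f1 x + f2 x <= 1].
  apply: aeS (aeI (aeI f10 f20) (Lp_norm_oo_le f12)) => x [[h1 h2] h3] Ox.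
  split; [exact: h1|exact: h2|].
  by apply: le_trans (h3 Ox); rewrite /= ler_norm.
have mf1 := density_mass PM1 d1; have mf2 := density_mass PM2 d2.
have [z1 [z2 [lz2 z21 z1r PA alt]]] := better_patches tan1 tan2 dC1 dC2 bPhi1 bPhi2
  M10 M20 M12 a21 jf1 jf2 f12_01 mf1 mf2 dec12.
have c1 := transport_cost_ge_mean M10 la1 a1r q1 PM1 d1.
have c2 := transport_cost_ge_mean M20 la2 a2r q2 PM2 d2.
have m1 := patch_of_min_cost lr M10 la1 a1r q1 PM1 d1.
have m2 := patch_of_min_cost lr M20 la2 a2r q2 PM2 d2.
have := bound z1 z2 lz2 z21 z1r.
rewrite /JKO_energy Ffin add0e /G_drift !W2_sqr.
rewrite (ipm _ _ _ PM1 bPhi1) (ipm _ _ _ PM2 bPhi2).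
rewrite (density_Rintegral PM1 d1 bPhi1).2 (density_Rintegral PM2 d2 bPhi2).2.
move=> /(finite_costs c0 w10 w20)[u1 [u2 [e1 e2]]].
rewrite e1 !lee_fin in c1 m1; rewrite e2 !lee_fin in c2 m2.
move: PA c1 c2 m1 m2 alt => {w10 w20 e1 e2}.
move: (\int[leb]_(x in Omega) (Phi1 x * f1 x)) (\int[leb]_(x in Omega) (Phi2 x * f2 x)) => A1 A2.
move: (\int[leb]_(x in `]z1, z1 + M1[) Phi1 x) (\int[leb]_(x in `]z2, z2 + M2[) Phi2 x) => P1 P2.
move: (patch_left M1 _) (patch_left M2 _) => y1 y2 PA c1 c2 m1 m2 alt E.
have ww : u1 + u2 <= M1 * (z1 - a1) ^+ 2 + M2 * (z2 - a2) ^+ 2.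
  rewrite -(ler_pM2l c0) mulrDr; move: E PA.
  move: (_ * u1) (_ * u2) (_ * (_ + _)) => u v t E PA; lra.
case: alt => [[e1 e2]|lt]; last by move: (lt_le_trans lt (lerD c1 c2)); rewrite ltNge ww.
rewrite e1 e2 in ww lz2 z21 z1r.
have ly1 : l <= y1 by rewrite (le_trans lz2)// (le_trans _ z21)// lerDl ltW.
have y2r : y2 + M2 <= r by rewrite (le_trans z21)// (le_trans _ z1r)// lerDl ltW.
have w1E : u1 <= M1 * (y1 - a1) ^+ 2.
  by move: c1 c2 ww; move: (_ * _) (M2 * _) => u v; lra.
have w2E : u2 <= M2 * (y2 - a2) ^+ 2.
  by move: c1 c2 ww; move: (_ * _) (M2 * _) => u v; lra.
exists y1, y2; split => //; [exact: m1|exact: m2].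
Qed.

End jko_scheme.

(** * The limit of the scheme *)

Section scheme_limit.
Context {R : realType}.
Notation leb := (@lebesgue_measure R).
Variables (l r : R) (Phi1 Phi2 : R -> R).
Notation Omega := (`]l, r[%classic : set R).
Hypothesis lr : l < r.
Hypotheses (C11 : C1_on Omega Phi1) (W11 : W1oo Omega Phi1).
Hypotheses (C12 : C1_on Omega Phi2) (W12 : W1oo Omega Phi2).
Hypothesis drift12 : forall x, Omega x -> - derive1 Phi1 x >= - derive1 Phi2 x.
Hypotheses (cvx1 : distr_deriv2_ge0 Omega Phi1) (cvx2 : distr_deriv2_ge0 Omega Phi2).

Let mO : measurable (Omega : set (measurableTypeR R)).
Proof. exact: measurable_itv. Qed.

Let oO : open Omega. Proof. exact: itv_open. Qed.

Lemma potential_bounded_meas Phi : C1_on Omega Phi -> W1oo Omega Phi ->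
  bounded_meas l r Phi.
Proof.
move=> C1 W1; split; first exact: (measurable_C1 oO C1).1.
have [C PC] := potential_bounded lr C1 W1.
by exists C => x /itvooP; exact: PC.
Qed.

Lemma potential_difference_noninc x y : l < x -> x <= y -> y < r ->
  Phi1 y - Phi2 y <= Phi1 x - Phi2 x.
Proof.
move=> lx; rewrite le_eqVlt => /predU1P[<-//|xy yr].
have xyO z : x <= z <= y -> Omega z.
  by move=> /andP[xz zy]; apply/itvooP; rewrite (lt_le_trans lx xz) (le_lt_trans zy yr).
pose G z := Phi1 z - Phi2 z.
have dG z : z \in `]x, y[ -> is_derive z 1 G (derive1 Phi1 z - derive1 Phi2 z).
  rewrite in_itv/= => /andP[xz zy].
  have Oz : Omega z by apply: xyO; rewrite !ltW.
  by apply: is_deriveB; apply: derivable_is_derive; [exact: C11.1|exact: C12.1].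
have cG : {within `[x, y], continuous G}.
  apply: continuous_in_subspaceT => z /set_mem/=; rewrite in_itv/= => xzy.
  have /itvooP Oz := xyO _ xzy.
  by apply: cvgB; [exact: (potential_cont C11 Oz)|exact: (potential_cont C12 Oz)].
have [c cxy E] := MVT xy dG cG.
have Oc : Omega c by apply: xyO; move: cxy; rewrite in_itv/= => /andP[? ?]; rewrite !ltW.
have d0 : (derive1 Phi1 c - derive1 Phi2 c) * (y - x) <= 0.
  rewrite mulr_le0_ge0// ?subr_ge0 ?(ltW xy)// subr_le0 -lerN2; exact: drift12.
by rewrite -subr_le0 -/(G y) -/(G x) E.
Qed.

Lemma initial_patch mu (a b : R) : a < b -> `]a, b[%classic `<=` Omega ->
  has_density Omega mu (\1_(`]a, b[%classic)) -> is_patchm mu a (b - a).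
Proof.
move=> ab abO [_ d] A mA; rewrite d// integral_indic//; last exact: measurableI.
rewrite addrC subrK; congr (leb _).
by apply/seteqP; split => [x [Ix [Ax _]]|x [Ax Ix]]; split => //; split => //; exact: abO.
Qed.

Lemma itv_subset_le (a b : R) : a < b -> `]a, b[%classic `<=` Omega -> l <= a /\ b <= r.
Proof.
move=> ab abO; split; rewrite leNgt; apply/negP => h.
  have := abO ((a + Num.min b l) / 2); rewrite /= !in_itv/= => H.
  by move: H; case: (leP b l) => bl; rewrite /= => H; have := H _; move=> /(_ ltac:(apply/andP; split; lra))/andP[]; lra.
have := abO ((b + Num.max a r) / 2); rewrite /= !in_itv/= => H.
by move: H; case: (leP a r) => bl; rewrite /= => H; have := H _; move=> /(_ ltac:(apply/andP; split; lra))/andP[]; lra.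
Qed.

Variables (a10 b10 a20 b20 : R).
Notation M1 := (b10 - a10).
Notation M2 := (b20 - a20).
Hypotheses (ab1 : a10 < b10) (ab1O : `]a10, b10[%classic `<=` Omega).
Hypotheses (ab2 : a20 < b20) (ab2O : `]a20, b20[%classic `<=` Omega).
Hypothesis sorted0 : forall x1 x2, 0 < (\1_(`]a10, b10[%classic) x1 : R) ->
  0 < (\1_(`]a20, b20[%classic) x2 : R) -> x1 >= x2.
Hypothesis M12 : M1 + M2 < r - l.

Let M10 : 0 < M1. Proof. by rewrite subr_gt0. Qed.
Let M20 : 0 < M2. Proof. by rewrite subr_gt0. Qed.

Lemma initial_sorted : b20 <= a10.
Proof.
have S x1 x2 : a10 < x1 < b10 -> a20 < x2 < b20 -> x2 <= x1.
  move=> h1 h2; apply: sorted0; rewrite indicE mem_set//= in_itv//.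
rewrite leNgt; apply/negP => h.
have [x1 x1I x1b] : exists2 x, a10 < x < b10 & x < (a10 + b20) / 2.
  have [hb|hb] := ltP b10 ((a10 + b20) / 2); first by exists ((a10 + b10) / 2); [apply/andP; split|]; move: ab1 hb h; lra.
  by exists ((a10 + (a10 + b20) / 2) / 2); [apply/andP; split|]; move: ab1 hb h; lra.
have [x2 x2I x2b] : exists2 x, a20 < x < b20 & (a10 + b20) / 2 < x.
  have [hb|hb] := ltP ((a10 + b20) / 2) a20; first by exists ((a20 + b20) / 2); [apply/andP; split|]; move: ab2 hb h; lra.
  by exists ((b20 + (a10 + b20) / 2) / 2); [apply/andP; split|]; move: ab2 hb h; lra.
by have := S _ _ x1I x2I; rewrite leNgt (lt_trans x1b x2b).
Qed.

Lemma scheme_patches tau N d1 d2 : 0 < tau ->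
  JKO_scheme Omega Phi1 Phi2 M1 M2 (\1_(`]a10, b10[%classic)) (\1_(`]a20, b20[%classic))
    tau N d1 d2 ->
  forall k, (k <= N)%N -> exists z1 z2, ordered_patches l r M1 M2 (d1 k) (d2 k) z1 z2.
Proof.
move=> tau0 [i1 i2 step]; elim=> [_|k IH kN].
  exists a10, a20; split; [exact: initial_patch|exact: initial_patch|..].
  - by have [] := itv_subset_le ab2 ab2O.
  - by rewrite addrC subrK; exact: initial_sorted.
  - by rewrite addrC subrK; have [] := itv_subset_le ab1 ab1O.
have [z1 [z2 oz]] := IH (ltnW kN).
have [A1 [A1P _]] := potential_derive1 lr C11 W11.
have [A2 [A2P _]] := potential_derive1 lr C12 W12.
pose A := Num.max A1 A2.
have dA1 x : l < x < r -> `|derive1 Phi1 x| <= A by move=> /A1P h; rewrite le_max h.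
have dA2 x : l < x < r -> `|derive1 Phi2 x| <= A by move=> /A2P h; rewrite le_max h orbT.
exact: (jko_step (potential_tangent lr C11 W11 cvx1) (potential_tangent lr C12 W12 cvx2)
  dA1 dA2 (potential_bounded_meas C11 W11) (potential_bounded_meas C12 W12)
  potential_difference_noninc M10 M20 M12 tau0 oz (step k kN)).
Qed.

Variables (T : R) (mu1 mu2 : R -> {measure set R -> \bar R}).
Hypothesis scheme_limit : JKO_limit Omega T Phi1 Phi2 M1 M2
  (\1_(`]a10, b10[%classic)) (\1_(`]a20, b20[%classic)) mu1 mu2.

Lemma limit_ramps_close (t e : R) : 0 <= t <= T -> in_PM Omega M1 (mu1 t) ->
  in_PM Omega M2 (mu2 t) -> 0 < e ->
  exists z1 z2, [/\ l <= z2, z2 + M2 <= z1, z1 + M1 <= r,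
    forall s, `|\int[mu1 t]_(x in Omega) ramp s x -
                \int[leb]_(x in `]z1, z1 + M1[) ramp s x| <= e &
    forall s, `|\int[mu2 t]_(x in Omega) ramp s x -
                \int[leb]_(x in `]z2, z2 + M2[) ramp s x| <= e].
Proof.
move=> tT PM1 PM2 e0.
have [tau [N [d1 [d2 [tauN _ sch u1 u2]]]]] := scheme_limit.
pose c := 2 * e / (M1 + M2 + 1).
have D0 : 0 < M1 + M2 + 1 by exact: (addr_gt0 (addr_gt0 M10 M20) ltr01).
have c0 : 0 < c by rewrite divr_gt0// mulr_gt0.
have cM M : M <= M1 + M2 -> c * (M + 1) / 2 <= e.
  move=> hM; rewrite ler_pdivrMr// [e * 2]mulrC.
  have <- : c * (M1 + M2 + 1) = 2 * e by rewrite /c divfK// gt_eqF.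
  by rewrite ler_pM2l// lerD2r.
have [n [v1 v2]] : exists n, (forall t, 0 <= t <= T ->
      (W2 (time_discrete (tau n) (N n) (d1 n) t) (mu1 t) < c%:E)%E) /\
    (forall t, 0 <= t <= T ->
      (W2 (time_discrete (tau n) (N n) (d2 n) t) (mu2 t) < c%:E)%E).
  have [n1 _ h1] := u1 _ c0; have [n2 _ h2] := u2 _ c0.
  exists (maxn n1 n2); split; [apply: h1|apply: h2]; rewrite /= ?leq_maxl ?leq_maxr//.
have := scheme_patches (tauN n).1 (sch n) (geq_minr (Num.truncn (t / tau n)).+1 (N n)).
move=> [z1 [z2 [p1 p2 lz2 z21 z1r]]].
have lz1 : l <= z1 by rewrite (le_trans lz2)// (le_trans _ z21)// lerDl ltW.
have z2r : z2 + M2 <= r by rewrite (le_trans z21)// (le_trans _ z1r)// lerDl ltW.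
exists z1, z2; split => // s.
  apply: (le_trans (W2_ramps_close M10 lz1 z1r p1 PM1 c0 (v1 t tT) s)).
  by apply: cM; rewrite lerDl ltW.
apply: (le_trans (W2_ramps_close M20 lz2 z2r p2 PM2 c0 (v2 t tT) s)).
by apply: cM; rewrite lerDr ltW.
Qed.

(** Ramp integrals pass to the limit in W_2; the first moments do as well, which
   keeps the order of the two patches. *)
Lemma limit_patches (t : R) f1 f2 : 0 <= t <= T -> in_PM Omega M1 (mu1 t) ->
  in_PM Omega M2 (mu2 t) -> has_density Omega (mu1 t) f1 ->
  has_density Omega (mu2 t) f2 ->
  let a1 := patch_left M1 (\int[leb]_(x in Omega) (x * f1 x)) in
  let a2 := patch_left M2 (\int[leb]_(x in Omega) (x * f2 x)) in
  [/\ l <= a2, a2 + M2 <= a1, a1 + M1 <= r,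
      \forall x \ae leb, Omega x -> f1 x = \1_(`]a1, a1 + M1[) x &
      \forall x \ae leb, Omega x -> f2 x = \1_(`]a2, a2 + M2[) x].
Proof.
have aux (u v w z1 z2 : R) : - ((v + w - u) / 4) <= u - z1 ->
    v - z2 <= (v + w - u) / 4 -> z2 + w <= z1 -> 0 < v + w - u -> False by lra.
move=> tT PM1 PM2 D1 D2 a1 a2.
have close e := limit_ramps_close (e := e) tT PM1 PM2.
have [_ a1r f1E _] : [/\ l <= a1, a1 + M1 <= r,
      \forall x \ae leb, Omega x -> f1 x = \1_(`]a1, a1 + M1[) x &
      is_patchm (mu1 t) a1 M1].
  apply: (patch_of_ramps M10 PM1 D1 lr) => e /close[z1 [z2 [lz2 z21 z1r h _]]].
  by exists z1; split => //; rewrite (le_trans lz2)// (le_trans _ z21)// lerDl ltW.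
have [la2 _ f2E _] : [/\ l <= a2, a2 + M2 <= r,
      \forall x \ae leb, Omega x -> f2 x = \1_(`]a2, a2 + M2[) x &
      is_patchm (mu2 t) a2 M2].
  apply: (patch_of_ramps M20 PM2 D2 lr) => e /close[z1 [z2 [lz2 z21 z1r _ h]]].
  by exists z2; split => //; rewrite (le_trans z21)// (le_trans _ z1r)// lerDl ltW.
split => //; rewrite leNgt; apply/negP; rewrite -subr_gt0 => h.
pose m := Num.min M1 M2; pose d := a2 + M2 - a1.
have m0 : 0 < m by rewrite lt_min M10 M20.
have e0 : 0 < m * (d / 4) by rewrite mulr_gt0// divr_gt0.
have [z1 [z2 [lz2 z21 z1r h1 h2]]] := close _ e0.
have lz1 : l <= z1 by rewrite (le_trans lz2)// (le_trans _ z21)// lerDl ltW.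
have := ramps_close_left M10 PM1 D1 lz1 h1; have := ramps_close_left M20 PM2 D2 lz2 h2.
rewrite -/a1 -/a2 => k2 k1.
have d40 : 0 <= d / 4 by rewrite divr_ge0// ltW.
have b1 : `|a1 - z1| <= d / 4.
  rewrite -(ler_pM2l M10) (le_trans k1)// ler_wpM2r// ge_min lexx//.
have b2 : `|a2 - z2| <= d / 4.
  rewrite -(ler_pM2l M20) (le_trans k2)// ler_wpM2r// ge_min lexx orbT//.
move: b1 b2 z21 h; rewrite /d !ler_norml => /andP[b1 _] /andP[_ b2].
exact: aux.
Qed.

End scheme_limit.

(** * Integration on the space-time cylinder *)

Section square_integrable.
Context d (X : measurableType d) (R : realType).
Variable mu : {measure set X -> \bar R}.

Lemma in_L2_integrable (D : set X) (f : X -> R) : measurable D -> (mu D < +oo)%E ->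
  in_Lp mu D 2%:E f -> mu.-integrable D (EFin \o f).
Proof.
move=> mD Doo [mf Lf].
have mfD : measurable_fun setT (f \_ D) by exact: (measurable_restrictT _ mD).1.
have L2 : (\int[mu]_x (`|(f \_ D) x| `^ 2)%:E < +oo)%E.
  rewrite (@lty_poweRy _ _ 2^-1)//.
  by move: Lf; rewrite /Lp_norm restrict_EFin unlock.
have i2 : mu.-integrable setT (EFin \o (fun x => `|(f \_ D) x| `^ 2)).
  apply/integrableP; split.
    apply/measurable_EFinP; apply: (@measurableT_comp _ _ _ _ _ _ (fun x : R => x `^ 2)%R) => //.
    exact: measurableT_comp.
  by under eq_integral => x _ do rewrite /= ger0_norm ?powR_ge0//.
have i1 : mu.-integrable setT (EFin \o \1_D).
  apply/integrableP; split.
    by apply/measurable_EFinP; exact: measurable_indic.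
  under eq_integral => x _ do rewrite /= ger0_norm//.
  by rewrite integral_indic// setIT.
apply/(integrable_mkcond _ mD).2; rewrite restrict_EFin.
apply: (le_integrable measurableT _ _ (integrableD measurableT i2 i1)) => //.
  by apply/measurable_EFinP.
move=> x _ /=; rewrite lee_fin [leRHS]ger0_norm ?addr_ge0 ?powR_ge0//.
rewrite patchE indicE; case: ifPn => xD; last by rewrite normr0 ?addr_ge0 ?powR_ge0.
(* |f| <= |f|^2 + 1 *)
rewrite powR_mulrn ?normr_ge0// -subr_ge0.
have -> : `|f x| ^+ 2 + 1 - `|f x| = (`|f x| - 2^-1) ^+ 2 + 3 / 4 by field.
by rewrite addr_ge0 ?sqr_ge0.
Qed.

End square_integrable.

Section slices.
Context {R : realType}.
Notation leb := (@lebesgue_measure R).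
Variables (l r T : R).
Hypotheses (lr : l < r) (T0 : 0 < T).
Notation Omega := (`]l, r[%classic : set R).
Notation I := (`[0, T]%classic : set R).
Notation Q := (I `*` Omega).

Let mO : measurable (Omega : set (measurableTypeR R)).
Proof. exact: measurable_itv. Qed.

Let mI : measurable (I : set (measurableTypeR R)).
Proof. exact: measurable_itv. Qed.

Lemma measurable_cylinder : measurable (Q : set (measurableTypeR R * measurableTypeR R)).
Proof. exact: measurableX. Qed.

Lemma cylinder_finite : ((leb \x leb)%E Q < +oo)%E.
Proof.
rewrite product_measure1E// /= !lebesgue_measure_itv/= !lte_fin lr T0.
by rewrite -!EFinD -EFinM ltry.
Qed.

Variable f : measurableTypeR R * measurableTypeR R -> R.
Hypothesis jf : (leb \x leb)%E.-integrable Q (EFin \o f).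

Let jfQ : (leb \x leb)%E.-integrable setT ((EFin \o f) \_ Q).
Proof. exact: (integrable_mkcond _ measurable_cylinder).1. Qed.

Let sliceE t : I t ->
  (fun x => ((EFin \o f) \_ Q) (t, x)) = (EFin \o (fun x => f (t, x))) \_ Omega.
Proof.
move=> It; apply/funext => x; rewrite !patchE.
have [Ox|Ox] := boolP (x \in Omega).
  by rewrite mem_set//; split => //; exact/set_mem.
by rewrite memNset//= => -[_ /mem_set]; exact/negP.
Qed.

Lemma integrable_slices : \forall t \ae leb, I t ->
  leb.-integrable Omega (EFin \o (fun x => f (t, x))).
Proof.
apply: aeS (ae_integrable1 jfQ) => t + It; rewrite sliceE// => h.
exact: (integrable_mkcond _ mO).2.
Qed.

Lemma integrable_Rintegral_slices :
  leb.-integrable I (EFin \o (fun t => \int[leb]_(x in Omega) f (t, x))).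
Proof.
have fineB (y : \bar R) : (`|(fine y)%:E| <= `|y|)%E.
  by case: y => [y| |] //=; rewrite normr0 leey.
have jF := integrable_fubini_F jfQ.
apply/(integrable_mkcond _ mI).2.
have -> : ((EFin \o (fun t => \int[leb]_(x in Omega) f (t, x))) \_ I) =
    EFin \o fine \o (fubini_F leb ((EFin \o f) \_ Q)).
  apply/funext => t; rewrite /= patchE /fubini_F; case: ifPn => [/set_mem It|nI].
    by rewrite (sliceE It) /= -integral_mkcond.
  rewrite (_ : (fun y => _) = cst 0%E) ?integral0//.
  by apply/funext => y; rewrite patchE memNset//= => -[It _]; case/negP: nI; exact: mem_set.
apply: (le_integrable measurableT _ _ jF) => //.
  apply/measurable_EFinP; apply: measurableT_comp => //.
  exact: measurable_int jF.
move=> t _; exact: fineB.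
Qed.

End slices.

Section integral_derivative.
Context {R : realType}.
Notation leb := (@lebesgue_measure R).

(** Lebesgue differentiation of the primitive, extended by zero outside [0, T]. *)
Lemma ae_is_derive_integral (T : R) (F : R -> R) : leb.-integrable `[0, T] (EFin \o F) ->
  \forall t \ae leb, 0 < t < T ->
    is_derive t 1 (fun s : R => \int[leb]_(z in `[0, s]) F z) (F t).
Proof.
move=> jF; pose f := F \_ `[0, T].
have jf : leb.-integrable setT (EFin \o f) by exact: integrable_restrictT.
have jfy y : leb.-integrable `]-oo, y] (EFin \o f).
  by apply: (integrableS _ _ _ jf) => //; exact: measurable_itv.
have lf : locally_integrable [set: R] f by exact: integrable_locally_restrict.
have := FTC1Ny jfy lf; apply: aeS => t [dt dtE] /andP[t0 tT].
have : is_derive t 1 (fun s : R => \int[leb]_(z in `]-oo, s]) f z) (F t).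
  apply: DeriveDef => //; rewrite -derive1E dtE /f patchE mem_set//=.
  by rewrite in_itv/= !ltW.
apply: near_eq_is_derive; near=> s.
have s0 : 0 < s by near: s; exact: lt_nbhsr.
have sT : s < T by near: s; exact: lt_nbhsl.
rewrite [LHS]Rintegral_mkcond [RHS]Rintegral_mkcond; congr Rintegral.
apply/funext => x; rewrite /f !patchE !mem_setE !in_itv/=.
have [x0|x0] := ltP x 0; first by rewrite /=; case: ifP.
by have [xs|xs] := leP x s; rewrite //= (le_trans xs (ltW sT)).
Unshelve. all: by end_near. Qed.

(** Fermat's rule at a single point of differentiability. *)
Lemma is_derive_min0 (h : R -> R) (t d : R) : is_derive t 1 h d ->
  (\forall s \near t, 0 <= h s) -> h t = 0 -> d = 0.
Proof.
move=> [dh hd] h0 ht; apply/eqP; apply: contraT => d0.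
have : (s^-1 *: (h (s *: 1 + t) - h t)) @[s --> (0:R)^'] --> d by rewrite -hd; exact: dh.
move=> /cvgrPdist_lt /(_ `|d|); rewrite normr_gt0 => /(_ d0) [e2 /= e20 H].
have [e1 /= e10 {}h0] := h0.
pose e := Num.min e1 e2 / 2.
have e0 : 0 < e by rewrite divr_gt0// lt_min e10.
have [ee1 ee2] : e < e1 /\ e < e2.
  have m0 : 0 < Num.min e1 e2 by rewrite lt_min e10.
  have : e < Num.min e1 e2 by rewrite /e ltr_pdivrMr// ltr_pMr// ltr1n.
  by rewrite lt_min => /andP.
have key s : s = e \/ s = - e -> `|d - s^-1 * h (s + t)| < `|d| /\ 0 <= h (s + t).
  move=> se; have sn : `|s| = e by case: se => ->; rewrite ?normrN gtr0_norm.
  split; last by apply: h0; rewrite /ball_/= opprD addrA addrAC subrr add0r normrN sn.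
  have := H s; rewrite /ball_/= sub0r normrN sn => /(_ ee2).
  rewrite -normr_gt0 sn => /(_ e0); rewrite ht subr0 scaler1; exact.
have [k1 p1] := key e (or_introl erefl); have [k2 p2] := key (- e) (or_intror erefl).
have q1 : 0 <= e^-1 * h (e + t) by rewrite mulr_ge0// invr_ge0 ltW.
have q2 : (- e)^-1 * h (- e + t) <= 0 by rewrite invrN mulNr oppr_le0 mulr_ge0// invr_ge0 ltW.
have [dp|dp|/eqP] := ltgtP d 0; last by rewrite (negbTE d0).
  move: k1; rewrite (ltr0_norm dp) ltr_norml => /andP[k1 _].
  by move: k1; rewrite ltrBrDr addrC; lra.
by move: k2; rewrite (gtr0_norm dp) ltr_norml => /andP[_ k2]; lra.
Qed.

End integral_derivative.

(** * The velocity of a moving patch *)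

Section bounded_multiplier.
Context d (X : measurableType d) (R : realType).
Variable mu : {measure set X -> \bar R}.

Lemma integrable_mul_ae_bounded (D : set X) (u k : X -> R) (C : R) : measurable D ->
  mu.-integrable D (EFin \o u) -> measurable_fun D k ->
  (\forall x \ae mu, D x -> `|k x| <= C) ->
  mu.-integrable D (EFin \o (fun x => u x * k x)).
Proof.
move=> mD ju mk kC.
have mu' : measurable_fun D u by apply/measurable_EFinP; exact: measurable_int ju.
apply/integrableP; split.
  by apply/measurable_EFinP; exact: measurable_funM.
have /integrableP[_ jC] := integrableZl mD `|C| ju.
apply: le_lt_trans jC; apply: ae_ge0_le_integral => //.
- apply/measurable_EFinP; apply: measurableT_comp => //; exact: measurable_funM.
- apply/measurable_EFinP; apply: measurableT_comp => //; exact: measurable_funM.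
- apply: aeS kC => x kC Dx /=; rewrite lee_fin !normrM mulrC normr_id.
  by rewrite ler_wpM2r// (le_trans (kC Dx))// ler_norm.
Qed.

End bounded_multiplier.

Section rampsq_primitive.
Context {R : realType}.
Notation leb := (@lebesgue_measure R).
Implicit Types (s x y M : R).

(** This is ramp^3 / 6, written as a product of differentiable functions. *)
Definition rampcub s x : R := (x - s) * rampsq s x / 3.

Lemma is_derive_rampcub s x : is_derive x 1 (rampcub s) (rampsq s x).
Proof.
have d1 : is_derive x (1 : R) (fun y : R => y - s) 1.
  have := is_derive_affine 1 (- s) x; rewrite (_ : (fun y => _) = (fun u => u - s))//.
  by apply/funext => u; rewrite mul1r.
have := is_deriveZ (3^-1) (is_deriveM d1 (is_derive_rampsq s x)).
rewrite (_ : (_ \*: _) = rampcub s); last first.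
  by apply/funext => y; rewrite /rampcub/= /GRing.scale/= mulrC.
congr (is_derive _ _ _ _); rewrite /GRing.scale/= /rampsq rampE.
by case: ifP => _; field.
Qed.

Lemma Rintegral_patch_rampsq s y M : 0 < M ->
  \int[leb]_(x in `]y, y + M[) rampsq s x = rampcub s (y + M) - rampcub s y.
Proof.
move=> M0; have yM : y < y + M by rewrite ltrDl.
apply: (Rintegral_FTC2_oo yM _ (is_derive_rampcub s)) => x.
apply: differentiable_continuous; apply/derivable1_diffP.
by have [] := is_derive_rampsq s x.
Qed.

End rampsq_primitive.

Section patch_velocity.
Context {R : realType}.
Implicit Types (s t x : R).
Notation leb := (@lebesgue_measure R).
Variables (l r T M : R) (Phi a : R -> R) (rho q : R * R -> R).
Notation Omega := (`]l, r[%classic : set R).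
Notation I := (`[0, T]%classic : set R).
Hypotheses (lr : l < r) (T0 : 0 < T) (M0 : 0 < M).
Hypotheses (C1 : C1_on Omega Phi) (W1 : W1oo Omega Phi).
Hypothesis transport : weak_transport Omega T Phi rho q.
Hypothesis rhoL : in_Lp (leb \x leb)%E (I `*` Omega) +oo rho.
Hypothesis qL : in_Lp (leb \x leb)%E (I `*` Omega) 2%:E q.
Hypothesis mrho : forall t : R, 0 <= t <= T -> measurable_fun Omega (fun x => rho (t, x)).
Hypothesis aO : forall t : R, 0 <= t <= T -> l <= a t /\ a t + M <= r.
Hypothesis rhoE : forall t : R, 0 <= t <= T ->
  \forall x \ae leb, Omega x -> rho (t, x) = \1_(`]a t, a t + M[) x.

Let mO : measurable (Omega : set (measurableTypeR R)).
Proof. exact: measurable_itv. Qed.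

Let mQ := measurable_cylinder l r T.

Let oO : open Omega. Proof. exact: itv_open. Qed.

Let mdPhi : measurable_fun Omega (derive1 Phi).
Proof. exact: (measurable_C1 oO C1).2. Qed.

Let patchO t : 0 <= t <= T -> `]a t, a t + M[%classic `<=` Omega.
Proof. by move=> /aO[la ar]; exact: subset_patch. Qed.

Lemma patch_density_Rintegral t (g : R -> R) : 0 <= t <= T -> measurable_fun Omega g ->
  \int[leb]_(x in Omega) (g x * rho (t, x)) = \int[leb]_(x in `]a t, a t + M[) g x.
Proof.
move=> tT mg.
transitivity (\int[leb]_(x in Omega) (g x * \1_(`]a t, a t + M[%classic) x)).
  rewrite /Rintegral; congr fine; apply: ae_eq_integral => //.
  - by apply/measurable_EFinP; apply: measurable_funM => //; exact: mrho.
  - by apply/measurable_EFinP; apply: measurable_funM => //; exact: measurable_indic.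
  - by apply: aeS (rhoE tT) => x h Ox /=; rewrite h.
rewrite [LHS]Rintegral_mkcond [RHS]Rintegral_mkcond; apply: eq_Rintegral => x _.
rewrite !patchE indicE; case: (boolP (x \in `]a t, a t + M[%classic)) => [xE|_].
  by rewrite mem_set ?mulr1//; apply: (patchO tT); exact/set_mem.
by rewrite mulr0; case: ifP.
Qed.

Let qint : (leb \x leb)%E.-integrable (I `*` Omega) (EFin \o q).
Proof. exact: (in_L2_integrable mQ (cylinder_finite lr T0) qL). Qed.

Section moment.
Variables (psi dpsi : R -> R).
Hypotheses (Dpsi : forall x : R, is_derive x 1 psi (dpsi x)) (cdpsi : continuous dpsi).
Hypothesis bdpsi : bounded_meas l r dpsi.

Let cpsi : continuous psi.
Proof.
move=> x; apply: differentiable_continuous; apply/derivable1_diffP.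
by have [] := Dpsi x.
Qed.

Let flux (z : R * R) := (q z + derive1 Phi z.2) * dpsi z.2 * rho z.

Let flux_integrable : (leb \x leb)%E.-integrable (I `*` Omega) (EFin \o flux).
Proof.
have mproj : forall g : R -> R, measurable_fun Omega g ->
    measurable_fun (I `*` Omega) (fun z : measurableTypeR R * measurableTypeR R => g z.2).
  move=> g mg; apply: (measurable_comp mO _ mg) => //.
  - by move=> _ [z [_ zO] <-].
  - exact: measurable_funS measurable_snd.
have [C [PC _]] := potential_derive1 lr C1 W1.
have jP : (leb \x leb)%E.-integrable (I `*` Omega) (EFin \o (fun z => derive1 Phi z.2)).
  have m2 := mproj _ mdPhi.
  apply: (@ae_bounded_integrable _ _ _ _ _ _ C mQ (cylinder_finite lr T0) m2).
  by apply: aeW => z [_ /itvooP]; exact: PC.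
have [B B0 rB] := in_Lp_oo_bounded rhoL.
have [mdpsi [D dD]] := bdpsi.
have m2 := mproj _ mdpsi.
have dQ : \forall z \ae (leb \x leb)%E, (I `*` Omega) z -> `|dpsi z.2| <= D.
  by apply: aeW => z [_ zO]; exact: dD.
have j2 := integrable_mul_ae_bounded mQ (integrableD mQ qint jP) m2 dQ.
exact: (integrable_mul_ae_bounded mQ j2 rhoL.1 rB).
Qed.

Let moment_increment s t : 0 <= s -> s < t -> t <= T ->
  \int[leb]_(x in `]a t, a t + M[) psi x = \int[leb]_(x in `]a s, a s + M[) psi x -
    \int[leb]_(th in `[s, t]) (\int[leb]_(x in Omega) flux (th, x)).
Proof.
move=> s0 st tT.
have cyl : C1_cyl Omega T (fun z => psi z.2) (fun=> 0) (fun z => dpsi z.2).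
  split.
  - by apply: continuous_subspaceT => z; apply: continuous_comp; [exact: cvg_snd|exact: cpsi].
  - by apply: continuous_subspaceT => z; exact: cvg_cst.
  - by apply: continuous_subspaceT => z; apply: continuous_comp; [exact: cvg_snd|exact: cdpsi].
  - by move=> u x _ _; split => //=; exact: is_derive_cst.
have := transport cyl s0 st tT => /=.
have mpsi : measurable_fun Omega psi.
  by apply: measurable_funS (continuous_measurable_fun cpsi).
have H u : 0 <= u <= T -> \int[leb]_(x in Omega) (rho (u, x) * psi x) =
    \int[leb]_(x in `]a u, a u + M[) psi x.
  move=> uT; rewrite -patch_density_Rintegral//.
  by apply: eq_Rintegral => x _; rewrite mulrC.
rewrite !H ?(le_trans s0 (ltW st)) ?tT ?s0 ?(le_trans (ltW st) tT)//.
have -> : \int[leb]_(th in `[s, t]) (\int[leb]_(x in Omega) (rho (th, x) * 0)) = 0.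
  under eq_Rintegral => th _.
    under eq_Rintegral do rewrite mulr0.
    rewrite Rintegral_cst//= mul0r; over.
  by rewrite Rintegral_cst//= mul0r.
by rewrite oppr0 add0r /flux /= => ->; rewrite opprB addrCA subrr addr0.
Qed.

(** By the transport equation tested with psi, which does not depend on time, the
   moment of psi decreases by the time integral of the flux. The flux is
   integrable in time by Fubini's theorem, so Lebesgue differentiation applies. *)
Lemma moment_derivative : \forall t \ae leb, 0 < t < T ->
  leb.-integrable Omega (EFin \o (fun x => q (t, x))) /\
  is_derive t 1 (fun s => \int[leb]_(x in `]a s, a s + M[) psi x)
    (- \int[leb]_(x in `]a t, a t + M[) ((q (t, x) + derive1 Phi x) * dpsi x)).
Proof.
have jF := integrable_Rintegral_slices flux_integrable.
apply: aeS (aeI (integrable_slices qint) (ae_is_derive_integral jF)) => t [jq dF] tT.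
have /andP[t0 tT'] := tT.
have tI : 0 <= t <= T by rewrite !ltW.
have jqt : leb.-integrable Omega (EFin \o (fun x => q (t, x))).
  by apply: jq; rewrite /= in_itv.
split=> //.
have mqt : measurable_fun Omega (fun x => q (t, x)).
  by apply/measurable_EFinP; exact: measurable_int jqt.
have -> : \int[leb]_(x in `]a t, a t + M[) ((q (t, x) + derive1 Phi x) * dpsi x) =
    \int[leb]_(x in Omega) flux (t, x).
  rewrite -patch_density_Rintegral//; apply: measurable_funM; last exact: bdpsi.1.
  exact: measurable_funD.
have := is_deriveB (is_derive_cst (\int[leb]_(x in `]a 0, a 0 + M[) psi x) t 1) (dF tT).
rewrite sub0r; apply: near_eq_is_derive; near=> s.
have s0 : 0 < s by near: s; exact: lt_nbhsr.
have sT : s < T by near: s; exact: lt_nbhsl.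
by rewrite (moment_increment (lexx 0) s0 (ltW sT)).
Unshelve. all: by end_near. Qed.

End moment.

(** Moment of order one: the patch moves with velocity - c for c the mean of
   u = q + Phi' over it. The moments of the squared ramps can be differentiated
   in two ways, by the chain rule and by moment_derivative; comparing the two
   shows that u and c have the same integral against all ramps, so that u = c
   on the patch. A rigidly moving patch leaves no other choice. *)
Lemma patch_velocity : \forall t \ae leb, 0 < t < T ->
  exists c, [/\ is_derive t 1 a (- c),
    leb.-integrable Omega (EFin \o (fun x => q (t, x))) &
    \forall x \ae leb, a t < x < a t + M -> q (t, x) + derive1 Phi x = c].
Proof.
have D1 x : is_derive (x : R) (1 : R) (@id R) (1 : R) by exact: (is_derive_id x (1 : R)).
have c1 : continuous ((fun=> 1) : R -> R) by move=> x; exact: cvg_cst.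
have m1 := moment_derivative D1 c1 (bounded_meas_cst l r 1).
have mr (n : rat) := moment_derivative (is_derive_rampsq (ratr n)) (@continuous_ramp _ (ratr n))
  (bounded_meas_ramp l r (ratr n)).
apply: aeS (aeI m1 (ae_forall mr)) => t [h1 hr] tT.
have /andP[t0 tT'] := tT; have tI : 0 <= t <= T by rewrite !ltW.
have [jq d1] := h1 tT; have {}hr n := (hr n tT).2.
pose u x := q (t, x) + derive1 Phi x.
have [C [PC _]] := potential_derive1 lr C1 W1.
have jdP : leb.-integrable Omega (EFin \o derive1 Phi).
  apply: (ae_bounded_integrable mO _ mdPhi (C := C)).
    by rewrite /= lebesgue_measure_itv/= lte_fin lr -EFinD ltry.
  by apply: aeW => x /itvooP; exact: PC.
have ju : leb.-integrable Omega (EFin \o u) by exact: (integrableD mO jq jdP).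
have EO := patchO tI.
have mE : measurable (`]a t, a t + M[%classic : set (measurableTypeR R)) by exact: measurable_itv.
have juE : leb.-integrable `]a t, a t + M[ (EFin \o u) := integrableS mO mE EO ju.
pose c := M^-1 * \int[leb]_(x in `]a t, a t + M[) u x.
exists c.
have da : is_derive t 1 a (- c).
  have := is_deriveB (is_deriveZ M^-1 d1) (is_derive_cst (M / 2) t 1).
  rewrite subr0 /GRing.scale/=.
  under [X in _ (_ * - X)]eq_Rintegral do rewrite mulr1.
  rewrite mulrN -/c; apply: near_eq_is_derive; near=> s.
  have := @Rintegral_patch_affine R (a s) M 1 0 M0.
  under eq_Rintegral do rewrite mul1r addr0.
  move=> E; transitivity (M^-1 * \int[leb]_(x in `]a s, a s + M[) x - M / 2) => //.
  by rewrite E mul1r mul0r addr0; field; rewrite gt_eqF.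
split => //.
have jcst (k : R) : leb.-integrable `]a t, a t + M[ (EFin \o (fun=> k)).
  apply: (ae_bounded_integrable mE _ _ (C := `|k|)) => //; last by apply: aeW.
  by have := @lebesgue_measure_patch R (a t) M M0 => /= ->; rewrite ltry.
pose w := (fun x => u x - c) \_ `]a t, a t + M[.
have jw : leb.-integrable setT (EFin \o w).
  apply: integrable_restrictT => //; exact: (integrableB mE juE (jcst c)).
have w0 x : ~ `[l, r]%classic x -> w x = 0.
  move=> nx; rewrite /w patchE memNset// => /EO xO; apply: nx.
  exact: subset_itv_oo_cc xO.
suff W : \forall x \ae leb, w x = 0.
  apply: aeS W => x; rewrite /w patchE => + xE; rewrite mem_set//= => /eqP.
  by rewrite subr_eq0 => /eqP.
apply: (ae_eq0_of_ramps jw w0) => n.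
have E1 : \int[leb]_x (w x * ramp (ratr n) x) =
    \int[leb]_(x in `]a t, a t + M[) ((u x - c) * ramp (ratr n) x).
  rewrite [RHS]Rintegral_mkcond; apply: eq_Rintegral => x _.
  by rewrite /w !patchE; case: ifP => // _; rewrite mul0r.
have E2 : \int[leb]_(x in `]a t, a t + M[) ((u x - c) * ramp (ratr n) x) =
    \int[leb]_(x in `]a t, a t + M[) (u x * ramp (ratr n) x) -
    c * \int[leb]_(x in `]a t, a t + M[) ramp (ratr n) x.
  have jr := integrable_bounded_mul mE EO juE (bounded_meas_ramp l r (ratr n)).
  have jr1 := integrable_bounded_mul mE EO (jcst 1) (bounded_meas_ramp l r (ratr n)).
  have -> : \int[leb]_(x in `]a t, a t + M[) (u x * ramp (ratr n) x) =
      \int[leb]_(x in `]a t, a t + M[) (ramp (ratr n) x * u x).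
    by apply: eq_Rintegral => x _; rewrite mulrC.
  have -> : \int[leb]_(x in `]a t, a t + M[) ramp (ratr n) x =
      \int[leb]_(x in `]a t, a t + M[) (ramp (ratr n) x * 1).
    by apply: eq_Rintegral => x _; rewrite mulr1.
  rewrite -RintegralZl// -RintegralB//; last exact: (integrableZl mE c jr1).
  by apply: eq_Rintegral => x _; ring.
have dK : is_derive t 1 (fun s => rampcub (ratr n) (a s + M) - rampcub (ratr n) (a s))
    (- \int[leb]_(x in `]a t, a t + M[) (u x * ramp (ratr n) x)).
  have := hr n; rewrite (_ : (fun s => _) = (fun s => rampcub (ratr n) (a s + M) -
    rampcub (ratr n) (a s)))//.
  by apply/funext => s; rewrite Rintegral_patch_rampsq.
have dK' : is_derive t 1 (fun s => rampcub (ratr n) (a s + M) - rampcub (ratr n) (a s))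
    (rampsq (ratr n) (a t + M) * (- c) - rampsq (ratr n) (a t) * (- c)).
  have daM : is_derive t 1 (fun s => a s + M) (- c).
    by have := is_deriveD da (is_derive_cst M t 1); rewrite addr0.
  apply: is_deriveB.
    have h := is_derive_rampcub (ratr n) (a t + M).
    exact: (@is_derive1_comp _ (rampcub (ratr n)) (fun s => a s + M) _ _ _ h daM).
  have h := is_derive_rampcub (ratr n) (a t).
  exact: (@is_derive1_comp _ (rampcub (ratr n)) a _ _ _ h da).
rewrite E1 E2 Rintegral_patch_ramp//.
have := is_derive_derive1 dK; rewrite (is_derive_derive1 dK').
move: (\int[leb]_(x in _) _) => v; move: (rampsq _ _) (rampsq _ (a t)) => v1 v2 E.
by rewrite -[v]opprK -E; ring.
Unshelve. all: by end_near. Qed.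

End patch_velocity.

(** * The pressure on a patch *)

Section pressure.
Context {R : realType}.
Notation leb := (@lebesgue_measure R).
Implicit Types (x y s t c k : R).
Variables (l r : R) (p q : R -> R).
Notation Omega := (`]l, r[%classic : set R).
Hypothesis lr : l < r.
Hypotheses (jp : leb.-integrable Omega (EFin \o p)) (jq : leb.-integrable Omega (EFin \o q)).
Hypothesis pq : weak_deriv Omega p q.

Let mO : measurable (Omega : set (measurableTypeR R)).
Proof. exact: measurable_itv. Qed.

(** P is the primitive of q with the value of p at one of its Lebesgue points. *)
Lemma continuous_representative : exists P : R -> R,
  [/\ {within `[l, r], continuous P}, \forall x \ae leb, Omega x -> p x = P x &
      forall x y, l <= x -> x < y -> y <= r -> P y - P x = \int[leb]_(z in `]x, y[) q z].
Proof.
pose f := q \_ Omega.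
have jf : leb.-integrable setT (EFin \o f) by exact: integrable_restrictT.
have jfI (a b : R) (i j : bool) :
    leb.-integrable [set` Interval (BSide i a) (BSide j b)] (EFin \o f).
  by apply: (integrableS _ _ _ jf) => //; exact: measurable_itv.
pose P0 x := \int[leb]_(z in `[l, x]) f z.
have cP0 : {within `[l, r], continuous P0}.
  exact: (parameterized_integral_continuous (ltW lr) (jfI l r true false)).
have inc x y : l <= x -> x < y -> y <= r -> P0 y - P0 x = \int[leb]_(z in `]x, y[) q z.
  move=> lx xy yr.
  rewrite /P0 (@Rintegral_itvB R f (BLeft l) (BRight y) x)//; last first.
    by rewrite bnd_simp ltW.
  rewrite -Rintegral_itv_bndo_bndc//; apply: eq_Rintegral => z /set_mem/=.
  rewrite in_itv/= => /andP[xz zy]; rewrite /f patchE mem_set//= in_itv/=.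
  by rewrite (le_lt_trans lx xz) (lt_le_trans zy yr).
have lf : locally_integrable [set: R] (p \_ Omega) by exact: integrable_locally_restrict.
have Lp := lebesgue_differentiation lf.
have [s0 /andP[ls0 s0r] Ls0] := ae_exists_itv lr Lp.
have incp x y : l < x -> x < y -> y < r -> lebesgue_pt (p \_ Omega) x ->
    lebesgue_pt (p \_ Omega) y -> p y - p x = P0 y - P0 x.
  move=> lx xy yr Lx Ly.
  rewrite (weak_deriv_increment jp jq pq lx (ltW xy) yr Lx Ly) inc ?ltW//.
  have xyO : `[x, y] `<=` Omega.
    by apply: subset_itv; rewrite bnd_simp.
  have jqI : leb.-integrable `[x, y] (EFin \o q) := integrableS mO (measurable_itv _) xyO jq.
  rewrite -Rintegral_itv_obnd_cbnd; last first.
    by apply: integrableS jqI => //; apply: subset_itv; rewrite bnd_simp.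
  rewrite Rintegral_itv_bndo_bndc//.
  by apply: integrableS jqI => //; apply: subset_itv; rewrite bnd_simp.
exists (fun x => p s0 - P0 s0 + P0 x); split.
- move=> x; apply: cvgD; [exact: cvg_cst|exact: cP0].
- apply: aeS Lp => x Lx /itvooP/andP[lx xr].
  have [xs|xs|->] := ltgtP x s0; last by rewrite subrK.
    by have := incp _ _ lx xs s0r Lx Ls0; move: (P0 s0) (P0 x) => u v; lra.
  by have := incp _ _ ls0 xs xr Ls0 Lx; move: (P0 s0) (P0 x) => u v; lra.
- by move=> x y lx xy yr; rewrite -(inc _ _ lx xy yr) /=; ring.
Qed.

End pressure.

Section bulk.
Context {R : realType}.
Notation leb := (@lebesgue_measure R).
Implicit Types (x y s t c k : R).
Variables (l r a b c : R) (Phi P q : R -> R).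
Notation Omega := (`]l, r[%classic : set R).
Notation E := (`]a, b[%classic : set R).
Hypotheses (lr : l < r) (C1 : C1_on Omega Phi) (W1 : W1oo Omega Phi).
Hypotheses (la : l <= a) (ab : a < b) (br : b <= r).
Hypothesis cP : {within `[l, r], continuous P}.
Hypothesis Pq : forall x y, l <= x -> x < y -> y <= r ->
  P y - P x = \int[leb]_(z in `]x, y[) q z.
Hypothesis jq : leb.-integrable Omega (EFin \o q).
Hypothesis qE : \forall x \ae leb, a < x < b -> q x + derive1 Phi x = c.

Let EO x : a < x < b -> l < x < r.
Proof. by move=> /andP[ax xb]; rewrite (le_lt_trans la ax) (lt_le_trans xb br). Qed.

(** On the patch the derivative q of the pressure is c - Phi'. *)
Lemma pressure_in_bulk : exists k, forall x, a < x < b -> P x = c * x + k - Phi x.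
Proof.
have inc x y : a < x -> x < y -> y < b -> P y - P x = c * (y - x) - (Phi y - Phi x).
  move=> ax xy yb; have xb := lt_trans xy yb; have ay := lt_trans ax xy.
  have xO : l < x < r by apply: EO; rewrite ax.
  have yO : l < y < r by apply: EO; rewrite ay.
  have /andP[lx xr] := xO; have /andP[ly yr] := yO.
  rewrite (Pq (ltW lx) xy (ltW yr)).
  have sub : `[x, y] `<=` Omega by apply: subset_itv; rewrite bnd_simp.
  have cd : {within `[x, y], continuous (derive1 Phi)}.
    apply: continuous_in_subspaceT => z /set_mem/sub/itvooP zO.
    exact: (potential_derive1_cont C1 zO).
  have jd : leb.-integrable `[x, y] (EFin \o derive1 Phi).
    by apply: continuous_compact_integrable => //; exact: segment_compact.
  have cPhi : derivable_oo_LRcontinuous Phi x y.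
    split.
    - by move=> z zI; apply: C1.1; apply: sub; apply: subset_itv_oo_cc zI.
    - apply: cvg_at_right_filter; exact: (potential_cont C1 xO).
    - apply: cvg_at_left_filter; exact: (potential_cont C1 yO).
  have mxy : measurable (`]x, y[%classic : set (measurableTypeR R)) by exact: measurable_itv.
  have oc : `]x, y[ `<=` `[x, y] by exact: subset_itv_oo_cc.
  have jdo : leb.-integrable `]x, y[ (EFin \o derive1 Phi).
    by apply: integrableS jd => //; exact: measurable_itv.
  have FTC : \int[leb]_(z in `]x, y[) derive1 Phi z = Phi y - Phi x.
    transitivity (\int[leb]_(z in `[x, y]) derive1 Phi z).
      rewrite Rintegral_itv_bndo_bndc.
        by rewrite Rintegral_itv_obnd_cbnd//; apply: integrableS jd => //; apply: subset_itv; rewrite bnd_simp.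
      by [].
    by rewrite /Rintegral (continuous_FTC2 xy cd cPhi).
  rewrite -FTC.
  have jcst : leb.-integrable `]x, y[ (EFin \o (fun=> c)).
    apply: (ae_bounded_integrable mxy _ _ (C := `|c|)) => //; last by apply: aeW.
    by rewrite /= lebesgue_measure_itv/= lte_fin xy -EFinD ltry.
  transitivity (\int[leb]_(z in `]x, y[) (c - derive1 Phi z)).
    rewrite /Rintegral; congr fine; apply: ae_eq_integral => //.
    - by apply: (measurable_int leb); apply: integrableS jq => //; exact: subset_trans sub.
    - exact: (measurable_int leb (integrableB mxy jcst jdo)).
    - apply: aeS qE => z + /=; rewrite in_itv/= => H /andP[xz zy].
      by rewrite -H ?addrK// (lt_trans ax xz) (lt_trans zy yb).
  rewrite RintegralB// Rintegral_cst//= lebesgue_measure_itv/= lte_fin xy.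
  by rewrite -EFinD.
pose m := (a + b) / 2; have mI : a < m < b by rewrite /m; apply/andP; split; move: ab; lra.
exists (P m - c * m + Phi m) => x /andP[ax xb]; have /andP[am mb] := mI.
have [xm|xm|->] := ltgtP x m; last by ring.
  by have := inc _ _ ax xm mb; rewrite mulrBr; move: (c * m) (c * x) => u v; lra.
by have := inc _ _ am xm xb; rewrite mulrBr; move: (c * m) (c * x) => u v; lra.
Qed.

(** On the patch P + Phi is the affine function c x + k, and (c x + k) psi'' is
   the derivative of (c x + k) psi' - c psi, which vanishes at both ends. *)
Lemma bulk_law_patch : bulk_law Phi P E.
Proof.
have [k Pk] := pressure_in_bulk.
have oE : open E by exact: itv_open.
rewrite /bulk_law (interior_id _).1// => psi tpsi.
have sm := test_fun_smooth tpsi.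
have sm2 := smooth_derive1 (smooth_derive1 sm).
have cpsi2 : continuous (derive1n 2 psi) by exact: smooth_continuous sm2.
have mE : measurable (E : set (measurableTypeR R)) by exact: measurable_itv.
pose W x := (c * x + k) * derive1 psi x - c * psi x.
have dW x : is_derive x 1 W ((c * x + k) * derive1n 2 psi x).
  have d0 : is_derive x 1 psi (derive1 psi x).
    by apply: derivable_is_derive; exact: smooth_derivable.
  have d1 : is_derive x 1 (derive1 psi) (derive1n 2 psi x).
    by apply: derivable_is_derive; apply: smooth_derivable; exact: smooth_derive1.
  have := is_deriveB (is_deriveM (is_derive_affine c k x) d1) (is_deriveZ c d0).
  congr (is_derive _ _ _ _); rewrite /GRing.scale/=; ring.
have W0 x : ~ E x -> W x = 0.
  move=> nEx; have out f : test_fun E f -> f x = 0.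
    by move=> [_ [K [_ KE] K0]]; apply: K0 => /KE.
  by rewrite /W (out _ tpsi) (out _ (test_fun_derive1 tpsi)) !mulr0 subrr.
have caff : continuous (fun x => (c * x + k) * derive1n 2 psi x).
  move=> x; have ca : {for x, continuous (fun y : R => c * y + k)}.
    apply: differentiable_continuous; apply/derivable1_diffP.
    by have [] := is_derive_affine c k x.
  exact: (cvgM ca (cpsi2 x)).
have I0 : \int[leb]_(x in E) ((c * x + k) * derive1n 2 psi x) = 0.
  rewrite (Rintegral_FTC2_oo ab caff dW) !W0 ?subrr//= in_itv/= ltxx ?andbF//.
have Eab : E `<=` `[a, b] by exact: subset_itv_oo_cc.
have jE (f : R -> R) : continuous f -> leb.-integrable E (EFin \o f).
  move=> cf; have jc : leb.-integrable `[a, b] (EFin \o f).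
    by apply: continuous_compact_integrable; [exact: segment_compact|exact: continuous_subspaceT].
  by apply: integrableS jc.
have jaff := jE _ caff; have j2 := jE _ cpsi2.
have jPhi : leb.-integrable E (EFin \o (fun x => Phi x * derive1n 2 psi x)).
  apply: (integrable_bounded_mul mE _ j2 (potential_bounded_meas lr C1 W1)).
  by move=> x; rewrite /= !in_itv/=; exact: EO.
have -> : \int[leb]_(x in E) (P x * derive1n 2 psi x) =
    \int[leb]_(x in E) ((c * x + k) * derive1n 2 psi x - Phi x * derive1n 2 psi x).
  apply: eq_Rintegral => x /set_mem/=; rewrite in_itv/= => xE.
  by rewrite Pk// mulrBl.
by rewrite RintegralB// I0 sub0r opprK.
Qed.

Let mean_value u v : a <= u -> u < v -> v <= b ->
  exists2 z, u < z < v & P v - P u = (c - derive1 Phi z) * (v - u).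
Proof.
move=> au uv vb; have [k Pk] := pressure_in_bulk.
have dP z : z \in `]u, v[ -> is_derive z 1 P (c - derive1 Phi z).
  rewrite in_itv/= => /andP[uz zv].
  have zE : a < z < b by rewrite (le_lt_trans au uz) (lt_le_trans zv vb).
  have dPhi : is_derive z 1 Phi (derive1 Phi z).
    by apply: derivable_is_derive; apply: C1.1; apply/itvooP; exact: EO.
  have := is_deriveB (is_derive_affine c k z) dPhi.
  apply: near_eq_is_derive; near=> y; rewrite Pk//.
  apply/andP; split; near: y; [apply: lt_nbhsr|apply: lt_nbhsl]; by case/andP: zE.
have cPuv : {within `[u, v], continuous P}.
  apply: continuous_subspaceW cP; apply: subset_itv; rewrite bnd_simp.
    exact: le_trans au.
  exact: le_trans br.
by have [z zI Ez] := MVT uv dP cPuv; exists z; first by move: zI; rewrite in_itv.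
Unshelve. all: by end_near. Qed.

(** Difference quotients at the end points are values of c - Phi' at points of the
   patch in between, by the mean value theorem. *)
Lemma inner_deriv_patch x g : x = a \/ x = b -> drift_at Omega Phi x g ->
  inner_deriv E P x (c - g).
Proof.
move=> xab dg; rewrite /inner_deriv (interior_id _).1; last exact: itv_open.
apply/cvgrPdist_le => e e0.
have /cvgrPdist_le/(_ e e0)[d /= d0 H] := dg.
exists d => //= y /= yd yE.
have yI : a < y < b by move: yE; rewrite in_itv.
have key z : a < z < b -> `|x - z| <= `|x - y| -> 
    (P y - P x) / (y - x) = c - derive1 Phi z ->
    `|c - g - (P y - P x) / (y - x)| <= e.
  move=> zI zy ->; have -> : c - g - (c - derive1 Phi z) = derive1 Phi z - g by ring.
  rewrite distrC; apply: H; first exact: le_lt_trans zy yd.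
  by rewrite /= in_itv/=; exact: EO.
case/andP: yI => ay yb; case: xab => xE; rewrite xE in key *.
  have [z /andP[az zy] E] := mean_value (lexx a) ay (ltW yb).
  apply: (key z); first by rewrite az (lt_trans zy yb).
    by rewrite !ltr0_norm ?subr_lt0//; lra.
  by rewrite E mulfK// gt_eqF// subr_gt0.
have [z /andP[yz zb] E] := mean_value (ltW ay) yb (lexx b).
apply: (key z); first by rewrite (lt_trans ay yz).
  by rewrite !gtr0_norm ?subr_gt0//; lra.
have -> : P y - P b = - (P b - P y) by rewrite opprB.
by rewrite E -mulrN opprB mulfK// lt_eqF// subr_lt0.
Qed.

End bulk.

(** * The Hele-Shaw flow *)

Section moving_patches.
Context {R : realType}.
Notation leb := (@lebesgue_measure R).
Implicit Types (x s t a b : R).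

Lemma closure_itv_sub (a b : R) : closure `]a, b[%classic `<=` (`[a, b]%classic : set R).
Proof.
have -> : (`[a, b]%classic : set R) = closure `[a, b]%classic.
  by apply/closure_id; exact: interval_closed.
by apply: closureS; exact: subset_itv_oo_cc.
Qed.

Lemma topo_boundary_itv (a b x : R) : topo_boundary `]a, b[%classic x -> x = a \/ x = b.
Proof.
move=> [/closure_itv_sub]; rewrite (interior_id _).1; last exact: itv_open.
rewrite /= !in_itv/= => /andP[ax xb] nx.
have [xa|ax'|->] := ltgtP x a; [by rewrite leNgt xa in ax| |by left].
have [xb'|bx|->] := ltgtP x b; [|by rewrite leNgt bx in xb|by right].
by case: nx; rewrite ax'.
Qed.

Lemma outward_normal_left (a b : R) : a < b -> outward_normal `]a, b[%classic a (-1).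
Proof.
move=> ab; have ev : \forall h \near (0:R)^'+, a < a + h < b.
  near=> h; have h0 : 0 < h by near: h; exact: nbhs_right_gt.
  rewrite ltrDl h0/= -ltrBrDl; near: h; apply: nbhs_right_lt.
  by rewrite subr_gt0.
split; first by right.
- split; last by rewrite (interior_id _).1; [rewrite /= in_itv/= ltxx|exact: itv_open].
  move=> B [e /= e0 eB]; have [d d0 dP] := near_right0P ev.
  pose h := Num.min e d / 2.
  have m0 : 0 < Num.min e d by rewrite lt_min e0.
  have h0 : 0 < h by rewrite divr_gt0.
  have : h < Num.min e d by rewrite /h ltr_pdivrMr// ltr_pMr// ltr1n.
  rewrite lt_min => /andP[he hd].
  exists (a + h); split; first by rewrite /= in_itv/=; exact: dP.
  by apply: eB; rewrite /ball_/= opprD addrA subrr add0r normrN gtr0_norm.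
- apply: filterS2 (nbhs_right_gt 0) ev => h h0 hI; rewrite !mulN1r opprK /= !in_itv/=.
  by split=> //; rewrite ltrDl ltrNr oppr0 ltNge (ltW h0).
Unshelve. all: by end_near. Qed.

Lemma outward_normal_right (a b : R) : a < b -> outward_normal `]a, b[%classic b 1.
Proof.
move=> ab; have ev : \forall h \near (0:R)^'+, a < b - h < b.
  near=> h; have h0 : 0 < h by near: h; exact: nbhs_right_gt.
  rewrite ltrBlDr ltrDl h0 andbT ltrBrDl -ltrBrDr; near: h; apply: nbhs_right_lt.
  by rewrite subr_gt0.
split; first by left.
- split; last by rewrite (interior_id _).1; [rewrite /= in_itv/= ltxx andbF|exact: itv_open].
  move=> B [e /= e0 eB]; have [d d0 dP] := near_right0P ev.
  pose h := Num.min e d / 2.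
  have m0 : 0 < Num.min e d by rewrite lt_min e0.
  have h0 : 0 < h by rewrite divr_gt0.
  have : h < Num.min e d by rewrite /h ltr_pdivrMr// ltr_pMr// ltr1n.
  rewrite lt_min => /andP[he hd].
  exists (b - h); split; first by rewrite /= in_itv/=; exact: dP.
  by apply: eB; rewrite /ball_/= opprB addrA [b + h]addrC addrK gtr0_norm.
- apply: filterS2 (nbhs_right_gt 0) ev => h h0 hI; rewrite !mul1r /= !in_itv/=.
  by split=> //; rewrite [_ < b]ltNge lerDl (ltW h0) andbF.
Unshelve. all: by end_near. Qed.

(** A patch of constant length is translated with velocity - c, and the one-sided
   derivative of P at either end is c - g, so that V = - nu c = nu (- d - g). *)
Lemma interface_law_patch (Omega : set R) (Phi P a : R -> R) (M t c : R) : 0 < M ->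
  is_derive t 1 a (- c) ->
  (forall x, x = a t \/ x = a t + M -> exists g, drift_at Omega Phi x g) ->
  (forall x g, x = a t \/ x = a t + M -> drift_at Omega Phi x g ->
     inner_deriv `]a t, a t + M[%classic P x (c - g)) ->
  interface_law Omega Phi P (fun s => `]a s, a s + M[%classic) t.
Proof.
move=> M0 da dg idv x xb; have aM s : a s < a s + M by rewrite ltrDl.
have xE := topo_boundary_itv xb; have [g gP] := dg _ xE.
have daM : is_derive t 1 (fun s => a s + M) (- c).
  by have := is_deriveD da (is_derive_cst M t 1); rewrite addr0.
case: (xE) => xe.
- rewrite xe in xE gP *; exists (-1), c, (c - g), g; split.
  + exact: outward_normal_left.
  + exists a; split => //; last by rewrite mulN1r.
    by near=> s; exact: outward_normal_left.
  + exact: idv.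
  + exact: gP.
  + by ring.
- rewrite xe in xE gP *; exists 1, (- c), (c - g), g; split.
  + exact: outward_normal_right.
  + exists (fun s => a s + M); split => //; last by rewrite mul1r.
    by near=> s; exact: outward_normal_right.
  + exact: idv.
  + exact: gP.
  + by ring.
Unshelve. all: by end_near. Qed.

End moving_patches.

Theorem theorem1p3 (R : realType) (l r T : R)
    (Phi1 Phi2 : R -> R) (a10 b10 a20 b20 : R)
    (mu1 mu2 : R -> {measure set R -> \bar R}) (rho1 rho2 p : R * R -> R) :
  let Omega : set R := `]l, r[%classic in
  let rho01 : R -> R := \1_(`]a10, b10[%classic) in
  let rho02 : R -> R := \1_(`]a20, b20[%classic) in
  let M1 := b10 - a10 in
  let M2 := b20 - a20 in
  l < r -> 0 < T ->
  C1_on Omega Phi1 -> W1oo Omega Phi1 ->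
  C1_on Omega Phi2 -> W1oo Omega Phi2 ->
  (forall x, Omega x -> - derive1 Phi1 x >= - derive1 Phi2 x) ->
  distr_deriv2_ge0 Omega Phi1 -> distr_deriv2_ge0 Omega Phi2 ->
  a10 < b10 -> `]a10, b10[%classic `<=` Omega ->
  a20 < b20 -> `]a20, b20[%classic `<=` Omega ->
  (forall x1 x2, 0 < rho01 x1 -> 0 < rho02 x2 -> x1 >= x2) ->
  ((M1 + M2)%:E < lebesgue_measure Omega)%E ->
  weak_solution Omega T Phi1 Phi2 M1 M2 rho01 rho02 mu1 mu2 rho1 rho2 p ->
  JKO_limit Omega T Phi1 Phi2 M1 M2 rho01 rho02 mu1 mu2 ->
  exists a1 b1 a2 b2 : R -> R,
    (forall t, 0 < t <= T ->
       is_patch Omega (fun x => rho1 (t, x)) (a1 t) (b1 t) /\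
       is_patch Omega (fun x => rho2 (t, x)) (a2 t) (b2 t)) /\
    hele_shaw_two_phase Omega T Phi1 Phi2 rho1 rho2 p
      (fun t => `]a1 t, b1 t[%classic) (fun t => `]a2 t, b2 t[%classic).
Proof.
move=> Omega rho01 rho02 M1 M2 lr T0 C11 W11 C12 W12 drift cvx1 cvx2 ab1 ab1O ab2 ab2O
  sorted0 M12 [D1 D2 _ slack [q [[pL qL pq] tr1 tr2]]] lim.
have M10 : 0 < M1 by rewrite subr_gt0.
have M20 : 0 < M2 by rewrite subr_gt0.
have M12' : M1 + M2 < r - l.
  by move: M12; rewrite /Omega /= lebesgue_measure_itv/= lte_fin lr -EFinD lte_fin.
have [[[PM1 _] _] rL1 dens1 _] := D1.
have [[[PM2 _] _] rL2 dens2 _] := D2.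
pose a1 t := patch_left M1 (\int[@lebesgue_measure R]_(x in Omega) (x * rho1 (t, x))).
pose a2 t := patch_left M2 (\int[@lebesgue_measure R]_(x in Omega) (x * rho2 (t, x))).
have pat t (tT : 0 <= t <= T) := limit_patches lr C11 W11 C12 W12 drift cvx1 cvx2 ab1 ab1O
  ab2 ab2O sorted0 M12' lim tT (PM1 t tT) (PM2 t tT) (dens1 t tT) (dens2 t tT).
have la2 t : 0 <= t <= T -> l <= a2 t by move=> tT; case: (pat t tT).
have a21 t : 0 <= t <= T -> a2 t + M2 <= a1 t by move=> tT; case: (pat t tT).
have a1r t : 0 <= t <= T -> a1 t + M1 <= r by move=> tT; case: (pat t tT).
have la1 t : 0 <= t <= T -> l <= a1 t.
  by move=> tT; rewrite (le_trans (la2 t tT))// (le_trans _ (a21 t tT))// lerDl ltW.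
have a2r t : 0 <= t <= T -> a2 t + M2 <= r.
  by move=> tT; rewrite (le_trans (a21 t tT))// (le_trans _ (a1r t tT))// lerDl ltW.
have rE1 t : 0 <= t <= T -> \forall x \ae @lebesgue_measure R, Omega x ->
    rho1 (t, x) = \1_(`]a1 t, a1 t + M1[) x by move=> tT; case: (pat t tT).
have rE2 t : 0 <= t <= T -> \forall x \ae @lebesgue_measure R, Omega x ->
    rho2 (t, x) = \1_(`]a2 t, a2 t + M2[) x by move=> tT; case: (pat t tT).
have tI t : 0 < t <= T -> 0 <= t <= T by move=> /andP[t0 ->]; rewrite ltW.
exists a1, (fun t => a1 t + M1), a2, (fun t => a2 t + M2); split.
  move=> t /tI tT; split; split.
  - by rewrite ltrDl.
  - exact: subset_patch (la1 t tT) (a1r t tT).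
  - exact: rE1.
  - by rewrite ltrDl.
  - exact: subset_patch (la2 t tT) (a2r t tT).
  - exact: rE2.
have indic1 (a b x y : R) : y = \1_(`]a, b[) x -> (`]a, b[%classic x <-> y = 1).
  move=> ->; rewrite indicE; case: (boolP (x \in `]a, b[%classic)) => [/set_mem|/negP] xI //.
  by split => [/mem_set|/eqP]//; rewrite /= eq_sym oner_eq0.
split.
- move=> t /tI tT; apply: aeS (aeI (rE1 t tT) (rE2 t tT)) => x [e1 e2] Ox.
  by split; apply: indic1; [exact: e1|exact: e2].
- apply: aeS slack => z h /h[_ /eqP]; rewrite mulf_eq0 => /orP[/eqP//|].
  by rewrite -addrA -opprD subr_eq0 => /eqP <- [].
have m1 t (tT : 0 <= t <= T) := (dens1 t tT).1.
have m2 t (tT : 0 <= t <= T) := (dens2 t tT).1.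
have v1 := patch_velocity lr T0 M10 C11 W11 tr1 rL1 qL m1
  (fun t tT => conj (la1 t tT) (a1r t tT)) rE1.
have v2 := patch_velocity lr T0 M20 C12 W12 tr2 rL2 qL m2
  (fun t tT => conj (la2 t tT) (a2r t tT)) rE2.
have jp := integrable_slices
  (in_L2_integrable (measurable_cylinder l r T) (cylinder_finite lr T0) pL).
apply: aeS (aeI (aeI v1 v2) (aeI jp pq)) => t [[h1 h2] [hp hpq]] tT.
have /andP[t0 tT'] := tT; have tI' : 0 <= t <= T by rewrite !ltW.
have [c1 [da1 jq u1]] := h1 tT; have [c2 [da2 _ u2]] := h2 tT.
have jpt : (@lebesgue_measure R).-integrable Omega (EFin \o (fun x => p (t, x))).
  by apply: hp; rewrite /= in_itv.
have [P [cP pP incP]] := continuous_representative lr jpt jq (hpq tI').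
have b1 : a1 t < a1 t + M1 by rewrite ltrDl.
have b2 : a2 t < a2 t + M2 by rewrite ltrDl.
have id1 := inner_deriv_patch C11 (la1 t tI') b1 (a1r t tI') cP incP jq u1.
have id2 := inner_deriv_patch C12 (la2 t tI') b2 (a2r t tI') cP incP jq u2.
have g1 x : x = a1 t \/ x = a1 t + M1 -> exists g, drift_at Omega Phi1 x g.
  move=> xE; apply: (potential_drift_at lr C11 W11 cvx1).
  case: xE => ->; first by rewrite la1//= (le_trans (ltW b1))// a1r.
  by rewrite a1r// andbT (le_trans _ (ltW b1))// la1.
have g2 x : x = a2 t \/ x = a2 t + M2 -> exists g, drift_at Omega Phi2 x g.
  move=> xE; apply: (potential_drift_at lr C12 W12 cvx2).
  case: xE => ->; first by rewrite la2//= (le_trans (ltW b2))// a2r.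
  by rewrite a2r// andbT (le_trans _ (ltW b2))// la2.
exists P; split.
- split; last exact: pP.
  apply: continuous_subspaceW cP; exact: closure_itv_sub.
- split.
    exact: (bulk_law_patch lr C11 W11 (la1 t tI') b1 (a1r t tI') incP jq u1).
  exact: (bulk_law_patch lr C12 W12 (la2 t tI') b2 (a2r t tI') incP jq u2).
- by split; [exact: (interface_law_patch M10 da1 g1 id1)
    |exact: (interface_law_patch M20 da2 g2 id2)].
- (* where the patches touch, the gap a1 - a2 - M2 >= 0 has a minimum in time, so
     both patches have the same velocity: c1 = c2 *)
  move=> x /topo_boundary_itv x1 /topo_boundary_itv x2.
  have [g1' G1] := g1 _ x1; have [g2' G2] := g2 _ x2.
  exists (c1 - g1'), (c2 - g2'), g1', g2'; split => //; [exact: id1|exact: id2|].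
  rewrite !subrK.
  have x12 : a1 t - a2 t - M2 = 0.
    have := a21 t tI'; move: b1 b2 x1 x2.
    by move: (a1 t) (a2 t) => y1 y2 h3 h4 [->|->] [e|e] h5; lra.
  have dh : is_derive t 1 (fun s => a1 s - a2 s - M2) (- c1 - - c2 - 0).
    exact: is_deriveB (is_deriveB da1 da2) (is_derive_cst M2 t 1).
  have hpos : \forall s \near t, 0 <= a1 s - a2 s - M2.
    near=> s; rewrite -addrA -opprD subr_ge0; apply: a21; apply/andP; split; apply: ltW; near: s;
      [exact: lt_nbhsr|exact: lt_nbhsl].
  have := is_derive_min0 dh hpos x12.
  by rewrite subr0 opprK => /eqP; rewrite addrC subr_eq0 => /eqP ->.
Unshelve. all: by end_near. Qed.
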